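(* Let $d\ge2$. Let $f:\widehat{\mathcal{K}}^d_s\to[0,\infty)$ be measurable and rotation invariant. Let $X'$ be an isotropic (random) tessellation of $\mathbb{S}^d$ with intensity $\gamma_{X'}\in(0,\infty)$. If $Z_0$ denotes the spherical Crofton cell and $Z$ the typical cell of $X'$, then $$\mathbb{E}[f(Z_0)]=\gamma_{X'}\,\mathbb{E}\left[f(Z)\,\sigma_d^\circ(Z)\right].$$ If $X'$ is the hypersphere tessellation induced by a Poisson point process $X$ on $\mathbb{S}^d$ (with finite non-zero intensity measure) whose intensity measure has no point masses, then $$\mathbb{E}[X'(\mathcal{C}^d)]=h_d\left(\mathbb{E}[X(\mathbb{S}^d)]\right),\qquad h_d(t)=(-1)^{d+1}e^{-t}+2\sum_{i=0}^{\lfloor d/2\rfloor}\frac{t^{d-2i}}{(d-2i)!}.$$ In particular, if $X$ is isotropic with intensity $\gamma_s$, then $\gamma_{X'}=h_d(\gamma_s)$.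
   Context: $\mathbb{S}^d$ is the unit sphere in $\mathbb{R}^{d+1}$ ($d\ge2$), $\sigma_d^\circ$ its normalized (probability) spherical Lebesgue measure, $\mathsf p\in\mathbb{S}^d$ a fixed point, $o$ the zero vector, $\lambda$ the Haar probability measure on $\mathrm{SO}(d+1)$. $\overline{\mathcal{K}}^d_s$ is the set of intersections of $\mathbb{S}^d$ with a nonempty closed convex cone in $\mathbb{R}^{d+1}$ that is not a linear subspace; $\widehat{\mathcal{K}}^d_s=\overline{\mathcal{K}}^d_s\cup\{\mathbb{S}^d\}$; $\mathcal{C}^d$ is the space of nonempty compact subsets of $\mathbb{S}^d$ (with the topology of the Hausdorff metric). A function $f$ on $\widehat{\mathcal{K}}^d_s$ is rotation invariant if $f(\varrho K)=f(K)$ for all $\varrho\in\mathrm{SO}(d+1)$ and all $K$. A tessellation is a finite collection of spherical polytopes (intersections of $\mathbb{S}^d$ with polyhedral cones that are not linear subspaces) with nonempty interiors that cover $\mathbb{S}^d$ and have pairwise disjoint interiors, or the trivial tessellation $\{\mathbb{S}^d\}$. A random tessellation $X'$ is regarded as a point process on $\widehat{\mathcal{K}}^d_s\subset\mathcal{C}^d$ (its cells), so $X'(\mathcal{C}^d)$ is the number of cells; it is isotropic if its distribution is invariant under $\mathrm{SO}(d+1)$; its intensity is $\gamma_{X'}=\mathbb{E}[X'(\mathcal{C}^d)]$. The Crofton cell $Z_0$ is the a.s. unique cell containing $\mathsf p$ in its interior. Let $c_s:\mathcal{C}^d\to\mathbb{S}^d\cup\{o\}$ be a measurable centre function with $c_s(\varrho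 C)=\varrho c_s(C)$ for all $\varrho\in\mathrm{SO}(d+1)$. Let $\kappa(\mathsf p,\cdot)$ be the invariant probability measure on the stabilizer of $\mathsf p$ in $\mathrm{SO}(d+1)$, $\kappa(x,\cdot)$ for $x\in\mathbb{S}^d$ its image under $\varrho\mapsto\varrho_x\circ\varrho$ for any rotation $\varrho_x$ with $\varrho_x\mathsf p=x$, and $\kappa(o,\cdot)=\lambda$. The typical cell $Z$ has distribution $$\mathbb{P}(Z\in\cdot)=\frac1{\gamma_{X'}}\mathbb{E}\int_{\widehat{\mathcal{K}}^d_s}\int_{\mathrm{SO}(d+1)}\mathbf 1\{\varphi^{-1}K\in\cdot\}\,\kappa(c_s(K),d\varphi)\,X'(dK).$$ The hypersphere tessellation induced by $X$ partitions $\mathbb{S}^d$ by the great hyperspheres $\mathbb{S}^d\cap x^\perp$, $x\in X$ (the trivial tessellation if $X$ is empty). The intensity measure of $X$ is $\mathbb{E}[X(\cdot)]$; it has no point masses if $\mathbb{E}[X(\{x\})]=0$ for all $x\in\mathbb{S}^d$. A Poisson process $X$ is isotropic with intensity $\gamma_s\in(0,\infty)$ if its intensity measure is $\gamma_s\sigma_d^\circ$.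
   Formalization: The cell-count formula is proved when X' is isotropic or when the intensity measure of X vanishes on every great hypersphere; ''no point masses'' alone is not enough (e.g. d=2, uniform intensity on one great circle gives mean e^{-t}+2t). *)

(* Defs.v *)
From HB Require Import structures.
From mathcomp Require Import all_boot all_order all_algebra.
From mathcomp Require Import all_classical all_reals all_analysis.
From mathcomp Require Import measurable_realfun.

Set Implicit Arguments.
Unset Strict Implicit.
Unset Printing Implicit Defensive.

Import Order.TTheory GRing.Theory Num.Theory.
Import numFieldNormedType.Exports.

Local Open Scope classical_set_scope.
Local Open Scope ring_scope.

(* ** Euclidean space, sphere, rotations *)

Notation vec R d := 'cV[R]_d.+1.

Definition borelM (R : realType) (m n : nat) : measurableType _ :=
  g_sigma_algebraType (@open 'M[R]_(m, n)).

Notation borel_vec R d := (borelM R d.+1 1).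

Section sphere.
Context {R : realType} {d : nat}.
Implicit Types (x y : vec R d) (K C : set (vec R d)).

Definition dot x y : R := (x^T *m y) 0 0.

(* The library norm on matrices is the sup norm. *)
Definition enorm x : R := Num.sqrt (dot x x).

Definition sphere : set (vec R d) := [set x | enorm x = 1].

Definition SO : set 'M[R]_d.+1 := [set rho | rho^T *m rho = 1%:M /\ \det rho = 1].

Definition stabilizer x : set 'M[R]_d.+1 := [set rho | SO rho /\ rho *m x = x].

Definition rotset (rho : 'M[R]_d.+1) K : set (vec R d) := mulmx rho @` K.

(* Interior relative to the sphere. *)
Definition sph_interior K : set (vec R d) :=
  [set x | sphere x /\ \forall y \near x, sphere y -> K y].

End sphere.
Arguments sphere : clear implicits.
Arguments SO : clear implicits.

(* ** Spherical Lebesgue measure *)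

(* n-dimensional Lebesgue measure, the iterated product of the Lebesgue measure
   on R; as in the library's product measures, the first factor integrates the
   measure of the sections. *)
Fixpoint lebesgue_cV {R : realType} (n : nat) : set 'cV[R]_n -> \bar R :=
  match n with
  | 0%N => fun A => (\1_A 0)%:E
  | n'.+1 => fun A =>
      (\int[@lebesgue_measure R]_t
         lebesgue_cV [set v : 'cV[R]_n' | A (col_mx (t%:M : 'M[R]_1) v)])%E
  end.

Section spherical_lebesgue.
Context {R : realType} {d : nat}.
Implicit Types A : set (vec R d).

Definition spherical_cone A : set (vec R d) :=
  [set y | exists (t : R) x, [/\ 0 < t <= 1, sphere R d x, A x & y = t *: x]].

(* The surface measure of A is (d+1) times the volume of the cone over A; the
   factor cancels in the normalization.  Points of A off the sphere are
   ignored. *)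
Definition sigma_sph A : \bar R :=
  (lebesgue_cV (spherical_cone A) *
   ((fine (lebesgue_cV (spherical_cone (sphere R d))))^-1)%:E)%E.

End spherical_lebesgue.

(* ** The hyperspace of compact sets and its Borel sigma-algebra *)

Section hyperspace.
Context (R : realType) (d : nat).
Implicit Types C D K : set (vec R d).

Definition compacts : set (set (vec R d)) :=
  [set C | [/\ C `<=` sphere R d, compact C & C !=set0]].

Definition hausdorff_dist C D : R :=
  inf [set e : R | [/\ 0 <= e,
    forall x, C x -> exists2 y, D y & enorm (x - y) <= e &
    forall y, D y -> exists2 x, C x & enorm (x - y) <= e]].

Definition hausdorff_open (U : set (set (vec R d))) : Prop :=
  U `<=` compacts /\
  forall C, U C -> exists2 e : R, 0 < e &
    forall D, compacts D -> hausdorff_dist C D < e -> U D.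

(* The Borel sigma-algebra of [compacts], extended to all subsets of the
   ambient space by making the complement of [compacts] an atom. *)
Definition hyper : measurableType _ := g_sigma_algebraType hausdorff_open.

Definition closed_convex_cone (C : set (vec R d)) : Prop :=
  [/\ C !=set0, closed C, convex_set C &
      forall (a : R) x, 0 <= a -> C x -> C (a *: x)].

Definition linear_subspace (C : set (vec R d)) : Prop :=
  C 0 /\ forall (a : R) x y, C x -> C y -> C (a *: x + y).

Definition Kbar : set hyper :=
  [set K | exists C, [/\ closed_convex_cone C, ~ linear_subspace C &
                         K = sphere R d `&` C]].

Definition Khat : set hyper := Kbar `|` [set sphere R d].

Definition polyhedral_cone (C : set (vec R d)) : Prop :=
  exists us : seq (vec R d), C = [set x | forall u, u \in us -> dot u x <= 0].

Definition spherical_polytope K : Prop :=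
  exists C, [/\ polyhedral_cone C, ~ linear_subspace C & K = sphere R d `&` C].

Definition tessellation (s : seq hyper) : Prop :=
  s = [:: sphere R d : hyper] \/
  [/\ uniq s,
      forall K, K \in s -> spherical_polytope K /\ sph_interior K !=set0,
      forall x, sphere R d x -> exists2 K : set (vec R d), K \in s & K x &
      forall K L, K \in s -> L \in s -> K <> L ->
        sph_interior K `&` sph_interior L = set0].

End hyperspace.

(* ** Point processes *)

Section point_processes.
Context {R : realType} {dO dT : measure_display}.
Context {Omega : measurableType dO} {T : measurableType dT}.
Context (P : probability Omega R).

Definition is_counting (s : seq T) (m : set T -> \bar R) : Prop :=
  forall B, measurable B -> m B = (\sum_(x <- s) \d_x B)%E.

Definition intensity_measure (X : R.-ker Omega ~> T) (B : set T) : \bar R :=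
  (\int[P]_w X w B)%E.

(* The sigma-algebra generated by the evaluations m |-> m B, B measurable. *)
Definition counting_events : set (set (set T -> \bar R)) :=
  <<s [set E | exists2 B : set T, measurable B &
        exists2 Y : set (\bar R), measurable Y & E = [set m | Y (m B)]] >>.

Definition same_law (X Y : Omega -> set T -> \bar R) : Prop :=
  forall E, counting_events E -> P [set w | E (X w)] = P [set w | E (Y w)].

Definition mutually_independent (n : nat) (X : 'I_n -> Omega -> \bar R) : Prop :=
  forall Y : 'I_n -> set (\bar R), (forall i, measurable (Y i)) ->
    P (\bigcap_i (X i @^-1` Y i)) = (\prod_(i < n) P (X i @^-1` Y i))%E.

(* The Poisson weights are written out because the library's [poisson_pmf] is
   constantly 1 when the rate is 0. *)
Definition poisson_process (X : R.-ker Omega ~> T) (D : set T) : Prop :=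
  [/\ forall w, exists2 s : seq T,
        (forall x, x \in s -> D x) & is_counting s (X w),
      forall B, measurable B -> (intensity_measure X B < +oo)%E -> forall k,
        let t := fine (intensity_measure X B) in
        P [set w | X w B = k%:R%:E] = (expR (- t) * t ^+ k / k`!%:R)%:E &
      forall n (B : 'I_n -> set T), (forall i, measurable (B i)) ->
        trivIset setT B -> mutually_independent (fun i w => X w (B i))].

End point_processes.

Section random_tessellations.
Context {R : realType} {d : nat} {dO : measure_display}.
Context {Omega : measurableType dO} (P : probability Omega R).
Implicit Types m : set (hyper R d) -> \bar R.

Definition random_tessellation (X' : R.-ker Omega ~> hyper R d) : Prop :=
  forall w, exists2 s, tessellation s & is_counting s (X' w).

Definition isotropic (X' : R.-ker Omega ~> hyper R d) : Prop :=
  forall rho, SO R d rho ->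
    same_law P (fun w => pushforward (X' w) (rotset rho : hyper R d -> hyper R d))
      (fun w => X' w).

Definition gamma (X' : R.-ker Omega ~> hyper R d) : \bar R := intensity_measure P X' (@compacts R d).

Definition cells m : set (set (vec R d)) := [set K | Khat K /\ m [set K] != 0].

(* The value [sphere R d] is only a default for the case where p lies in the
   interior of no cell. *)
Definition crofton_cell (p : vec R d) m : hyper R d :=
  xget (sphere R d) [set K | cells m K /\ sph_interior K p].

End random_tessellations.

(* ** The typical cell *)

Section typical_cell.
Context {R : realType} {d : nat}.

Definition haar_probability (G : set 'M[R]_d.+1)
    (mu : probability (borelM R d.+1 d.+1) R) : Prop :=
  mu G = 1%E /\
  forall g, G g -> forall A : set (borelM R d.+1 d.+1), measurable A ->
    mu [set h : 'M[R]_d.+1 | A (g *m h)] = mu A.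

Definition rotation_kernel (lambda : probability (borelM R d.+1 d.+1) R)
    (p : vec R d) (kappa : vec R d -> probability (borelM R d.+1 d.+1) R) : Prop :=
  [/\ haar_probability (stabilizer p) (kappa p),
      forall x rho_x, sphere R d x -> SO R d rho_x -> rho_x *m p = x ->
        forall A : set (borelM R d.+1 d.+1), measurable A ->
          kappa x A = kappa p [set rho : 'M[R]_d.+1 | A (rho_x *m rho)] &
      forall A, measurable A -> kappa 0 A = lambda A].

Definition centre_function (c : hyper R d -> borel_vec R d) : Prop :=
  [/\ measurable_fun (@compacts R d : set (hyper R d)) c,
      forall C, compacts C -> sphere R d (c C) \/ c C = 0 &
      forall rho C, SO R d rho -> compacts C -> c (rotset rho C) = rho *m c C].

Context {dO dO' : measure_display} {Omega : measurableType dO}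
  {Omega' : measurableType dO'} (P : probability Omega R)
  (P' : probability Omega' R).

Definition typical_cell (kappa : vec R d -> probability (borelM R d.+1 d.+1) R)
    (c : hyper R d -> borel_vec R d) (X' : R.-ker Omega ~> hyper R d)
    (Z : Omega' -> hyper R d) : Prop :=
  [/\ measurable_fun setT Z, forall w, Khat (Z w) &
      forall A : set (hyper R d), measurable A ->
        P' (Z @^-1` A) =
        (((fine (gamma P X'))^-1)%:E *
         \int[P]_w \int[X' w]_(K in @Khat R d)
           \int[kappa (c K)]_(phi in SO R d)
             (\1_A (rotset (invmx phi) K : hyper R d))%:E)%E].

End typical_cell.

(* ** Hypersphere tessellations *)

Section hypersphere_tessellation.
Context {R : realType} {d : nat} {dO : measure_display}.
Context {Omega : measurableType dO}.

Definition great_hypersphere (x : vec R d) : set (vec R d) :=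
  [set y | sphere R d y /\ dot x y = 0].

Definition off_hyperspheres (Q : set (vec R d)) : set (vec R d) :=
  sphere R d `\` \bigcup_(x in Q) great_hypersphere x.

Definition induced_cells (Q : set (vec R d)) : set (set (vec R d)) :=
  [set closure (connected_component (off_hyperspheres Q) y)
     | y in off_hyperspheres Q].

Definition points (m : set (borel_vec R d) -> \bar R) : set (vec R d) :=
  [set x | m [set x] != 0].

Definition hypersphere_tessellation (X : R.-ker Omega ~> borel_vec R d)
    (X' : R.-ker Omega ~> hyper R d) : Prop :=
  forall w, cells (X' w) = induced_cells (points (X w)).

End hypersphere_tessellation.

Definition h_fun {R : realType} (d : nat) (t : R) : R :=
  (-1) ^+ d.+1 * expR (- t) +
  2 * \sum_(i < (d./2).+1) t ^+ (d - i.*2) / (d - i.*2)`!%:R.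

(* Main.v *)
Require Import Defs.
From HB Require Import structures.
From mathcomp Require Import all_boot all_order all_algebra.
From mathcomp Require Import all_classical all_reals all_analysis.
From mathcomp Require Import measurable_realfun.
From mathcomp Require Import ring lra zify.

(* Crofton formula.  The intensity measure M of X' is invariant under rotations,
   and almost surely exactly one cell contains p: at least one does, and
   averaging over p gives E #{K : p in K} = int sigma dM = E (sum of the areas of
   the cells) = 1, distinct cells overlapping in hyperplane sections only.  Hence
   E f(Z_0) = int f(K) 1{p in K} M(dK); replacing K by its image under a Haar
   distributed rotation turns 1{p in K} into sigma(K).

   Mean number of cells.  The cells correspond to the sign vectors realized by the
   points of X, and n vectors in general position realize
   2 * sum_(i <= d) C(n - 1, i) of them (for n >= 1); averaging over the Poisson
   number of points gives h_d.  If great hyperspheres are null, the points are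
   almost surely in general position: on finer and finer grids of cells, the
   expected number of tuples of occupied cells admitting a dependent choice of
   representatives tends to 0 by dominated convergence.

   Great hyperspheres are null when X' is isotropic: a point x lies in exactly one
   cell iff X has no point on the hypersphere orthogonal to x, so the void
   probability exp (- Lambda(x^perp)) does not depend on x; and each point lies on
   at most d of the hyperspheres orthogonal to the points of a moment curve, whose
   common mass a thus satisfies N a <= d Lambda(S) for all N. *)

Set Implicit Arguments.
Unset Strict Implicit.
Unset Printing Implicit Defensive.

Import Order.TTheory GRing.Theory Num.Theory.
Import numFieldNormedType.Exports.

Local Open Scope classical_set_scope.
Local Open Scope ring_scope.

(** Absence of point masses does not put the points in general position: an intensity carried by one
    great hypersphere may be free of atoms, yet n of its points span at most a hyperplane and cut
    out fewer cells than the formula predicts once n > d. The Poisson part therefore rests on great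
    hyperspheres being null, and isotropy of the tessellation has to be converted into that. Two
    further obstacles shape the proof. [sigma_sph] is an iterated integral and not a packaged
    measure: rotation invariance of Lebesgue measure is derived from the uniqueness of translation
    invariant measures, and areas are then handled as Haar measures of sets of rotations, which also
    makes the area a measurable function of the cell. The Crofton cell is defined by a choice, and f
    (Z_0) is not shown to be measurable in w; its integral is compared with that of a measurable
    function which agrees with it off a null set. *)

(** * Continuity of matrix operations *)

Lemma nbhs_true {T : topologicalType} (x : T) (A : T -> Prop) :
  (forall y, A y) -> \forall y \near x, A y.
Proof. by move=> hA; near=> y; exact: hA. Unshelve. all: by end_near. Qed.

Lemma near_seq {T : topologicalType} (x : T) (I : eqType) (s : seq I)
    (A : I -> T -> Prop) :
  (forall i, i \in s -> \forall y \near x, A i y) ->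
  \forall y \near x, forall i, i \in s -> A i y.
Proof.
elim: s => [|i s IH] h; first exact: nbhs_true.
have h1 := h i (mem_head _ _).
have h2 := IH (fun j js => h j (@mem_behead _ (i :: s) _ js)).
by apply: filterS2 h1 h2 => y h1 h2 j; rewrite inE => /predU1P[->|/h2].
Qed.

(** The norm on matrices is the sup norm, so finitely many entrywise estimates suffice. *)
Lemma mx_continuous {R : realType} {T : topologicalType} m n
    (f : T -> 'M[R]_(m, n)) :
  (forall i j, continuous (fun x => f x i j)) -> continuous f.
Proof.
move=> cf x; apply/cvgrPdist_lt => e e0.
have /filter_forall H : forall i : 'I_m * 'I_n,
    \forall y \near x, `|f x i.1 i.2 - f y i.1 i.2| < e.
  by move=> i; move/cvgrPdist_lt : (cf i.1 i.2 x) => /(_ e e0).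
apply: filterS H => y H.
suff : ball (f x) e (f y) by rewrite mx_norm_ball.
by split=> // i j; exact: (H (i, j)).
Qed.

Lemma continuousT_comp {T U V : topologicalType} (f : T -> U) (g : U -> V) :
  continuous f -> continuous g -> continuous (g \o f).
Proof. by move=> cf cg x; apply: continuous_comp; [exact: cf|exact: cg]. Qed.

Lemma continuous_sum {R : realType} {T : topologicalType} (I : Type) (r : seq I)
    (f : I -> T -> R) :
  (forall i, continuous (f i)) -> continuous (fun x => \sum_(i <- r) f i x).
Proof.
move=> cf; elim: r => [|i r IH].
  by under eq_fun do rewrite big_nil; move=> x; exact: cvg_cst.
under eq_fun do rewrite big_cons.
by move=> x; apply: cvgD; [exact: cf|exact: IH].
Qed.

Lemma continuous_prod {R : realType} {T : topologicalType} (I : Type) (r : seq I)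
    (f : I -> T -> R) :
  (forall i, continuous (f i)) -> continuous (fun x => \prod_(i <- r) f i x).
Proof.
move=> cf; elim: r => [|i r IH].
  by under eq_fun do rewrite big_nil; move=> x; exact: cvg_cst.
under eq_fun do rewrite big_cons.
by move=> x; apply: cvgM; [exact: cf|exact: IH].
Qed.

Lemma continuous_mulr {R : realType} {T : topologicalType} (f g : T -> R) :
  continuous f -> continuous g -> continuous (fun x => f x * g x).
Proof. by move=> cf cg x; apply: cvgM; [exact: cf|exact: cg]. Qed.

Lemma continuous_const {T U : topologicalType} (c : U) :
  continuous (fun _ : T => c).
Proof. by move=> x; exact: cvg_cst. Qed.

Lemma continuous_coord {R : realType} m n i j :
  continuous (fun M : 'M[R]_(m, n) => M i j).
Proof. exact: coord_continuous. Qed.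

Lemma continuous_mulmxl {R : realType} m n p (A : 'M[R]_(m, n)) :
  continuous (fun B : 'M[R]_(n, p) => A *m B).
Proof.
apply: mx_continuous => i j.
rewrite (_ : (fun _ => _) = fun B : 'M[R]_(n, p) => \sum_k A i k * B k j); last first.
  by apply/funext => B; rewrite mxE.
apply: continuous_sum => k; apply: continuous_mulr; first exact: continuous_const.
exact: continuous_coord.
Qed.

Lemma continuous_mulmxr {R : realType} m n p (B : 'M[R]_(n, p)) :
  continuous (fun A : 'M[R]_(m, n) => A *m B).
Proof.
apply: mx_continuous => i j.
rewrite (_ : (fun _ => _) = fun A : 'M[R]_(m, n) => \sum_k A i k * B k j); last first.
  by apply/funext => A; rewrite mxE.
apply: continuous_sum => k; apply: continuous_mulr; last exact: continuous_const.
exact: continuous_coord.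
Qed.

Lemma continuous_trmx {R : realType} m n :
  continuous (fun A : 'M[R]_(m, n) => A^T).
Proof.
apply: mx_continuous => i j.
rewrite (_ : (fun _ => _) = fun A : 'M[R]_(m, n) => A j i); last first.
  by apply/funext => A; rewrite mxE.
exact: continuous_coord.
Qed.

Lemma continuous_det {R : realType} n : continuous (fun A : 'M[R]_n => \det A).
Proof.
apply: continuous_sum => s; apply: continuous_mulr; first exact: continuous_const.
by apply: continuous_prod => i; exact: continuous_coord.
Qed.

(** * Inner product and norm *)

Section euclid.
Context {R : realType} {d : nat}.
Implicit Types (x y z : vec R d) (rho : 'M[R]_d.+1).

Lemma dotE x y : dot x y = \sum_i x i 0 * y i 0.
Proof. by rewrite /dot mxE; apply: eq_bigr => i _; rewrite mxE. Qed.

Lemma dotC x y : dot x y = dot y x.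
Proof. by rewrite !dotE; apply: eq_bigr => i _; rewrite mulrC. Qed.

Lemma dotDr x y z : dot x (y + z) = dot x y + dot x z.
Proof. by rewrite /dot mulmxDr mxE. Qed.

Lemma dotZr a x y : dot x (a *: y) = a * dot x y.
Proof. by rewrite /dot -scalemxAr mxE. Qed.

Lemma dotDl x y z : dot (x + y) z = dot x z + dot y z.
Proof. by rewrite dotC dotDr !(dotC z). Qed.

Lemma dotZl a x y : dot (a *: x) y = a * dot x y.
Proof. by rewrite dotC dotZr dotC. Qed.

Lemma dot0r x : dot x 0 = 0.
Proof. by rewrite /dot mulmx0 mxE. Qed.

Lemma dot0l x : dot 0 x = 0.
Proof. by rewrite dotC dot0r. Qed.

Lemma dotNr x y : dot x (- y) = - dot x y.
Proof. by rewrite -scaleN1r dotZr mulN1r. Qed.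

Lemma dotNl x y : dot (- x) y = - dot x y.
Proof. by rewrite dotC dotNr dotC. Qed.

Lemma dot_continuous x : continuous (dot x).
Proof.
rewrite (_ : dot x = (fun M : 'M[R]_(1, 1) => M 0 0) \o (mulmx x^T)) //.
by apply: continuousT_comp; [exact: continuous_mulmxl|exact: continuous_coord].
Qed.

Lemma dotxx_ge0 x : 0 <= dot x x.
Proof. by rewrite dotE; apply: sumr_ge0 => i _; rewrite -expr2 sqr_ge0. Qed.

Lemma dotxx_eq0 x : (dot x x == 0) = (x == 0).
Proof.
apply/idP/eqP => [|->]; last by rewrite dot0r.
rewrite dotE psumr_eq0 => [/allP h|i _]; last by rewrite -expr2 sqr_ge0.
apply/colP => i; rewrite mxE; apply/eqP.
by have := h i (mem_index_enum _); rewrite mulf_eq0 orbb.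
Qed.

Lemma enormE x : enorm x ^+ 2 = dot x x.
Proof. by rewrite /enorm sqr_sqrtr// dotxx_ge0. Qed.

Lemma enorm_ge0 x : 0 <= enorm x. Proof. exact: sqrtr_ge0. Qed.

Lemma enorm_eq0 x : (enorm x == 0) = (x == 0).
Proof. by rewrite -dotxx_eq0 -enormE expf_eq0. Qed.

Lemma enorm_gt0 x : (0 < enorm x) = (x != 0).
Proof. by rewrite lt_def enorm_ge0 andbT enorm_eq0. Qed.

Lemma enormZ a x : enorm (a *: x) = `|a| * enorm x.
Proof.
by rewrite /enorm dotZl dotZr mulrA -expr2 sqrtrM ?sqr_ge0// sqrtr_sqr.
Qed.

Lemma enormN x : enorm (- x) = enorm x.
Proof. by rewrite -scaleN1r enormZ normrN normr1 mul1r. Qed.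

Lemma coord_le_enorm x i : `|x i 0| <= enorm x.
Proof.
rewrite -(@ler_pXn2r _ 2)// ?nnegrE ?enorm_ge0// enormE dotE (bigD1 i)//=.
rewrite real_normK ?num_real// -expr2 lerDl.
by apply: sumr_ge0 => j _; rewrite -expr2 sqr_ge0.
Qed.

Lemma coord_le_norm m n (A : 'M[R]_(m, n)) i j : `|A i j| <= `|A|.
Proof.
rewrite [leRHS]/Num.norm /= mx_normrE; apply/bigmax_geP; right => /=.
by exists (i, j).
Qed.

Lemma norm_le_enorm x : `|x| <= enorm x.
Proof.
rewrite [leLHS]/Num.norm /= mx_normrE; apply/bigmax_leP; split; first exact: enorm_ge0.
by move=> [i j] _ /=; rewrite (ord1 j) coord_le_enorm.
Qed.

Lemma enorm_le_norm x : enorm x <= d.+1%:R * `|x|.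
Proof.
rewrite -(@ler_pXn2r _ 2)// ?nnegrE ?enorm_ge0 ?mulr_ge0// enormE dotE.
apply: (@le_trans _ _ (\sum_(i < d.+1) `|x| ^+ 2)).
  apply: ler_sum => i _; rewrite -expr2 -real_normK ?num_real//.
  by rewrite ler_pXn2r ?nnegrE// coord_le_norm.
rewrite sumr_const card_ord -[leLHS]mulr_natl exprMn.
apply: ler_wpM2r; first exact: sqr_ge0.
by rewrite -natrX ler_nat (leq_pexp2l (m:=d.+1) (n1:=1) (n2:=2)).
Qed.

Lemma dotxx_continuous : continuous (fun x : vec R d => dot x x).
Proof.
rewrite (_ : (fun _ => _) = fun x : vec R d => \sum_i x i 0 * x i 0); last first.
  by apply/funext => x; rewrite dotE.
by apply: continuous_sum => i; apply: continuous_mulr; exact: continuous_coord.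
Qed.

Lemma enorm_continuous : continuous (@enorm R d).
Proof.
by apply: (continuousT_comp dotxx_continuous); exact: sqrt_continuous.
Qed.

Lemma sphereE x : sphere R d x <-> dot x x = 1.
Proof.
rewrite -enormE; split => [->|/eqP]; first by rewrite expr1n.
by rewrite sqrp_eq1 ?enorm_ge0// => /eqP.
Qed.

Lemma sphere_neq0 x : sphere R d x -> x != 0.
Proof. by move=> hx; rewrite -enorm_eq0 hx oner_eq0. Qed.

Lemma sphereN x : sphere R d x -> sphere R d (- x).
Proof. by rewrite /sphere /= enormN. Qed.

Definition normalize x : vec R d := (enorm x)^-1 *: x.

Lemma sphere_normalize x : x != 0 -> sphere R d (normalize x).
Proof.
move=> x0; rewrite /sphere /= /normalize enormZ ger0_norm ?invr_ge0 ?enorm_ge0//.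
by rewrite mulVf// enorm_eq0.
Qed.

Lemma normalize_sphere x : sphere R d x -> normalize x = x.
Proof. by rewrite /normalize => ->; rewrite invr1 scale1r. Qed.

Lemma normalizeZ a x : 0 < a -> normalize (a *: x) = normalize x.
Proof.
move=> a0; rewrite /normalize enormZ gtr0_norm// invfM scalerA mulrAC mulVf ?mul1r//.
by rewrite gt_eqF.
Qed.

Lemma dot_normalize x y : dot x (normalize y) = (enorm y)^-1 * dot x y.
Proof. exact: dotZr. Qed.

Lemma normalize_continuous x : x != 0 -> {for x, continuous normalize}.
Proof.
move=> x0; apply: (@cvgZ _ _ (vec R d) (nbhs x) _ (fun y => (enorm y)^-1) id).
  by apply: (@cvgV _ (vec R d) (nbhs x)); [rewrite enorm_eq0|exact: enorm_continuous].
exact: cvg_id.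
Qed.

Lemma closed_sphere : closed (sphere R d).
Proof.
rewrite (_ : sphere R d = @enorm R d @^-1` [set 1]) //.
apply: closed_comp; last exact: closed_eq.
by move=> x _; exact: enorm_continuous.
Qed.

Lemma closed_sphere_compact (K : set (vec R d)) :
  K `<=` sphere R d -> closed K -> compact K.
Proof.
move=> KS cK.
(* [bounded_closed_compact] speaks of row vectors, hence the transposition. *)
have -> : K = trmx @` (trmx @^-1` K : set 'rV[R]_d.+1).
  apply/seteqP; split => x.
    by move=> Kx; exists x^T; rewrite /= ?trmxK.
  by move=> [y Ky <-].
apply: continuous_compact.
  by apply/continuous_subspaceT => y; exact: continuous_trmx.
apply: bounded_closed_compact.
  exists 1; split; first exact: num_real.
  move=> M M1 y /= /KS hy; apply: le_trans (ltW M1).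
  rewrite [leLHS]/Num.norm /= mx_normrE; apply/bigmax_leP; split => // -[i j] _ /=.
  by rewrite -hy; have := coord_le_enorm y^T j; rewrite mxE (ord1 i).
by apply: closed_comp cK => y _; exact: continuous_trmx.
Qed.

Lemma sphere_neq_nil : sphere R d !=set0.
Proof.
exists (delta_mx 0 0); apply/sphereE; rewrite dotE (bigD1 0)//= big1 => [|i i0].
  by rewrite !mxE !eqxx /= mulr1 addr0.
by rewrite !mxE (negbTE i0) /= mul0r.
Qed.

Lemma compacts_sphere : compacts (sphere R d).
Proof.
split => //; last exact: sphere_neq_nil.
by apply: closed_sphere_compact => //; exact: closed_sphere.
Qed.

Lemma compacts_closed (K : set (vec R d)) : compacts K -> closed K.
Proof. by move=> [_ cK _]; apply: compact_closed => //; exact: norm_hausdorff. Qed.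

End euclid.

(** * Rotations *)

Section rotations.
Context {R : realType} {d : nat}.
Implicit Types (x y z : vec R d) (rho : 'M[R]_d.+1).

Lemma SO_mul rho rho' : SO R d rho -> SO R d rho' -> SO R d (rho *m rho').
Proof.
move=> [h1 h2] [h3 h4]; split; last by rewrite det_mulmx h2 h4 mulr1.
by rewrite trmx_mul mulmxA -(mulmxA _ _ rho) h1 mulmx1.
Qed.

Lemma SO_trK rho : SO R d rho -> rho^T *m rho = 1%:M. Proof. by case. Qed.

Lemma SO_Ktr rho : SO R d rho -> rho *m rho^T = 1%:M.
Proof. by move=> [/mulmx1C]. Qed.

Lemma SO_tr rho : SO R d rho -> SO R d rho^T.
Proof. by move=> h; split; rewrite ?trmxK ?det_tr ?SO_Ktr//; case: h. Qed.

Lemma SO_invmx rho : SO R d rho -> invmx rho = rho^T.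
Proof.
move=> h; have u : rho \in unitmx by rewrite unitmxE (proj2 h) unitr1.
by rewrite -[RHS]mulmx1 -(mulmxV u) mulmxA SO_trK// mul1mx.
Qed.

Lemma dot_mulmx rho x y : dot (rho *m x) y = dot x (rho^T *m y).
Proof. by rewrite /dot trmx_mul mulmxA. Qed.

Lemma orth_dot rho x y : rho^T *m rho = 1%:M -> dot (rho *m x) (rho *m y) = dot x y.
Proof. by move=> h; rewrite dot_mulmx mulmxA h mul1mx. Qed.

Lemma orth_enorm rho x : rho^T *m rho = 1%:M -> enorm (rho *m x) = enorm x.
Proof. by move=> h; rewrite /enorm orth_dot. Qed.

Lemma SO_sphere rho x : SO R d rho -> sphere R d (rho *m x) <-> sphere R d x.
Proof. by move=> [h _]; rewrite /sphere /= orth_enorm. Qed.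

Lemma SO_mulK rho x : SO R d rho -> rho^T *m (rho *m x) = x.
Proof. by move=> h; rewrite mulmxA SO_trK// mul1mx. Qed.

Lemma SO_mulKV rho x : SO R d rho -> rho *m (rho^T *m x) = x.
Proof. by move=> h; rewrite mulmxA SO_Ktr// mul1mx. Qed.

Lemma rotsetE rho (K : set (vec R d)) x : SO R d rho -> rotset rho K x <-> K (rho^T *m x).
Proof.
move=> h; split => [[y Ky <-]|Kx]; first by rewrite SO_mulK.
by exists (rho^T *m x) => //; rewrite SO_mulKV.
Qed.

Lemma rotset_preimage rho (K : set (vec R d)) : SO R d rho ->
  rotset rho K = mulmx rho^T @^-1` K.
Proof. by move=> h; apply/seteqP; split => x; rewrite rotsetE. Qed.

Lemma rotset_comp rho rho' (K : set (vec R d)) :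
  rotset rho (rotset rho' K) = rotset (rho *m rho') K.
Proof.
apply/seteqP; split => [x [_ [y Ky <-] <-]|x [y Ky <-]].
  by exists y; rewrite // mulmxA.
by rewrite -mulmxA; exists (rho' *m y) => //; exists y.
Qed.

Lemma rotset1 (K : set (vec R d)) : rotset 1%:M K = K.
Proof.
apply/seteqP; split => [x [y Ky <-]|x Kx]; first by rewrite mul1mx.
by exists x => //; rewrite mul1mx.
Qed.

Lemma rotsetK rho (K : set (vec R d)) : SO R d rho -> rotset rho^T (rotset rho K) = K.
Proof. by move=> h; rewrite rotset_comp SO_trK// rotset1. Qed.

Lemma rotset_sphere rho : SO R d rho -> rotset rho (sphere R d) = sphere R d.
Proof.
move=> h; apply/seteqP; split => x; rewrite rotsetE// => hx.
  by apply/(SO_sphere _ (SO_tr h)).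
by apply/(SO_sphere _ (SO_tr h)).
Qed.

Lemma rotset_compacts rho (K : set (vec R d)) : SO R d rho ->
  compacts K -> compacts (rotset rho K).
Proof.
move=> h [KS cK [x Kx]]; split.
- by rewrite -(rotset_sphere h) => _ [y Ky <-]; exists y => //; exact: KS.
- apply: continuous_compact => //; apply: continuous_subspaceT.
  exact: continuous_mulmxl.
- by exists (rho *m x); exists x.
Qed.

Lemma rotset_compactsE rho (K : set (vec R d)) : SO R d rho ->
  compacts (rotset rho K) <-> compacts K.
Proof.
move=> h; split; last exact: rotset_compacts.
by move=> /(rotset_compacts (SO_tr h)); rewrite rotsetK.
Qed.

(* Householder reflection in the bisector of [x] and [y]. *)
Lemma orth_transitive x y : sphere R d x -> sphere R d y ->
  exists H : 'M[R]_d.+1, H^T *m H = 1%:M /\ H *m x = y.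
Proof.
move=> hx hy; have [->|xy] := eqVneq x y.
  by exists 1%:M; rewrite trmx1 mul1mx mul1mx.
pose u := x - y; pose c := 2 / dot u u.
have u0 : dot u u != 0 by rewrite dotxx_eq0 subr_eq0.
pose H : 'M[R]_d.+1 := 1%:M - c *: (u *m u^T).
have HE z : H *m z = z - (c * dot u z) *: u.
  rewrite /H mulmxBl mul1mx -scalemxAl -mulmxA -scalerA; congr (_ - _ *: _).
  by rewrite (mx11_scalar (u^T *m z)) mul_mx_scalar /dot.
have HT : H^T = H.
  by rewrite /H linearB /= trmx1 linearZ /= trmx_mul trmxK.
exists H; split.
  have dH z : dot u (H *m z) = - dot u z.
    by rewrite HE dotDr dotNr dotZr; move: (dot u z) => a; rewrite /c; field.
  have HHz z : H *m (H *m z) = z.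
    by rewrite [LHS]HE dH mulrN scaleNr opprK [H *m z]HE subrK.
  rewrite HT; apply/matrixP => i j.
  have := congr1 (fun v : vec R d => v i 0) (HHz (delta_mx j 0)).
  by rewrite mulmxA -colE !mxE eqxx andbT.
rewrite HE.
have xx : dot x x = 1 by apply/sphereE.
have yy : dot y y = 1 by apply/sphereE.
(* Since |x| = |y| = 1, dot u u = 2 (1 - dot x y) = 2 dot u x. *)
have e : c * dot u x = 1.
  move: u0; rewrite /c /u !(dotDl, dotDr, dotNr, dotNl) xx yy (dotC y x) => u0.
  by field; apply: contra_neq u0 => <-; ring.
by rewrite e scale1r /u opprB addrC subrK.
Qed.

(** If the orthogonal matrix [H] taking x to y has determinant -1, it is followed by a reflection
    that fixes y: [G] carries y to the first basis vector, [D] changes the sign of the last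
    coordinate, which is a different one because 0 < d, and the transpose of [G] carries back. *)
Lemma SO_transitive x y : (0 < d)%N -> sphere R d x -> sphere R d y ->
  exists2 rho, SO R d rho & rho *m x = y.
Proof.
move=> d0 hx hy.
have [H [HH Hx]] := orth_transitive hx hy.
have /eqP : (\det H) ^+ 2 = 1 by rewrite expr2 -{1}det_tr -det_mulmx HH det1.
rewrite sqrf_eq1 => /orP[/eqP dH|/eqP dH]; first by exists H.
pose e0 : vec R d := delta_mx 0 0.
have he0 : sphere R d e0.
  apply/sphereE; rewrite dotE (bigD1 0)//= big1 => [|i i0].
    by rewrite !mxE !eqxx /= mulr1 addr0.
  by rewrite !mxE (negbTE i0) /= mul0r.
have [G [GG Gy]] := orth_transitive hy he0.
pose D : 'M[R]_d.+1 := diag_mx (\row_j (if j == ord_max then -1 else 1)).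
have DT : D^T = D by rewrite /D tr_diag_mx.
have DD : D *m D = 1%:M.
  apply/matrixP => i j; rewrite mul_diag_mx !mxE; case: (i == j) => /=.
    by case: ifP; rewrite ?mulrNN ?mulr1n mulr1.
  by rewrite mulr0n mulr0.
have De0 : D *m e0 = e0.
  apply/matrixP => i j; rewrite mul_diag_mx !mxE.
  have [->|_] /= := eqVneq i 0; last by rewrite mulr0.
  rewrite (_ : (0 == ord_max :> 'I_d.+1) = false) ?mul1r//.
  by apply/negbTE/eqP => /(congr1 val) /= h; move: d0; rewrite -h.
have dD : \det D = -1.
  rewrite det_diag (bigD1 ord_max)//= big1 => [|i im]; first by rewrite !mxE eqxx mulr1.
  by rewrite mxE (negbTE im).
have GGT : G *m G^T = 1%:M by exact: mulmx1C.
exists (G^T *m D *m G *m H).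
  split; last first.
    rewrite !det_mulmx dD dH det_tr.
    by have /(congr1 determinant) := GG; rewrite det_mulmx det_tr det1 => e; rewrite !mulrN1 mulNr opprK.
  rewrite !trmx_mul trmxK DT !mulmxA.
  rewrite -(mulmxA _ G G^T) GGT mulmx1 -(mulmxA _ D D) DD mulmx1.
  by rewrite -(mulmxA _ G^T G) GG mulmx1.
rewrite -mulmxA Hx -!mulmxA Gy De0 -Gy mulmxA GG mul1mx.
by [].
Qed.

End rotations.

(** * Borel sets of matrices *)

Section borel_matrices.
Context {R : realType}.

Lemma open_borelM m n (U : set 'M[R]_(m, n)) : open U -> measurable (U : set (borelM R m n)).
Proof. by move=> oU; apply: sub_sigma_algebra. Qed.

Lemma closed_borelM m n (C : set 'M[R]_(m, n)) :
  closed C -> measurable (C : set (borelM R m n)).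
Proof.
by move=> /closed_openC/open_borelM/measurableC; rewrite setCK.
Qed.

Lemma continuous_borelM m n m' n' (f : 'M[R]_(m, n) -> 'M[R]_(m', n')) :
  continuous f -> measurable_fun [set: borelM R m n] (f : borelM R m n -> borelM R m' n').
Proof.
move=> cf; apply: (@measurability _ _ (borelM R m n) (borelM R m' n') setT f (@open 'M[R]_(m', n'))) => // _ [U oU <-].
by rewrite setTI; apply: open_borelM; apply: open_comp.
Qed.

Lemma continuous_borelM_R m n (f : 'M[R]_(m, n) -> R) :
  continuous f -> measurable_fun [set: borelM R m n] (f : borelM R m n -> R).
Proof.
move=> cf; apply: (measurability _ (RGenOInfty.measurableE R)).
move=> _ [_ [x ->] <-]; rewrite setTI; apply: open_borelM.
by apply: open_comp => //; exact: interval_open.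
Qed.

(** Cubes with rational centre form a countable base: by [open_rat_boxes] measurability into a space
    of matrices reduces to the entries, and compact sets are later tested by the boxes they meet. *)
Definition rat_box m n (k : nat) (q : 'M[rat]_(m, n)) : set 'M[R]_(m, n) :=
  [set M | forall i j, `|M i j - ratr (q i j)| < k.+1%:R^-1].

Lemma open_rat_boxes m n (U : set 'M[R]_(m, n)) : open U ->
  U = \bigcup_(kq : nat * 'M[rat]_(m, n))
        (if `[< rat_box kq.1 kq.2 `<=` U >] then rat_box kq.1 kq.2 else set0).
Proof.
move=> oU; apply/seteqP; split => [M UM|M [[k q] _] /=]; last first.
  by case: ifPn => // /asboolP h /h.
have [e e0 he] : exists2 e : R, 0 < e & ball M e `<=` U.
  by have := oU; rewrite openE => /(_ M UM)/nbhs_ballP[e e0 he]; exists e.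
(* A box of radius below e / 2 that contains M lies in the ball of radius e about M. *)
pose k := Num.truncn (2 / e).
have ke : k.+1%:R^-1 < e / 2.
  by rewrite -[ltRHS]invf_div ltf_pV2 ?posrE ?divr_gt0// truncnS_gt.
have H i j : exists q : rat, `|M i j - ratr q| < k.+1%:R^-1.
  have [|q] := @rat_in_itvoo _ (M i j - k.+1%:R^-1) (M i j + k.+1%:R^-1).
    by rewrite ltrD2l gt0_cp// invr_gt0.
  by rewrite in_itv /= => /andP[h1 h2]; exists q; move: (ratr q) (_^-1) h1 h2 => a b h1 h2; rewrite ltr_norml; lra.
pose q : 'M[rat]_(m, n) := \matrix_(i, j) sval (cid (H i j)).
have Mq : rat_box k q M by move=> i j; rewrite mxE; case: cid.
exists (k, q) => //=; rewrite asboolT// => N hN.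
apply: he; split => // i j; rewrite /ball /=.
have := Mq i j; have := hN i j; move: ke.
move: (ratr (q i j)) (k.+1%:R^-1) => a b; rewrite !ltr_norml; lra.
Qed.

Lemma measurable_mx d (T : measurableType d) (D : set T) m n (f : T -> borelM R m n) :
  (forall i j, measurable_fun D (fun x => (f x : 'M[R]_(m, n)) i j)) -> measurable_fun D f.
Proof.
move=> mf mD; apply: (@measurability _ _ T (borelM R m n) D f (@open 'M[R]_(m, n))) => // _ [U oU <-].
rewrite (open_rat_boxes oU) preimage_bigcup setI_bigcupr.
apply: countable_bigcupT_measurable => // -[k q] /=.
case: ifP => _; last by rewrite preimage_set0 setI0.
rewrite (_ : _ `&` _ = D `&` \bigcap_(ij in [set: 'I_m * 'I_n])
   (D `&` (fun x => (f x : 'M[R]_(m, n)) ij.1 ij.2) @^-1`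
     [set r | `|r - ratr (q ij.1 ij.2)| < k.+1%:R^-1])); last first.
  apply/seteqP; split => x /= [Dx h]; split=> //.
    by move=> [i j] _; split => //=; exact: h.
  by move=> i j; have [] := h (i, j) I.
apply: measurableI => //; apply: fin_bigcap_measurable => // -[i j] _.
apply: mf => //=; apply: open_measurable.
rewrite (_ : [set r | _] = ball (ratr (q i j) : R) k.+1%:R^-1); first exact: ball_open.
by apply/seteqP; split => r /=; rewrite distrC.
Qed.

Lemma measurable_coord m n i j :
  measurable_fun setT (fun M : borelM R m n => (M : 'M[R]_(m, n)) i j).
Proof. by apply: continuous_borelM_R; exact: continuous_coord. Qed.

Lemma measurable_coord_comp d (T : measurableType d) (D : set T) m n
    (f : T -> borelM R m n) i j :
  measurable_fun D f -> measurable_fun D (fun x => (f x : 'M[R]_(m, n)) i j).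
Proof. by move=> mf; apply: (measurableT_comp (measurable_coord i j)). Qed.

Lemma measurable_mulmx d (T : measurableType d) (D : set T) m n p
    (f : T -> borelM R m n) (g : T -> borelM R n p) :
  measurable_fun D f -> measurable_fun D g ->
  measurable_fun D (fun x => (f x : 'M[R]_(m, n)) *m (g x : 'M[R]_(n, p)) : borelM R m p).
Proof.
move=> mf mg; apply: measurable_mx => i j.
under eq_fun do rewrite mxE.
apply: measurable_sum => k; apply: measurable_funM; exact: measurable_coord_comp.
Qed.

Lemma measurable_trmx d (T : measurableType d) (D : set T) m n (f : T -> borelM R m n) :
  measurable_fun D f -> measurable_fun D (fun x => (f x : 'M[R]_(m, n))^T : borelM R n m).
Proof.
move=> mf; apply: measurable_mx => i j.
by under eq_fun do rewrite mxE; exact: measurable_coord_comp.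
Qed.

Lemma measurable_addmx d (T : measurableType d) (D : set T) m n
    (f g : T -> borelM R m n) :
  measurable_fun D f -> measurable_fun D g ->
  measurable_fun D (fun x => (f x : 'M[R]_(m, n)) + (g x : 'M[R]_(m, n)) : borelM R m n).
Proof.
move=> mf mg; apply: measurable_mx => i j.
under eq_fun do rewrite mxE.
by apply: measurable_funD; exact: measurable_coord_comp.
Qed.

Lemma measurable_oppmx d (T : measurableType d) (D : set T) m n (f : T -> borelM R m n) :
  measurable_fun D f ->
  measurable_fun D (fun x => - (f x : 'M[R]_(m, n)) : borelM R m n).
Proof.
move=> mf; apply: measurable_mx => i j.
under eq_fun do rewrite mxE.
by apply: measurable_funN; exact: measurable_coord_comp.
Qed.

Lemma measurable_SO (d : nat) : measurable (SO R d : set (borelM R d.+1 d.+1)).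
Proof.
apply: closed_borelM.
rewrite (_ : SO R d = (fun rho => rho^T *m rho) @^-1` [set 1%:M] `&`
                      (fun rho => \det rho) @^-1` [set 1]) //.
apply: closedI; apply: closed_comp.
- move=> x _; apply: mx_continuous => i j.
  rewrite (_ : (fun _ => _) = fun x : 'M[R]_d.+1 => \sum_k x k i * x k j); last first.
    by apply/funext => y; rewrite mxE; apply: eq_bigr => k _; rewrite mxE.
  by apply: continuous_sum => k; apply: continuous_mulr; exact: continuous_coord.
- by apply: accessible_closed_set1; apply: hausdorff_accessible; exact: norm_hausdorff.
- by move=> x _; exact: continuous_det.
- exact: closed_eq.
Qed.

End borel_matrices.

(** * Invariance of Lebesgue measure *)

Section sigma_finite_pack.
Context d (T : measurableType d) (R : realType) (m : {measure set T -> \bar R}).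

(** An alias of [m] indexed by the proof of sigma-finiteness, on which the structure demanded by
    product measures and Tonelli's theorem can be declared. *)
Definition sigma_finite_of of sigma_finite setT m : set T -> \bar R := m.

Variable sfm : sigma_finite setT m.

HB.instance Definition _ := Measure.on (sigma_finite_of sfm).
HB.instance Definition _ :=
  Measure_isSigmaFinite.Build _ _ _ (sigma_finite_of sfm) sfm.

Lemma sigma_finite_pack :
  exists mu : {sigma_finite_measure set T -> \bar R}, forall A, mu A = m A.
Proof. by exists (sigma_finite_of sfm). Qed.

End sigma_finite_pack.

(** The image measure with the measurability proof hidden, so that it can be used as a plain
    measure. *)
Lemma pushforward_pack d d' (T1 : measurableType d) (T2 : measurableType d')
    (R : realType) (m : {measure set T1 -> \bar R}) (f : T1 -> T2) :
  measurable_fun [set: T1] f ->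
  exists m' : {measure set T2 -> \bar R}, forall A, m' A = m (f @^-1` A).
Proof.
move=> mf; pose m' : {measure set T2 -> \bar R} := pushforward m f.
by exists (m' mf).
Qed.

Section lebesgue_translation.
Context {R : realType}.
Notation mu := (@lebesgue_measure R).

(** The translate and the measure itself agree on half-open intervals, which determine Lebesgue
    measure. *)
Lemma lebesgue_measure_shift (a : R) (A : set R) : measurable A ->
  mu ((fun x => x + a) @^-1` A) = mu A.
Proof.
move=> mA.
have mf : measurable_fun [set: R] (fun x : R => x + a).
  by apply: measurable_funD => //; exact: measurable_cst.
apply/esym.
rewrite -[RHS]/(pushforward mu (fun x : measurableTypeR R => (x + a : measurableTypeR R)) A).
apply: lebesgue_measure_unique => //= _ [[x y] _ <-] /=.
rewrite /pushforward.
rewrite (_ : _ @^-1` _ = `](x - a), (y - a)]%classic); last first.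
  by apply/seteqP; split => z /=; rewrite !in_itv /= ltrBlDr lerBrDr.
rewrite !lebesgue_measure_itv /= !lte_fin ltrD2r.
by case: ifP => // _; rewrite -!EFinD; congr EFin; ring.
Qed.

Lemma integral_shift (a : R) (f : R -> \bar R) :
  measurable_fun [set: R] f -> (forall x, 0 <= f x)%E ->
  (\int[mu]_x f (x + a)%R = \int[mu]_x f x)%E.
Proof.
move=> mf f0.
have ms : measurable_fun [set: measurableTypeR R] (fun x => (x + a : measurableTypeR R)).
  by apply: measurable_funD => //; exact: measurable_cst.
rewrite -[LHS]/(\int[mu]_(x in (fun x : R => (x + a)%R) @^-1` setT) (f \o (fun x : R => (x + a)%R)) x)%E.
rewrite -(ge0_integral_pushforward (phi := fun x : measurableTypeR R => (x + a : measurableTypeR R)))//.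
apply: eq_measure_integral => A mA _ /=.
exact: lebesgue_measure_shift.
Qed.

End lebesgue_translation.

Section lebesgue_cV_theory.
Context {R : realType}.

Lemma lebesgue_cV_set0 n : lebesgue_cV (set0 : set 'cV[R]_n) = 0%E.
Proof.
elim: n => [|n IH] /=; first by rewrite indicE in_set0.
by apply: integral0_eq => t _; rewrite -[RHS]IH; congr lebesgue_cV.
Qed.

Lemma lebesgue_cV_ge0 n (A : set 'cV[R]_n) : (0 <= lebesgue_cV A)%E.
Proof.
elim: n A => [|n IH] A /=; first by rewrite lee_fin.
by apply: integral_ge0 => t _; exact: IH.
Qed.

Lemma col_mx_ord0 n (t : R) (v : 'cV[R]_n) :
  (col_mx (t%:M : 'M[R]_1) v : 'cV[R]_n.+1) 0 0 = t.
Proof.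
have -> : (0 : 'I_n.+1) = lshift n (0 : 'I_1) by exact: val_inj.
by apply: (etrans (col_mxEu _ _ _ _)); rewrite mxE eqxx mulr1n.
Qed.

Lemma col_mx_lift n (t : R) (v : 'cV[R]_n) i :
  (col_mx (t%:M : 'M[R]_1) v : 'cV[R]_n.+1) (lift 0 i) 0 = v i 0.
Proof.
have -> : lift 0 i = rshift 1 i :> 'I_n.+1 by exact: val_inj.
exact: col_mxEd.
Qed.

Lemma lebesgue_cV_box n (a b : R) : a <= b ->
  lebesgue_cV [set v : 'cV[R]_n | forall i, a <= v i 0 <= b] = ((b - a) ^+ n)%:E.
Proof.
move=> ab; elim: n => [|n IH] /=.
  by rewrite indicE mem_set ?expr0//= => -[].
rewrite (_ : (fun t : R => _) = (cst ((b - a) ^+ n)%:E) \_ `[a, b]); last first.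
  apply/funext => t; rewrite patchE; case: ifPn => [|tab].
    rewrite inE /= in_itv /= => tab; rewrite -IH; congr lebesgue_cV.
    apply/seteqP; split => v /= h i; first by have := h (lift 0 i); rewrite col_mx_lift.
    by have [j ->|->] := unliftP 0 i; rewrite ?col_mx_lift ?col_mx_ord0.
  rewrite -[RHS](lebesgue_cV_set0 n); congr lebesgue_cV; rewrite -subset0 => v /= /(_ 0).
  by rewrite col_mx_ord0 => h; move/negP: tab; apply; rewrite inE /= in_itv.
rewrite -integral_mkcond integral_cst//= lebesgue_measure_itv /= lte_fin.
case: ifPn => [_|]; first by rewrite -EFinB -EFinM exprSr.
by rewrite -leNgt => ba; rewrite (le_anti (introT andP (conj ab ba))) subrr mule0 expr0n.
Qed.

Lemma measurable_col_mx n :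
  measurable_fun [set: measurableTypeR R * borelM R n 1]
    (fun x => col_mx (x.1%:M : 'M[R]_1) (x.2 : 'cV[R]_n) : borelM R n.+1 1).
Proof.
apply: measurable_mx => i j; rewrite (ord1 j).
have [k ->|->] := unliftP 0 i.
  under eq_fun do rewrite col_mx_lift.
  exact: measurable_coord_comp.
by under eq_fun do rewrite col_mx_ord0; exact: measurable_fst.
Qed.

Lemma lebesgue_cV_sigma_finite n (m : {measure set (borelM R n 1) -> \bar R}) :
  (forall A, measurable A -> m A = lebesgue_cV A) -> sigma_finite setT m.
Proof.
move=> mE.
have mB k : measurable ([set v : 'cV[R]_n | forall i, - k%:R <= v i 0 <= k%:R] : set (borelM R n 1)).
  rewrite (_ : [set v | _] = \bigcap_(i in [set: 'I_n])
      ((fun v : 'cV[R]_n => v i 0) @^-1` `[- k%:R, k%:R])); last first.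
    by apply/seteqP; split => v /= h i; [|have /= := h i I]; rewrite ?in_itv//=; move: (h i).
  apply: fin_bigcap_measurable => // i _.
  by rewrite -[X in measurable X]setTI; exact: measurable_coord.
exists (fun k => [set v : 'cV[R]_n | forall i, - k%:R <= v i 0 <= k%:R]).
  apply/esym; rewrite -subTset => v _; exists (Num.truncn `|v|).+1 => //= i.
  rewrite -ler_norml; apply: le_trans (coord_le_norm _ _ _) (ltW _).
  exact: truncnS_gt.
by move=> k; split; [exact: mB|rewrite mE// lebesgue_cV_box ?ltry//; apply: (@le_trans _ _ 0); rewrite ?oppr_le0 ler0n].
Qed.

(** [lebesgue_cV] is a set function on all sets, given by iterated integrals. On Borel sets it is
    the image of a product measure under stacking a coordinate on top of a vector, and measure
    theory is applied to it through this lemma. *)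
Lemma lebesgue_cV_measure n : exists mu : {sigma_finite_measure set (borelM R n 1) -> \bar R},
  forall A, measurable A -> mu A = lebesgue_cV A.
Proof.
elim: n => [|n [mu muE]].
  have [|mu muE] := @sigma_finite_pack _ (borelM R 0 1) R (\d_(0 : borelM R 0 1)).
    by apply: lebesgue_cV_sigma_finite => A mA /=; rewrite diracE indicE.
  by exists mu => A mA; rewrite muE /= /dirac indicE.
have [m mphi] := pushforward_pack (@lebesgue_measure R \x mu)%E (@measurable_col_mx n).
have mE A : measurable A -> m A = lebesgue_cV A.
  move=> mA; rewrite mphi /= /product_measure1 /=.
  apply: eq_integral => t _ /=; rewrite muE; last first.
    apply: measurable_xsection; rewrite -[X in measurable X]setTI.
    exact: measurable_col_mx.
  by congr lebesgue_cV; apply/seteqP; split => v; rewrite xsectionE.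
have [|mu' mu'E] := @sigma_finite_pack _ _ R m.
  exact: lebesgue_cV_sigma_finite.
by exists mu' => A mA; rewrite mu'E mE.
Qed.

End lebesgue_cV_theory.

Section lebesgue_cV_invariance.
Context {R : realType}.

(** Induction over the coordinates: either the remaining part [u'] of u is non-zero and every
    section lies in an affine hyperplane, or at most one section is non-empty. The alternative c !=
    0 admits u = 0, where A is empty; dimension 0 leaves no other case. *)
Lemma lebesgue_cV_null n (u : 'cV[R]_n) (c : R) (A : set 'cV[R]_n) :
  (u != 0) || (c != 0) -> (forall v, A v -> (u^T *m v) 0 0 = c) ->
  lebesgue_cV A = 0%E.
Proof.
elim: n u c A => [|n IH] u c A uc hA /=.
  rewrite indicE; case: (boolP (0 \in A)) => // /set_mem /hA.
  rewrite mulmx0 mxE => c0; move: uc; rewrite -c0 eqxx orbF => /eqP; case.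
  by apply/colP => -[].
pose u' : 'cV[R]_n := \col_i u (lift 0 i) 0.
have dotS (t : R) (v : 'cV[R]_n) :
    (u^T *m (col_mx (t%:M : 'M[R]_1) v : 'cV[R]_n.+1)) 0 0 = u 0 0 * t + (u'^T *m v) 0 0.
  rewrite !mxE big_ord_recl col_mx_ord0 mxE; congr (_ + _).
  by apply: eq_bigr => i _; rewrite col_mx_lift !mxE.
have [u'0|u'0] := eqVneq u' 0; last first.
  apply: integral0_eq => t _; apply: (IH u' (c - u 0 0 * t)); first by rewrite u'0.
  by move=> v /hA; rewrite dotS => <-; rewrite addrC addKr.
have [u0|u0] := eqVneq (u 0 0) 0.
  apply: integral0_eq => t _.
  apply: (IH u' (c - u 0 0 * t)).
    rewrite u'0 u0 mul0r subr0 eqxx /=; move: uc; case: eqP => //= u00 _.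
    by exfalso; apply: u00; apply/colP => i; rewrite mxE;
      have [j ->|->//] := unliftP 0 i; have := congr1 (fun v : 'cV_n => v j 0) u'0; rewrite !mxE.
  by move=> v /hA; rewrite dotS => <-; rewrite addrC addKr.
(* Only the section at t = c / u_0 can be non-empty, and one value of t does not affect the
   integral. *)
have F0 t : t != c / u 0 0 -> lebesgue_cV [set v : 'cV[R]_n | A (col_mx (t%:M : 'M[R]_1) v)] = 0%E.
  move=> tc; rewrite -[RHS](lebesgue_cV_set0 n); congr lebesgue_cV.
  rewrite -subset0 => v /= /hA; rewrite dotS u'0 trmx0 mul0mx mxE addr0 => e.
  by move/eqP: tc; apply; rewrite -e mulrC mulKf.
rewrite -(@integral_setD1 _ _ (c / u 0 0) setT).
- by apply: integral0_eq => t [_ /= /eqP /F0].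
- exact: measurableD.
- apply: (eq_measurable_fun (cst 0%E)); last exact: measurable_cst.
  by move=> t /set_mem [_ /= /eqP /F0].
Qed.

(** The first coordinate of y shifts the outer integral, the others shift the sections. *)
Lemma lebesgue_cV_shift n (y : 'cV[R]_n) (A : set (borelM R n 1)) : measurable A ->
  lebesgue_cV [set x : 'cV[R]_n | A (x + y)] = lebesgue_cV (A : set 'cV[R]_n).
Proof.
elim: n y A => [|n IH] y A mA /=.
  by rewrite !indicE; congr (_%:R%:E); congr (nat_of_bool _); apply/idP/idP => /set_mem h;
    apply/mem_set; move: h; rewrite /= (_ : 0 + y = 0)//; apply/colP => -[].
have [mu muE] := lebesgue_cV_measure (R := R) n.
pose y' : 'cV[R]_n := \col_i y (lift 0 i) 0.
pose F t := lebesgue_cV [set v : 'cV[R]_n | A (col_mx (t%:M : 'M[R]_1) v)].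
have mS : measurable ((fun x : measurableTypeR R * borelM R n 1 =>
    col_mx (x.1%:M : 'M[R]_1) (x.2 : 'cV[R]_n) : borelM R n.+1 1) @^-1` A).
  by rewrite -[X in measurable X]setTI; exact: measurable_col_mx.
have mSt t : measurable ([set v : 'cV[R]_n | A (col_mx (t%:M : 'M[R]_1) v)] : set (borelM R n 1)).
  rewrite (_ : [set v | _] = xsection ((fun x : measurableTypeR R * borelM R n 1 =>
    col_mx (x.1%:M : 'M[R]_1) (x.2 : 'cV[R]_n) : borelM R n.+1 1) @^-1` A) t).
    exact: measurable_xsection.
  by apply/seteqP; split => v; rewrite xsectionE.
transitivity (\int[lebesgue_measure]_t F (t + y 0 0)%R)%E.
  apply: eq_integral => t _; rewrite /F -(IH y' _ (mSt _)).
  congr lebesgue_cV; apply/seteqP; split => v /=;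
    rewrite (_ : (col_mx (t%:M : 'M[R]_1) v : 'cV[R]_n.+1) + y =
     col_mx ((t + y 0 0)%:M : 'M[R]_1) (v + y'))//; apply/colP => i;
    by have [j ->|->] := unliftP 0 i; rewrite [LHS]mxE ?col_mx_lift ?col_mx_ord0 ?mxE.
apply: integral_shift; last by move=> t; exact: lebesgue_cV_ge0.
rewrite (_ : F = mu \o xsection ((fun x : measurableTypeR R * borelM R n 1 =>
    col_mx (x.1%:M : 'M[R]_1) (x.2 : 'cV[R]_n) : borelM R n.+1 1) @^-1` A)).
  exact: measurable_fun_xsection.
by apply/funext => t; rewrite /F /= xsectionE muE//; exact: mSt.
Qed.

Lemma fubini_set d1 d2 (T1 : measurableType d1) (T2 : measurableType d2)
    (m1 : {sigma_finite_measure set T1 -> \bar R})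
    (m2 : {sigma_finite_measure set T2 -> \bar R}) (E : set (T1 * T2)) :
  measurable E ->
  (\int[m1]_x m2 [set y | E (x, y)] = \int[m2]_y m1 [set x | E (x, y)])%E.
Proof.
move=> mE.
have := @fubini_tonelli _ _ T1 T2 R m1 m2 (fun z => (\1_E z)%:E).
move=> H; transitivity (\int[m1]_x \int[m2]_y (\1_E (x, y))%:E)%E.
  apply: eq_integral => x _; rewrite integral_indic ?setIT//.
  by rewrite -[X in measurable X]xsectionE; exact: measurable_xsection.
rewrite H; last 2 first.
- exact/measurable_EFinP.
- by move=> z; rewrite lee_fin.
apply: eq_integral => y _; rewrite integral_indic ?setIT//.
by rewrite -[X in measurable X]ysectionE; exact: measurable_ysection.
Qed.

(** The uniqueness argument for Haar measures: the double integral of 1{x in A, x + y in B} is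
    computed in both orders, with the substitution x |-> x - y made before the second; the inner
    integrals are nu B and nu (-A). *)
Lemma translation_invariant_mul n
    (mu nu : {sigma_finite_measure set (borelM R n 1) -> \bar R}) :
  (forall (y : 'cV[R]_n) (A : set (borelM R n 1)), measurable A -> mu [set x : 'cV[R]_n | A (x + y)] = mu A) ->
  (forall (y : 'cV[R]_n) (A : set (borelM R n 1)), measurable A -> nu [set x : 'cV[R]_n | A (x + y)] = nu A) ->
  forall A B : set (borelM R n 1), measurable A -> measurable B ->
  (mu A * nu B = nu [set x : 'cV[R]_n | A (- x)%R] * mu B)%E.
Proof.
move=> mut nut A B mA mB.
have mNA : measurable ([set x : 'cV[R]_n | A (- x)] : set (borelM R n 1)).
  rewrite -[X in measurable X]setTI.
  by apply: (measurable_oppmx (f := id)) => //; exact: measurable_id.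
pose T := (borelM R n 1 * borelM R n 1)%type.
have madd : measurable_fun [set: T] (fun x => (x.1 : 'cV[R]_n) + (x.2 : 'cV[R]_n) : borelM R n 1).
  exact: measurable_addmx.
have msub : measurable_fun [set: T] (fun x => (x.1 : 'cV[R]_n) - (x.2 : 'cV[R]_n) : borelM R n 1).
  by apply: measurable_addmx => //; exact: measurable_oppmx.
have mE1 : measurable ([set x : T | A x.1 /\ B ((x.1 : 'cV[R]_n) + (x.2 : 'cV[R]_n))]).
  apply: measurableI; rewrite -[X in measurable X]setTI.
    exact: measurable_fst.
  exact: madd.
have mE2 : measurable ([set x : T | A ((x.1 : 'cV[R]_n) - (x.2 : 'cV[R]_n)) /\ B x.1]).
  apply: measurableI; rewrite -[X in measurable X]setTI.
    exact: msub.
  exact: measurable_fst.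
transitivity (\int[mu]_x nu [set y : 'cV[R]_n | A x /\ B ((x : 'cV[R]_n) + y)%R])%E.
  transitivity (\int[mu]_x ((\1_A x)%:E * nu B))%E.
    rewrite ge0_integralZr//; last exact/measurable_EFinP.
    by rewrite integral_indic// setIT.
  apply: eq_integral => x _; rewrite indicE; case: (boolP (x \in A)) => [|xA].
    rewrite inE => xA; rewrite mul1e -(nut x)//; congr (nu _).
    by apply/seteqP; split => y /=; rewrite addrC; [split|case].
  rewrite mul0e (_ : [set y | _] = set0) ?measure0//.
  by rewrite -subset0 => y [] /mem_set; rewrite (negbTE xA).
apply: (etrans (fubini_set mu nu mE1)) => /=.
transitivity (\int[nu]_y mu [set x : 'cV[R]_n | A (x - (y : 'cV[R]_n))%R /\ B x])%E.
  apply: eq_integral => y _; rewrite -(mut y [set x : 'cV[R]_n | A (x - (y : 'cV[R]_n)) /\ B x]).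
    by congr (mu _); apply/seteqP; split => x /=; rewrite addrK.
  have := measurable_ysection y mE2.
  by rewrite ysectionE.
apply: (etrans (esym (fubini_set mu nu mE2))) => /=.
transitivity (\int[mu]_x (nu [set x : 'cV[R]_n | A (- x)%R] * (\1_B x)%:E))%E.
  apply: eq_integral => x _; rewrite indicE; case: (boolP (x \in B)) => [|xB].
    rewrite inE => xB; rewrite mule1 -(nut (- (x : 'cV[R]_n)) [set x : 'cV[R]_n | A (- x)])//.
    by congr (nu _); apply/seteqP; split => y /=; rewrite opprB; [case|split].
  rewrite mule0 (_ : [set y | _] = set0) ?measure0//.
  by rewrite -subset0 => y [_] /mem_set; rewrite (negbTE xB).
rewrite ge0_integralZl//; last exact/measurable_EFinP.
by rewrite integral_indic// setIT.
Qed.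

End lebesgue_cV_invariance.

Lemma measurable_fun_inv (R : realType) : measurable_fun [set: R] (@GRing.inv R).
Proof.
rewrite -(setvU [set 0 : R]); apply/measurable_funU => //.
  exact: measurableC.
split; last exact: measurable_fun_set1.
apply: open_continuous_measurable_fun; first by apply: closed_openC; exact: closed_eq.
by move=> x /set_mem /= /eqP x0; exact: inv_continuous.
Qed.

Section lebesgue_rotation.
Context {R : realType} {d : nat}.
Notation punctured_ball := (spherical_cone (sphere R d)).

Lemma spherical_coneE (A : set (vec R d)) :
  spherical_cone A = [set y | 0 < enorm y <= 1 /\ A (normalize y)].
Proof.
apply/seteqP; split => y /=.
  move=> [t [x [/andP[t0 t1] hx Ax ->]]].
  by rewrite enormZ gtr0_norm// hx mulr1 t0 t1 normalizeZ// normalize_sphere.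
move=> [/andP[y0 y1] Ay]; exists (enorm y), (normalize y); split => //.
- by rewrite y0.
- by apply: sphere_normalize; rewrite -enorm_gt0.
- by rewrite /normalize scalerA divff ?scale1r// gt_eqF.
Qed.

Lemma punctured_ballE : punctured_ball = [set y | 0 < enorm y <= 1].
Proof.
rewrite spherical_coneE; apply/seteqP; split => y /=; first by case.
move=> /[dup] /andP[y0 _] ->; split => //.
by apply: sphere_normalize; rewrite -enorm_gt0.
Qed.

Lemma measurable_enorm : measurable_fun [set: borel_vec R d] (@enorm R d).
Proof. by apply: continuous_borelM_R; exact: enorm_continuous. Qed.

Lemma measurable_punctured_ball : measurable (punctured_ball : set (borel_vec R d)).
Proof.
rewrite punctured_ballE (_ : [set y | _] = @enorm R d @^-1` `]0, 1]).
  by rewrite -[X in measurable X]setTI; exact: measurable_enorm.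
by apply/seteqP; split => y; rewrite /= in_itv.
Qed.

Lemma measurable_normalize :
  measurable_fun [set: borel_vec R d] (@normalize R d : borel_vec R d -> borel_vec R d).
Proof.
apply: measurable_mx => i j; rewrite /normalize.
under eq_fun do rewrite mxE.
apply: measurable_funM; last exact: measurable_coord.
by apply: (measurableT_comp (@measurable_fun_inv R)); exact: measurable_enorm.
Qed.

Lemma measurable_spherical_cone (A : set (borel_vec R d)) :
  measurable A -> measurable (spherical_cone A : set (borel_vec R d)).
Proof.
move=> mA; rewrite spherical_coneE.
rewrite (_ : [set y | _] = punctured_ball `&` (@normalize R d @^-1` A)).
  apply: measurableI; first exact: measurable_punctured_ball.
  by rewrite -[X in measurable X]setTI; exact: measurable_normalize.
by rewrite punctured_ballE.
Qed.

Lemma lebesgue_punctured_ball :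
  (0 < lebesgue_cV punctured_ball)%E /\ (lebesgue_cV punctured_ball < +oo)%E.
Proof.
have [mu muE] := lebesgue_cV_measure (R := R) d.+1.
have mB a b : measurable ([set v : vec R d | forall i, a <= v i 0 <= b] : set (borel_vec R d)).
  rewrite (_ : [set v | _] = \bigcap_(i in [set: 'I_d.+1])
      ((fun v : vec R d => v i 0) @^-1` `[a, b])); last first.
    by apply/seteqP; split => v /= h i; [|have /= := h i I]; rewrite ?in_itv//=; move: (h i).
  apply: fin_bigcap_measurable => // i _.
  by rewrite -[X in measurable X]setTI; exact: measurable_coord.
(* The Euclidean norm is at most d + 1 times the sup norm, so the cube [e / 2, e]^(d+1) lies in the
   punctured ball, which in turn lies in [-1, 1]^(d+1). *)
pose e : R := d.+1%:R^-1.
have e0 : 0 < e by rewrite invr_gt0.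
have mpb := measurable_punctured_ball.
rewrite -muE//; split.
  apply: (@lt_le_trans _ _ (mu [set v : vec R d | forall i, e / 2 <= v i 0 <= e])).
    rewrite muE// lebesgue_cV_box ?ler_pdivrMr ?ler_peMr ?ltW// ?ltr1n//.
      by rewrite lte_fin exprn_gt0// subr_gt0 ltr_pdivrMr// ltr_pMr// ltr1n.
  apply: le_measure; rewrite ?inE// punctured_ballE => v /= h; apply/andP; split.
    have := h 0 => /andP[h0 _]; apply: lt_le_trans (coord_le_enorm v 0).
    by apply: lt_le_trans (ler_norm _); apply: lt_le_trans h0; rewrite divr_gt0.
  apply: le_trans (enorm_le_norm v) _.
  rewrite -ler_pdivlMl// mulr1 [leLHS]/Num.norm /= mx_normrE.
  apply/bigmax_leP; split; first exact: ltW.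
  move=> [i j] _ /=; rewrite (ord1 j) ger0_norm; first by case/andP: (h i).
  by case/andP: (h i) => + _; apply: le_trans; rewrite divr_ge0// ltW.
apply: (@le_lt_trans _ _ (mu [set v : vec R d | forall i, -1 <= v i 0 <= 1])).
  apply: le_measure; rewrite ?inE// punctured_ballE => v /= /andP[_ h] i.
  by rewrite -ler_norml (le_trans (coord_le_enorm v i)).
by rewrite muE// lebesgue_cV_box ?ltry// lerN10.
Qed.

(** The image [nu] of Lebesgue measure under the orthogonal map is again translation invariant,
    hence proportional to it; the constant is 1 because the map preserves the punctured ball. *)
Lemma lebesgue_cV_rot (rho : 'M[R]_d.+1) (A : set (borel_vec R d)) :
  rho^T *m rho = 1%:M -> measurable A ->
  lebesgue_cV [set x : vec R d | A (rho *m x)] = lebesgue_cV (A : set (vec R d)).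
Proof.
move=> rr; have rr' := mulmx1C rr.
have [mu muE] := lebesgue_cV_measure (R := R) d.+1.
have mut (y : vec R d) (B : set (borel_vec R d)) : measurable B ->
    mu [set x : vec R d | B (x + y)] = mu B.
  move=> mB; rewrite !muE ?lebesgue_cV_shift// -[X in measurable X]setTI.
  by apply: measurable_addmx => //; exact: measurable_cst.
have mrho (r : 'M[R]_d.+1) :
    measurable_fun [set: borel_vec R d] (fun x => r *m (x : vec R d) : borel_vec R d).
  by apply: continuous_borelM; exact: continuous_mulmxl.
have [nu' nu'E] := pushforward_pack mu (mrho rho).
have [|nu nuE'] := @sigma_finite_pack _ _ _ nu'.
  have [F [FU Foo]] := sigma_finiteT mu.
  exists (fun n => mulmx rho^T @^-1` F n).
    rewrite -preimage_bigcup -FU; first by rewrite preimage_setT.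
  move=> n; have [mF Fn] := Foo n; split.
    by rewrite -[X in measurable X]setTI; exact: mrho.
  rewrite nu'E -comp_preimage (_ : mulmx rho^T \o _ = id) ?preimage_id//.
  by apply/funext => x /=; rewrite mulmxA rr mul1mx.
have nuE B : nu B = mu (mulmx rho @^-1` B) by rewrite nuE' nu'E.
have nut (y : vec R d) (B : set (borel_vec R d)) : measurable B ->
    nu [set x : vec R d | B (x + y)] = nu B.
  move=> mB; rewrite !nuE -(mut (rho^T *m y) (mulmx rho @^-1` B)).
    congr (mu _); apply/seteqP; split => x /=; by rewrite mulmxDr mulmxA rr' mul1mx.
  by rewrite -[X in measurable X]setTI; exact: mrho.
have [b0 boo] := lebesgue_punctured_ball.
have mpb := measurable_punctured_ball.
(* The ball has positive finite measure, so it can be cancelled from [translation_invariant_mul]. *)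
have key (m : {sigma_finite_measure set (borel_vec R d) -> \bar R}) :
    (forall (y : vec R d) (B : set (borel_vec R d)), measurable B ->
      m [set x : vec R d | B (x + y)] = m B) ->
    m punctured_ball = mu punctured_ball ->
    forall B : set (borel_vec R d), measurable B -> mu B = m [set x : vec R d | B (- x)].
  move=> mt mb B mB; have := translation_invariant_mul mut mt mB mpb.
  rewrite mb => /(congr1 (fun x => x * ((fine (mu punctured_ball))^-1)%:E))%E.
  have bK x : (x * mu punctured_ball * ((fine (mu punctured_ball))^-1)%:E)%E = x.
    rewrite -muleA -[X in (_ * (X * _))%E]fineK; last by rewrite muE// fin_num_abs gee0_abs// ltW.
    by rewrite -EFinM divff ?mule1// gt_eqF// fine_gt0// muE// b0.
  by rewrite !bK.
have mN (B : set (borel_vec R d)) : measurable B ->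
    measurable ([set x : vec R d | B (- x)] : set (borel_vec R d)).
  move=> mB; rewrite -[X in measurable X]setTI.
  by apply: (measurable_oppmx (f := id)) => //; exact: measurable_id.
have nub : nu punctured_ball = mu punctured_ball.
  rewrite nuE; congr (mu _); rewrite punctured_ballE.
  by apply/seteqP; split => x /=; rewrite orth_enorm.
move=> mA; have mrA : measurable (mulmx rho @^-1` A : set (borel_vec R d)).
  by rewrite -[X in measurable X]setTI; exact: mrho.
rewrite -[LHS]muE// -[RHS]muE//.
(* [key] compares a set with its reflection at the origin; applying it to -A with [nu] and with [mu]
   eliminates the reflection. *)
have := key nu nut nub _ (mN _ mA).
have NN : [set x : vec R d | [set x0 : vec R d | A (- x0)] (- x)] = A.
  by apply/seteqP; split => x /=; rewrite opprK.
rewrite NN => e1; have := key mu mut erefl _ (mN _ mA); rewrite NN e1 => <-.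
by rewrite nuE.
Qed.

End lebesgue_rotation.

Lemma normalize_orth {R : realType} {d : nat} (rho : 'M[R]_d.+1) (x : vec R d) :
  rho^T *m rho = 1%:M -> normalize (rho *m x) = rho *m normalize x.
Proof. by move=> h; rewrite /normalize orth_enorm// scalemxAr. Qed.

(** * The normalized surface measure *)

Section sigma_sph_theory.
Context {R : realType} {d : nat}.
Notation punctured_ball := (spherical_cone (sphere R d)).

Lemma sigma_sph_sphere : sigma_sph (sphere R d) = 1%E.
Proof.
have [b0 boo] := @lebesgue_punctured_ball R d.
rewrite /sigma_sph -[X in (X * _)%E]fineK; last by rewrite fin_num_abs gee0_abs// ltW.
by rewrite -EFinM divff// gt_eqF// fine_gt0// b0.
Qed.

Lemma sigma_sph_hyperplane (u : vec R d) (A : set (vec R d)) :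
  u != 0 -> (forall x, A x -> dot u x = 0) -> sigma_sph A = 0%E.
Proof.
move=> u0 hA; rewrite /sigma_sph (@lebesgue_cV_null _ _ u 0) ?mul0e ?u0//.
move=> v [t [x [_ _ Ax ->]]].
by rewrite -[LHS]/(dot u (t *: x)) dotZr hA// mulr0.
Qed.

(* The image of Haar measure under rho |-> rho^-1 p is the normalized surface
   measure: integrate the indicator of {(y, rho) | y in ball, rho^-1 (y/|y|) in A}
   in both orders; the inner integral over rho does not depend on y by left
   invariance and transitivity. *)
Lemma sigma_sph_haar (lambda : probability (borelM R d.+1 d.+1) R) (p : vec R d)
    (A : set (borel_vec R d)) :
  (0 < d)%N -> haar_probability (SO R d) lambda -> sphere R d p -> measurable A ->
  sigma_sph (A : set (vec R d)) = lambda [set rho | SO R d rho /\ A (rho^T *m p)].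
Proof.
move=> d0 [lSO linv] hp mA.
have [mu muE] := lebesgue_cV_measure (R := R) d.+1.
have [b0 boo] := @lebesgue_punctured_ball R d.
have mpb := @measurable_punctured_ball R d.
have mcA := measurable_spherical_cone mA.
have mg (x : vec R d) : measurable ([set rho | SO R d rho /\ A (rho^T *m x)] : set (borelM R d.+1 d.+1)).
  apply: measurableI; first exact: measurable_SO.
  rewrite -[X in measurable X]setTI.
  apply: (measurable_mulmx (f := fun rho : borelM R d.+1 d.+1 => (rho : 'M[R]_d.+1)^T : borelM R d.+1 d.+1)
    (g := fun _ => x)) => //.
  exact: (measurable_trmx (f := id)).
have gE (x : vec R d) : sphere R d x ->
    lambda [set rho | SO R d rho /\ A (rho^T *m x)] = lambda [set rho | SO R d rho /\ A (rho^T *m p)].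
  move=> hx; have [g gSO gx] := SO_transitive d0 hx hp.
  rewrite -(linv g gSO _ (mg p)); congr (lambda _).
  apply/seteqP; split => rho /= [hr Ar]; split.
  - exact: SO_mul.
  - by rewrite trmx_mul -mulmxA -gx SO_mulK.
  - by rewrite -(mul1mx rho) -(SO_trK gSO) -mulmxA; apply: SO_mul => //; exact: SO_tr.
  - by move: Ar; rewrite trmx_mul -mulmxA -gx SO_mulK.
pose T := (borel_vec R d * borelM R d.+1 d.+1)%type.
pose f (z : T) : borel_vec R d := (z.2 : 'M[R]_d.+1)^T *m (z.1 : vec R d).
have mf : measurable_fun [set: T] f.
  apply: measurable_mulmx => //.
  by apply: (measurable_trmx (f := snd)); exact: measurable_snd.
pose E : set T := [set z | SO R d z.2 /\ spherical_cone A (f z)].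
have mE : measurable E.
  apply: measurableI; rewrite -[X in measurable X]setTI.
    by apply: measurable_snd => //; exact: measurable_SO.
  exact: mf.
have := fubini_set mu lambda mE.
rewrite /E /=.
rewrite (_ : (fun x : borel_vec R d => _) = fun y => (\1_punctured_ball y)%:E *
    lambda [set rho | SO R d rho /\ A (rho^T *m p)])%E; last first.
  apply/funext => y; rewrite indicE; case: (boolP (y \in _)) => [|yb].
    rewrite inE punctured_ballE /= => yb; rewrite mul1e.
    have y0 : y != 0 by rewrite -enorm_gt0; case/andP: yb.
    rewrite -(gE _ (sphere_normalize y0)); congr (lambda _).
    apply/seteqP; split => rho; rewrite spherical_coneE /f /= => -[hr].
      by rewrite normalize_orth; [case=> _|exact: SO_trK (SO_tr hr)].
    by move=> h; rewrite normalize_orth ?orth_enorm//; exact: SO_trK (SO_tr hr).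
  rewrite mul0e (_ : [set rho | _] = set0) ?measure0//.
  rewrite -subset0 => rho /= [hr]; rewrite spherical_coneE /f /= => -[h _].
  move/negP: yb; apply; rewrite inE punctured_ballE /=.
  by move: h; rewrite orth_enorm//; exact: SO_trK (SO_tr hr).
rewrite ge0_integralZr//; last exact/measurable_EFinP.
rewrite integral_indic// setIT.
rewrite (_ : (fun y : borelM R d.+1 d.+1 => _) = fun rho => ((\1_(SO R d) rho)%:E * mu (spherical_cone A))%E); last first.
  apply/funext => rho; rewrite indicE; case: (boolP (rho \in _)) => [|hr].
    rewrite inE => hr; rewrite mul1e !muE//.
      rewrite -[RHS](lebesgue_cV_rot (SO_trK (SO_tr hr)) mcA).
      by congr lebesgue_cV; apply/seteqP; split => x /=; [case|split].
    by have := measurable_ysection rho mE; rewrite ysectionE.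
  rewrite mul0e (_ : [set _ | _] = set0) ?measure0//.
  by rewrite -subset0 => y [] /mem_set; rewrite (negbTE hr).
rewrite ge0_integralZr//; last by apply/measurable_EFinP/measurable_indic; exact: measurable_SO.
rewrite integral_indic ?setIT//; last exact: measurable_SO.
move=> H; have {}H : (mu punctured_ball * lambda [set rho | SO R d rho /\ A (rho^T *m p)] =
    mu (spherical_cone A))%E by rewrite H -[RHS]mul1e; congr (_ * _)%E.
rewrite /sigma_sph -!muE// -H muleC muleA.
rewrite -[X in (_ * X * _)%E]fineK; last by rewrite muE// fin_num_abs gee0_abs// ltW.
by rewrite -EFinM mulVf ?mul1e// gt_eqF// fine_gt0// muE// b0.
Qed.

End sigma_sph_theory.

(** * Measurability in the hyperspace *)

Section hyperspace_measurability.
Context {R : realType} {d : nat}.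
Implicit Types (x y z : vec R d) (C D K : set (vec R d)).

Lemma hausdorff_dist_lt C D (e : R) : compacts C -> compacts D ->
  hausdorff_dist C D < e ->
  exists2 e', 0 <= e' < e &
    (forall x, C x -> exists2 y, D y & enorm (x - y) <= e') /\
    (forall y, D y -> exists2 x, C x & enorm (x - y) <= e').
Proof.
move=> [CS _ [x0 Cx0]] [DS _ [y0 Dy0]] /inf_lt[|e' [e'0 h1 h2] e'e]; last first.
  by exists e' => //; rewrite e'0.
(* The infimum defining the distance must be over a non-empty set; it contains 2, a bound for the
   diameter of the sphere. *)
have le2 x y : sphere R d x -> sphere R d y -> enorm (x - y) <= 2.
  move=> /sphereE hx /sphereE hy.
  rewrite -(@ler_pXn2r _ 2) ?nnegrE ?enorm_ge0// enormE.
  have := dotxx_ge0 (x + y).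
  rewrite !(dotDl, dotDr, dotNr, dotNl) hx hy (dotC y x); lra.
exists 2; split => // [x Cx|y Dy]; first by exists y0 => //; apply: le2; auto.
by exists x0 => //; apply: le2; auto.
Qed.

Lemma hausdorff_dist_le C D (e : R) : 0 <= e ->
  (forall x, C x -> exists2 y, D y & enorm (x - y) <= e) ->
  (forall y, D y -> exists2 x, C x & enorm (x - y) <= e) ->
  hausdorff_dist C D <= e.
Proof. by move=> e0 h1 h2; apply: ge_inf => //; exists 0 => r []. Qed.

Lemma hausdorff_open_measurable (U : set (set (vec R d))) :
  hausdorff_open U -> measurable (U : set (hyper R d)).
Proof. by move=> oU; apply: sub_sigma_algebra. Qed.

Lemma measurable_compacts : measurable (@compacts R d : set (hyper R d)).
Proof. by apply: hausdorff_open_measurable; split => // C _; exists 1. Qed.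

Lemma ball_norm_lt x y (e : R) : `|x - y| < e -> ball x e y.
Proof. by rewrite mx_norm_ball. Qed.

Lemma open_norm_ball (U : set (vec R d)) x : open U -> U x ->
  exists2 e : R, 0 < e & forall y, `|x - y| < e -> U y.
Proof.
rewrite openE => /(_ x) h Ux; have := h Ux.
by move=> /nbhs_ballP[e e0 he]; exists e => // y /ball_norm_lt /he.
Qed.

(** A compact set Hausdorff-close to C has a point close to a given x in C and U. Hitting the
    rational boxes gives the countably many measurable tests on which membership and equality of
    compact sets rest. *)
Lemma hit_open (U : set (vec R d)) : open U ->
  hausdorff_open [set K | compacts K /\ (K `&` U) !=set0].
Proof.
move=> oU; split => [K []//|C /= [cC [x [Cx Ux]]]].
have [e e0 he] := open_norm_ball oU Ux.
exists e => // D cD /(hausdorff_dist_lt cC cD)[e' /andP[_ e'e] [/(_ x Cx)[y Dy xy] _]].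
split => //; exists y; split => //; apply: he.
exact: le_lt_trans (norm_le_enorm _) (le_lt_trans xy e'e).
Qed.

Lemma measurable_hit (U : set (vec R d)) : open U ->
  measurable ([set K | compacts K /\ (K `&` U) !=set0] : set (hyper R d)).
Proof. by move=> /hit_open/hausdorff_open_measurable. Qed.

Lemma open_rat_box n (q : 'cV[rat]_d.+1) : open (@rat_box R d.+1 1 n q).
Proof.
rewrite (_ : rat_box n q = ball (\matrix_(i, j) ratr (q i j) : vec R d) n.+1%:R^-1).
  exact: ball_open.
rewrite mx_norm_ball; apply/seteqP; split => x /= h.
  rewrite [ltLHS]/Num.norm /= mx_normrE; apply/bigmax_ltP; split => // -[i j] _ /=.
  by rewrite !mxE distrC; exact: h.
move=> i j; rewrite distrC; apply: le_lt_trans h.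
by have := coord_le_norm ((\matrix_(i, j) ratr (q i j)) - x) i j; rewrite !mxE.
Qed.

Lemma rat_box_cover n x : exists q : 'cV[rat]_d.+1, rat_box n q x.
Proof.
have H i j : exists q : rat, `|x i j - ratr q| < n.+1%:R^-1.
  have [|q] := @rat_in_itvoo _ (x i j - n.+1%:R^-1) (x i j + n.+1%:R^-1).
    by rewrite ltrD2l gt0_cp// invr_gt0.
  rewrite in_itv /= => /andP[h1 h2]; exists q; move: (ratr q) (_^-1) h1 h2 => a b h1 h2.
  rewrite ltr_norml; lra.
by exists (\matrix_(i, j) sval (cid (H i j))) => i j; rewrite mxE; case: cid.
Qed.

Lemma closed_rat_box K x : closed K ->
  (forall n, exists q : 'cV[rat]_d.+1, rat_box n q x /\ (K `&` rat_box n q) !=set0) ->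
  K x.
Proof.
move=> cK h; rewrite closure_id in cK; rewrite cK => B /nbhs_ballP[e /= e0 he].
pose n := Num.truncn (2 / e).
have ne : n.+1%:R^-1 < e / 2.
  by rewrite -[ltRHS]invf_div ltf_pV2 ?posrE ?divr_gt0// truncnS_gt.
have [q [xq [y [Ky yq]]]] := h n; exists y; split => //; apply: he.
split => // i j; rewrite /ball /=.
have := xq i j; have := yq i j; move: ne.
by move: (ratr (q i j)) (n.+1%:R^-1) => a b; rewrite !ltr_norml; lra.
Qed.

(** For closed K, x lies in K iff at every scale some rational box contains x and meets K, which
    builds the graph from countably many rectangles. Joint measurability in (x, K) is what Tonelli's
    theorem requires when p is moved by random rotations. *)
Lemma measurable_mem_graph :
  measurable ([set z | compacts z.2 /\ (z.2 : set (vec R d)) z.1] :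
    set (borel_vec R d * hyper R d)).
Proof.
rewrite (_ : [set z | _] = (setT `*` (@compacts R d : set (hyper R d))) `&`
   \bigcap_n \bigcup_(q : 'cV[rat]_d.+1)
   ((rat_box n q : set (borel_vec R d)) `*`
    ([set K | compacts K /\ (K `&` rat_box n q) !=set0] : set (hyper R d)))); last first.
  apply/seteqP; split => -[x K] /=.
    move=> [cK Kx]; split => // n _; have [q xq] := rat_box_cover n x.
    by exists q => //; split => //=; split => //; exists x.
  move=> [[_ cK] h]; split => //; apply: closed_rat_box; first exact: compacts_closed.
  by move=> n; have [q _ [/= xq [_ ?]]] := h n I; exists q.
apply: measurableI; first by apply: measurableX => //; exact: measurable_compacts.
apply: bigcapT_measurable => n; apply: countable_bigcupT_measurable => // q.
apply: measurableX; first by apply: open_borelM; exact: open_rat_box.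
by apply: measurable_hit; exact: open_rat_box.
Qed.

Lemma measurable_mem x :
  measurable ([set K | compacts K /\ K x] : set (hyper R d)).
Proof. have := @measurable_xsection _ _ (borel_vec R d) (hyper R d) _ x measurable_mem_graph.
by rewrite xsectionE. Qed.

Lemma compacts_eq K K' : compacts K -> compacts K' ->
  (forall n (q : 'cV[rat]_d.+1),
    (K `&` rat_box n q) !=set0 <-> (K' `&` rat_box n q) !=set0) -> K = K'.
Proof.
move=> cK cK' h; apply/seteqP; split => x Kx; apply: closed_rat_box => [|n].
- exact: compacts_closed.
- by have [q xq] := rat_box_cover n x; exists q; split => //; apply/h; exists x.
- exact: compacts_closed.
- by have [q xq] := rat_box_cover n x; exists q; split => //; apply/h; exists x.
Qed.

(** A compact set is determined by the rational boxes it meets. Measurability of singletons lets [m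
    [set K]] in [cells] be read as a multiplicity. *)
Lemma measurable_compact1 K : compacts K -> measurable ([set K] : set (hyper R d)).
Proof.
move=> cK.
rewrite (_ : [set K] = (@compacts R d : set (hyper R d)) `&`
   \bigcap_(nq in [set: nat * 'cV[rat]_d.+1])
     [set D | compacts D /\ ((D `&` rat_box nq.1 nq.2) !=set0 <->
         (K `&` rat_box nq.1 nq.2) !=set0)]); last first.
  apply/seteqP; split => D /=; first by move=> ->; split.
  by move=> [cD h]; apply: compacts_eq => // n q; have [_ ?] := h (n, q) I.
apply: measurableI; first exact: measurable_compacts.
rewrite -[X in measurable X]setCK setC_bigcap; apply: measurableC.
apply: countable_bigcupT_measurable => // -[n q] /=; apply: measurableC.
have mH := measurable_hit (@open_rat_box n q).
have [hK|hK] := pselect ((K `&` rat_box n q) !=set0).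
  rewrite (_ : [set D | _] = [set D | compacts D /\ (D `&` rat_box n q) !=set0])//.
  by apply/seteqP; split => D /= [cD]; [case=> _ /(_ hK)|move=> hD; split].
rewrite (_ : [set D | _] = (@compacts R d : set (hyper R d)) `\`
   [set D | compacts D /\ (D `&` rat_box n q) !=set0]).
  by apply: measurableD => //; exact: measurable_compacts.
apply/seteqP; split => D /=.
  by move=> [cD [h _]]; split => // -[_ /h].
by move=> [cD h]; split => //; split => // hD; exfalso; apply: h.
Qed.

(** Rotations preserve the Hausdorff distance, so preimages of open sets are open. *)
Lemma measurable_rotset (rho : 'M[R]_d.+1) : SO R d rho ->
  measurable_fun [set: hyper R d] (rotset rho : hyper R d -> hyper R d).
Proof.
move=> hr; apply: (@measurability _ _ (hyper R d) (hyper R d) setT (rotset rho)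
  (@hausdorff_open R d)) => // _ [U [Uc oU] <-].
rewrite setTI; apply: hausdorff_open_measurable; split.
  by move=> C /Uc; rewrite rotset_compactsE.
move=> C UC; have [e e0 he] := oU _ UC; exists e => // D cD.
have cC : compacts C by have := Uc _ UC; rewrite rotset_compactsE.
move=> /(hausdorff_dist_lt cC cD)[e' /andP[e'0 e'e] [h1 h2]].
apply: he; first exact: rotset_compacts.
apply: le_lt_trans e'e; apply: hausdorff_dist_le => //.
  move=> _ [x /h1[y Dy xy] <-]; exists (rho *m y); first by exists y.
  by rewrite -mulmxBr orth_enorm//; case: hr.
move=> _ [y /h2[x Cx xy] <-]; exists (rho *m x); first by exists x.
by rewrite -mulmxBr orth_enorm//; case: hr.
Qed.

(** Together with [sph_symmetric] this expresses convexity and symmetry of the cone spanned by K in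
    terms of K alone. Both conditions are closed in the space of compact sets, so [Khat] becomes
    measurable through [KbarE]. *)
Definition sph_convex K := forall x y (s t : R), K x -> K y -> 0 <= s -> 0 <= t ->
  s *: x + t *: y != 0 -> K (normalize (s *: x + t *: y)).

Definition sph_symmetric K := forall x, K x -> K (- x).

Lemma norm_lt_miss K z : closed K -> ~ K z ->
  exists2 e : R, 0 < e & forall y, `|z - y| < e -> ~ K y.
Proof. by move=> /closed_openC cK Kz; exact: (open_norm_ball cK). Qed.

(** A failure of convexity is stable: if a normalized combination of x and y misses the closed set
    K, points of a nearby set D close to x and y have a combination that is still far from K, hence
    not in D. *)
Lemma measurable_sph_convex :
  measurable ([set K | compacts K /\ sph_convex K] : set (hyper R d)).
Proof.
suff oN : hausdorff_open [set K : set (vec R d) | compacts K /\ ~ sph_convex K].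
  rewrite (_ : [set K | _] = (@compacts R d : set (hyper R d)) `\`
     [set K : set (vec R d) | compacts K /\ ~ sph_convex K]).
    by apply: measurableD; [exact: measurable_compacts|exact: hausdorff_open_measurable].
  apply/seteqP; split => K /= [cK h]; split => //; first by case.
  by apply: contrapT => hn; apply: h.
split => [K []//|K /= [cK]].
move=> /existsNP[x] /existsNP[y] /existsNP[s] /existsNP[t].
rewrite !not_implyE => -[Kx [Ky [s0 [t0 [z0 nK]]]]].
have [e e0 he] := norm_lt_miss (compacts_closed cK) nK.
have cn := normalize_continuous z0.
have : \forall w \near (s *: x + t *: y), w != 0 /\ `|normalize (s *: x + t *: y) - normalize w| < e / 2.
  apply: filterI; last by move/cvgrPdist_lt : cn => /(_ (e / 2)); apply; rewrite divr_gt0.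
  have [r r0 hr] : exists2 r : R, 0 < r & forall y0 : vec R d, `|s *: x + t *: y - y0| < r -> y0 != 0.
    exists `|s *: x + t *: y|; first by rewrite normr_gt0.
    by move=> w; apply: contraTneq => ->; rewrite subr0 ltxx.
  apply/nbhs_ballP; exists r => // w; rewrite mx_norm_ball; exact: hr.
move=> /nbhs_ballP[r /= r0 hr].
(* Moving x and y by less than [u] moves s x + t y by less than r; the summand 1 keeps the
   denominator positive. *)
pose u := r / (s + t + 1).
have st0 : 0 < s + t + 1 by lra.
have u0 : 0 < u by rewrite divr_gt0.
exists (Num.min u (e / 2)); first by rewrite lt_min u0 divr_gt0.
move=> D cD; move=> /(hausdorff_dist_lt cK cD)[e' /andP[e'0]].
rewrite lt_min => /andP[e'u e'e] [h1 h2]; split => // convD.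
have [x' Dx' xx'] := h1 x Kx; have [y' Dy' yy'] := h1 y Ky.
have [|w0 wn] := hr (s *: x' + t *: y').
  apply: ball_norm_lt.
  rewrite (_ : _ - _ = s *: (x - x') + t *: (y - y')); last first.
    by rewrite !scalerBr opprD addrACA.
  apply: le_lt_trans (ler_normD _ _) _; rewrite !normrZ !ger0_norm//.
  have nx := le_trans (norm_le_enorm (x - x')) xx'.
  have ny := le_trans (norm_le_enorm (y - y')) yy'.
  apply: (@le_lt_trans _ _ ((s + t) * e')); first by rewrite mulrDl lerD// ler_wpM2l.
  apply: (@le_lt_trans _ _ ((s + t + 1) * e')); first by rewrite ler_wpM2r// lerDl.
  by rewrite -ltr_pdivlMl// mulrC.
have [w Kw hw] := h2 _ (convD _ _ _ _ Dx' Dy' s0 t0 w0).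
apply: (he w) Kw.
rewrite -(subrKA (normalize (s *: x' + t *: y'))).
apply: le_lt_trans (ler_normD _ _) _.
have := le_trans (norm_le_enorm _) hw; rewrite distrC => h.
by rewrite (splitr e) ltr_leD// (le_trans h)// ltW.
Qed.

Lemma measurable_sph_symmetric :
  measurable ([set K | compacts K /\ sph_symmetric K] : set (hyper R d)).
Proof.
suff oN : hausdorff_open [set K : set (vec R d) | compacts K /\ ~ sph_symmetric K].
  rewrite (_ : [set K | _] = (@compacts R d : set (hyper R d)) `\`
     [set K : set (vec R d) | compacts K /\ ~ sph_symmetric K]).
    by apply: measurableD; [exact: measurable_compacts|exact: hausdorff_open_measurable].
  apply/seteqP; split => K /= [cK h]; split => //; first by case.
  by apply: contrapT => hn; apply: h.
split => [K []//|K /= [cK]].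
move=> /existsNP[x]; rewrite not_implyE => -[Kx nK].
have [e e0 he] := norm_lt_miss (compacts_closed cK) nK.
exists (e / 2); first by rewrite divr_gt0.
move=> D cD; move=> /(hausdorff_dist_lt cK cD)[e' /andP[e'0 e'e] [h1 h2]]; split => // sD.
have [x' Dx' xx'] := h1 x Kx; have [w Kw hw] := h2 _ (sD _ Dx').
apply: (he w) Kw.
rewrite -(subrKA (- x')).
apply: le_lt_trans (ler_normD _ _) _.
rewrite (_ : `|- x - - x'| = `|x - x'|); last by rewrite -opprD normrN.
have h3 := le_trans (norm_le_enorm _) hw.
have h4 := le_trans (norm_le_enorm _) xx'.
rewrite (_ : `|- x' - w| = `|w - - x'|).
  by rewrite (splitr e) ltrD//; apply: le_lt_trans e'e.
by rewrite -normrN opprB.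
Qed.

(** x + y is twice the midpoint. *)
Lemma convex_cone_add (C : set (vec R d)) x y :
  closed_convex_cone C -> C x -> C y -> C (x + y).
Proof.
move=> [_ _ convC coneC] Cx Cy.
have h0 : (0 : R) <= 2^-1 by [].
have h1 : (2^-1 : R) <= 1 by rewrite invf_le1// ler1n.
have := convC x y (Itv01 h0 h1) (mem_set Cx) (mem_set Cy).
move=> /set_mem; rewrite /conv /= => h.
have := coneC 2 _ (ler0n _ 2) h.
by rewrite /unstable.onem (_ : 1 - 2^-1 = 2^-1 :> R) ?scalerDr ?scalerA ?divff ?scale1r//; field.
Qed.

(** K determines its cone, which consists of 0 and the vectors whose direction lies in K, and a
    closed convex cone is a linear subspace exactly when it is symmetric. The cone {0} is a linear
    subspace, so K is non-empty. *)
Lemma KbarE (K : hyper R d) :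
  Kbar K <-> [/\ compacts K, sph_convex K & ~ sph_symmetric K].
Proof.
split.
  move=> [C [CC nC ->]]; have [[c0 Cc0] clC convC coneC] := CC.
  have C0 : C 0 by rewrite -(scale0r c0); exact: coneC.
  have Cn x : C x -> C (normalize x) by apply: coneC; rewrite invr_ge0 enorm_ge0.
  split.
  - split; first by move=> x [].
      by apply: closed_sphere_compact; [move=> x []|apply: closedI => //; exact: closed_sphere].
    apply: contrapT => h; apply: nC; have Cz x : C x -> x = 0.
      move=> Cx; apply/eqP; apply/negPn/negP => x0; apply: h; exists (normalize x).
      by split; [exact: sphere_normalize|exact: Cn].
    by split => // a x y /Cz -> /Cz ->; rewrite scaler0 addr0.
  - move=> x y s t [hx Cx] [hy Cy] s0 t0 z0; split; first exact: sphere_normalize.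
    by apply: Cn; apply: convex_cone_add => //; exact: coneC.
  - move=> sK; apply: nC; split => // a x y Cx Cy.
    have CN z : C z -> C (- z).
      move=> Cz; have [->|z0] := eqVneq z 0; first by rewrite oppr0.
      have [_ h] := sK (normalize z) (conj (sphere_normalize z0) (Cn _ Cz)).
      have := coneC (enorm z) _ (enorm_ge0 z) h.
      by rewrite scalerN /normalize scalerA divff ?scale1r// enorm_eq0.
    apply: convex_cone_add => //.
    have [a0|/ltW a0] := leP 0 a; first exact: coneC.
    by rewrite -(opprK a) scaleNr; apply: CN; apply: coneC; rewrite ?oppr_ge0.
move=> [cK convK nsK]; have [KS _ [x0 Kx0]] := cK.
pose C := [set x : vec R d | x = 0 \/ K (normalize x)].
have Cge0 (a : R) x : 0 <= a -> C x -> C (a *: x).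
  rewrite le_eqVlt => /orP[/eqP <- _|a0 [->|Kx]]; first by left; rewrite scale0r.
    by left; rewrite scaler0.
  by right; rewrite normalizeZ.
have Cadd x y : C x -> C y -> C (x + y).
  move=> [->|Kx]; first by rewrite add0r.
  move=> [->|Ky]; first by rewrite addr0; right.
  have [->|xy0] := eqVneq (x + y) 0; first by left.
  have xE z : K (normalize z) -> z = enorm z *: normalize z.
    move=> /KS /sphere_neq0; rewrite /normalize scalerA => h.
    rewrite divff ?scale1r//; apply: contraNneq h => ->.
    by rewrite invr0 scale0r.
  right; rewrite (xE x)// (xE y)//; apply: convK; rewrite ?enorm_ge0//.
  by rewrite -xE// -xE.
have SC : sphere R d `&` C = K.
  apply/seteqP; split => x /=.
    by move=> [hx [x0'|]]; [have := sphere_neq0 hx; rewrite x0' eqxx|rewrite normalize_sphere].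
  by move=> Kx; split; [exact: KS|right; rewrite normalize_sphere//; exact: KS].
exists C; split => //.
- split => //; first by exists 0; left.
  (* The origin belongs to C, so closedness matters only at non-zero points, where [normalize] is
     continuous. *)
  + rewrite -(setCK C); apply: open_closedC; rewrite openE => x /= /not_orP[/eqP x0' nK].
    have clK := closed_openC (compacts_closed cK).
    have h1 : \forall y \near x, y != 0.
      have : open (~` [set (0 : vec R d)]).
        by apply: closed_openC; apply: accessible_closed_set1; apply: hausdorff_accessible; exact: norm_hausdorff.
      by rewrite openE => /(_ x (elimN eqP x0'))/=; apply: filterS => y /= /eqP.
    have h2 : \forall y \near x, ~ K (normalize y).
      have : nbhs (normalize x) (~` K) by apply: open_nbhs_nbhs.
      exact: (normalize_continuous x0').
    by apply: filterS2 h1 h2 => y /eqP y0 nKy [].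
  + move=> x y l /set_mem Cx /set_mem Cy; apply/mem_set; rewrite /conv /=.
    by apply: Cadd; apply: Cge0 => //; rewrite /unstable.onem subr_ge0.
- move=> [_ lC]; apply: nsK => x Kx.
  have hx := KS _ Kx.
  have Cx : C x by right; rewrite normalize_sphere.
  have := lC (-1) x 0 Cx (or_introl erefl); rewrite addr0 scaleN1r => CNx.
  by rewrite -SC; split => //; exact: sphereN.
Qed.

Lemma Kbar_compacts (K : hyper R d) : Kbar K -> compacts K.
Proof. by move=> /KbarE[]. Qed.

Lemma Khat_compacts (K : hyper R d) : Khat K -> compacts K.
Proof. by move=> [/Kbar_compacts//|->]; exact: compacts_sphere. Qed.

Lemma measurable_Khat : measurable (@Khat R d).
Proof.
apply: measurableU; last by apply: measurable_compact1; exact: compacts_sphere.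
rewrite (_ : @Kbar R d = [set K | compacts K /\ sph_convex K] `\`
   [set K | compacts K /\ sph_symmetric K]).
  by apply: measurableD; [exact: measurable_sph_convex|exact: measurable_sph_symmetric].
apply/seteqP; split => K.
  by move=> /KbarE[cK h1 h2]; split => // -[].
by move=> [[cK h1] h2]; apply/KbarE; split => // h; apply: h2.
Qed.

Lemma rotset_Khat rho (K : hyper R d) : SO R d rho -> Khat K -> Khat (rotset rho K).
Proof.
move=> hr [/KbarE[cK convK nsK]|->]; last by right; rewrite /= rotset_sphere.
left; apply/KbarE; split.
- exact: rotset_compacts.
- move=> _ _ s t [x Kx <-] [y Ky <-] s0 t0; rewrite !scalemxAr -mulmxDr => z0.
  rewrite normalize_orth; last by case: hr.
  exists (normalize (s *: x + t *: y)) => //; apply: convK => //.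
  by apply: contraNneq z0 => ->; rewrite mulmx0.
- move=> sK; apply: nsK => x Kx.
  have [y Ky e] : rotset rho K (- (rho *m x)) by apply: sK; exists x.
  by rewrite -(SO_mulK (- x) hr) mulmxN -e SO_mulK.
Qed.

Lemma rotset_KhatE rho (K : hyper R d) : SO R d rho -> Khat (rotset rho K) <-> Khat K.
Proof.
move=> hr; split; last exact: rotset_Khat.
by move=> /(rotset_Khat (SO_tr hr)); rewrite rotsetK.
Qed.

Lemma polytope_Kbar (K : hyper R d) : spherical_polytope K -> Kbar K.
Proof.
move=> [C [[us CE] nC KE]]; exists C; split => //; rewrite CE; split.
- by exists 0 => u _; rewrite dot0r.
- rewrite (_ : [set x | _] = \bigcap_(u in [set` us]) (dot u @^-1` [set r | r <= 0])); last first.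
    by apply/seteqP; split.
  apply: closed_bigI => u _; apply: closed_comp; last exact: closed_le.
  by move=> x _; exact: dot_continuous.
- move=> x y l /set_mem /= hx /set_mem /= hy; apply/mem_set => u uus /=.
  rewrite /conv /= dotDr !dotZr.
  by rewrite -[leRHS]addr0 /unstable.onem lerD// mulr_ge0_le0 ?hx ?hy ?subr_ge0.
- by move=> a x a0 hx u uus; rewrite dotZr mulr_ge0_le0// hx.
Qed.

End hyperspace_measurability.

(** * Intensity measures *)

Section intensity.
Context {R : realType} {dO dT : measure_display}.
Context {Omega : measurableType dO} {T : measurableType dT}.
Context (P : probability Omega R) (X : R.-ker Omega ~> T).
Local Open Scope ereal_scope.

Let intensity0 : intensity_measure P X set0 = 0.
Proof. by rewrite /intensity_measure integral0_eq// => w _; rewrite measure0. Qed.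

Let intensity_ge0 A : 0 <= intensity_measure P X A.
Proof. exact: integral_ge0. Qed.

Let intensity_sigma_additive : semi_sigma_additive (intensity_measure P X).
Proof.
move=> F mF tF mUF.
rewrite [X in _ --> X](_ : _ = \sum_(n <oo) intensity_measure P X (F n)).
  by apply/cvg_closeP; split; [exact: is_cvg_nneseries|rewrite closeE].
rewrite -integral_nneseries//; last by move=> n; exact: measurable_kernel.
apply: eq_integral => w _; apply/esym/cvg_lim => //=.
exact: measure_semi_sigma_additive.
Qed.

HB.instance Definition _ := isMeasure.Build _ _ _ (intensity_measure P X)
  intensity0 intensity_ge0 intensity_sigma_additive.

Import HBNNSimple.

Let integral_intensity_nnsfun (f : {nnsfun T >-> R}) :
  \int[P]_w \int[X w]_y (f y)%:E = \int[intensity_measure P X]_y (f y)%:E.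
Proof.
under [in RHS]eq_integral do rewrite fimfunE -fsumEFin//.
rewrite ge0_integral_fsum//; last 2 first.
  - by move=> r; exact/measurable_EFinP/measurableT_comp.
  - by move=> r z _; rewrite EFinM nnfun_muleindic_ge0.
under [in LHS]eq_integral.
  move=> w _.
  under eq_integral.
    by move=> z _; rewrite fimfunE -fsumEFin//; over.
  rewrite /= ge0_integral_fsum//; last 2 first.
    - by move=> r; exact/measurable_EFinP/measurableT_comp.
    - by move=> r z _; rewrite EFinM nnfun_muleindic_ge0.
  under eq_fsbigr.
    move=> r _.
    rewrite (integralZl_indic _ (fun r => f @^-1` [set r]))//; last first.
      by move=> r0; rewrite preimage_nnfun0.
    rewrite integral_indic// setIT.
    over.
  over.
rewrite /= ge0_integral_fsum//; last 2 first.
  - by move=> r; apply: measurable_funeM; exact: measurable_kernel.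
  - move=> n y _.
    have := mulemu_ge0 (fun n => f @^-1` [set n]).
    by apply; exact: preimage_nnfun0.
apply: eq_fsbigr => r _.
rewrite (integralZl_indic _ (fun r => f @^-1` [set r]))//; last first.
  exact: preimage_nnfun0.
rewrite /= integral_indic// setIT.
have [r0|r0] := leP 0%R r.
  by rewrite ge0_integralZl//; exact: measurable_kernel.
rewrite integral0_eq ?mule0.
  by rewrite preimage_nnfun0// measure0 mule0.
by move=> y _; rewrite preimage_nnfun0// measure0 mule0.
Qed.

(** Campbell's formula: by linearity for simple functions, then by monotone convergence on both
    sides. *)
Lemma integral_intensity (f : T -> \bar R) :
  (forall y, 0 <= f y) -> measurable_fun [set: T] f ->
  \int[P]_w \int[X w]_y f y = \int[intensity_measure P X]_y f y.
Proof.
move=> f0 mf; pose f_ := nnsfun_approx measurableT mf.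
have fE y : f y = limn (fun n => (f_ n y)%:E).
  by apply/esym/cvg_lim => //=; exact: cvg_nnsfun_approx.
have nd_f y : nondecreasing_seq (fun n => (f_ n y)%:E).
  by move=> a b ab; rewrite lee_fin; exact/lefP/nd_nnsfun_approx.
have mf_ n : measurable_fun [set: T] (fun y => (f_ n y)%:E) by exact/measurable_EFinP.
transitivity (limn (fun n => \int[intensity_measure P X]_y (f_ n y)%:E)); last first.
  rewrite -monotone_convergence//; last by move=> n y _; rewrite lee_fin.
  by apply: eq_integral => y _; rewrite fE.
rewrite [in RHS](_ : (fun n => _) = (fun n => \int[P]_w \int[X w]_y (f_ n y)%:E)); last first.
  by apply/funext => n; rewrite integral_intensity_nnsfun.
rewrite -monotone_convergence//.
- apply: eq_integral => w _; rewrite -monotone_convergence//.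
    by apply: eq_integral => y _; rewrite fE.
  by move=> n y _; rewrite lee_fin.
- move=> n; apply: measurable_fun_integral_kernel => //.
    by move=> U mU; exact: measurable_kernel.
  by move=> y; rewrite lee_fin.
- by move=> n w _; apply: integral_ge0 => y _; rewrite lee_fin.
- move=> w _ a b ab; apply: ge0_le_integral => //.
    by move=> y _; rewrite lee_fin.
  by move=> y _; exact: nd_f.
Qed.

Lemma measurable_integral_kernel (f : T -> \bar R) :
  (forall y, 0 <= f y) -> measurable_fun [set: T] f ->
  measurable_fun [set: Omega] (fun w => \int[X w]_y f y).
Proof.
move=> f0 mf; apply: measurable_fun_integral_kernel => //.
by move=> U mU; exact: measurable_kernel.
Qed.

End intensity.

(** * Integrals of functions not known to be measurable, and against counting measures *)

Section integral_lemmas.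
Local Open Scope ereal_scope.

(** The integral of a non-negative function is a supremum over the simple functions below it, so it
    is monotone for arbitrary functions. *)
Lemma ge0_le_integral_nomeas d (T : measurableType d) (R : realType)
    (mu : {measure set T -> \bar R}) (f g : T -> \bar R) :
  (forall x, 0 <= f x) -> (forall x, f x <= g x) ->
  \int[mu]_x f x <= \int[mu]_x g x.
Proof.
move=> f0 fg; have g0 x : 0 <= g x by exact: le_trans (fg x).
rewrite !ge0_integralTE//; apply: le_ereal_sup => _ [h hf <-].
by exists h => // x; exact: le_trans (hf x) (fg x).
Qed.

(** The upper bound replaces f by g plus +oo on N, the lower bound restricts g to the complement of
    N. It serves for integrands such as [f (crofton_cell p (X' w))], whose measurability in w is
    left open. *)
Lemma ge0_ae_eq_integral_nomeas d (T : measurableType d) (R : realType)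
    (mu : {measure set T -> \bar R}) (N : set T) (f g : T -> \bar R) :
  measurable N -> mu N = 0 -> measurable_fun [set: T] g ->
  (forall x, 0 <= f x) -> (forall x, 0 <= g x) ->
  (forall x, ~ N x -> f x = g x) -> \int[mu]_x f x = \int[mu]_x g x.
Proof.
move=> mN N0 mg f0 g0 fg; apply/eqP; rewrite eq_le; apply/andP; split.
  pose h := (cst +oo \_ N) : T -> \bar R.
  have mh : measurable_fun [set: T] h.
    by apply/(measurable_restrictT _ _).1 => //; exact: measurable_cst.
  have h0 x : 0 <= h x by rewrite /h patchE; case: ifP => //= _; exact: leey.
  apply: (@le_trans _ _ (\int[mu]_x (g x + h x))).
    apply: ge0_le_integral_nomeas => // x; have [Nx|Nx] := pselect (N x).
      by rewrite /h patchE mem_set//= addey ?leey// -ltNye (lt_le_trans _ (g0 x)).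
    by rewrite fg// leeDl.
  rewrite ge0_integralD// /h -integral_mkcond integral_cst// N0 mule0 adde0.
  exact: lexx.
rewrite (ge0_negligible_integral mN)// setTD integral_mkcond.
apply: ge0_le_integral_nomeas => x; first by rewrite erestrict_ge0.
rewrite patchE; case: ifPn => // /set_mem /= Nx; by rewrite fg.
Qed.

Lemma counting_integral d (T : measurableType d) (R : realType)
    (m : {measure set T -> \bar R}) (s : seq T) (f : T -> \bar R) :
  is_counting s m -> (forall y, 0 <= f y) -> measurable_fun [set: T] f ->
  \int[m]_y f y = \sum_(y <- s) f y.
Proof.
move=> ms f0 mf.
have [x0|s0] : (exists x0 : T, True) \/ s = [::].
  by case: s ms => [|x s] _; [right|left; exists x].
  move: x0 => [x0 _].
  pose m' k : {measure set T -> \bar R} := \d_(nth x0 s k).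
  transitivity (\int[msum m' (size s)]_y f y).
    apply: eq_measure_integral => A mA _.
    by rewrite [LHS]ms// /msum (big_nth x0) big_mkord.
  rewrite ge0_integral_measure_sum// (big_nth x0) big_mkord.
  by apply: eq_bigr => k _; rewrite integral_dirac// diracT mul1e.
rewrite s0 big_nil -[RHS](integral_measure_zero setT f).
by apply: eq_measure_integral => A mA _; rewrite [LHS]ms// s0 big_nil.
Qed.

Lemma sum_dirac_count (R : realType) d (T : measurableType d) (s : seq T) (B : set T) :
  \sum_(x <- s) \d_x B = ((count (fun x => x \in B) s)%:R)%:E :> \bar R.
Proof.
elim: s => [|x s IH]; first by rewrite big_nil.
by rewrite big_cons IH /= diracE natrD EFinD.
Qed.

(** Both sides are the integral of y over [0, +oo] against the common image measure. *)
Lemma law_eq_integral d (T : measurableType d) (R : realType)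
    (P : {measure set T -> \bar R}) (U V : T -> \bar R) :
  measurable_fun setT U -> measurable_fun setT V ->
  (forall x, 0 <= U x) -> (forall x, 0 <= V x) ->
  (forall Y, measurable Y -> P (U @^-1` Y) = P (V @^-1` Y)) ->
  \int[P]_x U x = \int[P]_x V x.
Proof.
move=> mU mV U0 V0 UV.
have E (W : T -> \bar R) : measurable_fun setT W -> (forall x, 0 <= W x) ->
    \int[P]_x W x = \int[pushforward P W]_(y in `[0, +oo]) y.
  move=> mW W0; have mI : measurable (`[0, +oo] : set (\bar R)) by exact: emeasurable_itv.
  rewrite [RHS]ge0_integral_pushforward//; last first.
    by move=> y; rewrite inE /= in_itv /= => /andP[].
  by rewrite (_ : W @^-1` _ = setT)//; apply/seteqP; split => x //= _; rewrite in_itv /= W0 leey.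
rewrite (E U)// (E V)//; apply: eq_measure_integral => Y mY _ /=.
exact: UV.
Qed.

End integral_lemmas.

(** * Crofton cell *)

Section tessellation_cells.
Context {R : realType} {d : nat}.
Implicit Types (x y z : vec R d) (K L : hyper R d) (s : seq (hyper R d)).

Lemma tessellation_uniq s : tessellation s -> uniq s.
Proof. by case=> [->|[]]. Qed.

Lemma tessellation_Khat s K : tessellation s -> K \in s -> Khat K.
Proof.
move=> [->|[_ h _ _]]; first by rewrite mem_seq1 => /eqP ->; right.
by move=> /h[/polytope_Kbar ? _]; left.
Qed.

Lemma tessellation_cover s x : tessellation s -> sphere R d x ->
  exists2 K : hyper R d, K \in s & (K : set (vec R d)) x.
Proof.
move=> [-> hx|[_ _ h _]]; first by exists (sphere R d : hyper R d); rewrite ?inE.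
exact: h.
Qed.

Lemma sph_interior_sub (K : set (vec R d)) : sph_interior K `<=` K.
Proof. by move=> x [hx /nbhs_singleton]; apply. Qed.

(** Where all inequalities with non-zero normal are strict, they stay strict nearby, so the point is
    interior; inequalities with normal 0 hold everywhere and are dropped. *)
Lemma polytope_boundary K : spherical_polytope K -> exists us : seq (vec R d),
  (forall u, u \in us -> u != 0) /\
  forall x, (K : set (vec R d)) x -> ~ sph_interior K x ->
    exists2 u, u \in us & dot u x = 0.
Proof.
move=> [C [[us CE] _ KE]]; exists [seq u <- us | u != 0]; split.
  by move=> u; rewrite mem_filter => /andP[].
move=> x; rewrite KE CE => -[hx Cx] nint; apply: contrapT => h; apply: nint.
split => //.
suff : \forall y \near x, forall u, u \in us -> dot u y <= 0.
  by apply: filterS => y hy ys; split.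
have : forall u, u \in us -> \forall y \near x, dot u y <= 0.
  move=> u uus; have [->|u0] := eqVneq u 0; first by apply: nbhs_true => y; rewrite dot0l.
  have : dot u x < 0.
    rewrite lt_neqAle Cx// andbT; apply/eqP => ux; apply: h.
    by exists u; rewrite // mem_filter u0.
  move=> ux; have : \forall y \near x, dot u y < 0.
    exact: (dot_continuous (x := u) (lt_nbhsl ux)).
  by apply: filterS => y /ltW.
exact: near_seq.
Qed.

(** A common point of two cells is not interior to both, so it lies on a bounding hyperplane of one
    of them. There are finitely many of these, with non-zero normals, so the overlaps are null for
    the surface measure. *)
Lemma tessellation_overlap s : tessellation s -> exists us : seq (vec R d),
  (forall u, u \in us -> u != 0) /\
  forall K L x, K \in s -> L \in s -> K <> L ->
    (K : set (vec R d)) x -> (L : set (vec R d)) x -> exists2 u, u \in us & dot u x = 0.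
Proof.
move=> [->|[_ hs _ disj]].
  by exists [::]; split => // K L x; rewrite !mem_seq1 => /eqP -> /eqP ->.
have [us [us0 h]] : exists us : seq (vec R d),
  (forall u, u \in us -> u != 0) /\
  forall K x, K \in s -> (K : set (vec R d)) x -> ~ sph_interior K x ->
    exists2 u, u \in us & dot u x = 0.
  have : forall K, K \in s -> spherical_polytope K by move=> K /hs[].
  elim: s {hs disj} => [|K s IH] hs; first by exists [::].
  have [us1 [us10 h1]] := polytope_boundary (hs K (mem_head _ _)).
  have [us2 [us20 h2]] := IH (fun L Ls => hs L (@mem_behead _ (K :: s) _ Ls)).
  exists (us1 ++ us2); split; first by move=> u; rewrite mem_cat => /orP[/us10|/us20].
  move=> L x; rewrite inE => /predU1P[->|Ls] Lx nint.
    by have [u uus ux] := h1 x Lx nint; exists u; rewrite // mem_cat uus.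
  by have [u uus ux] := h2 L x Ls Lx nint; exists u; rewrite // mem_cat uus orbT.
exists us; split => // K L x Ks Ls KL Kx Lx.
have [iK|iK] := pselect (sph_interior K x); last exact: h iK.
have [iL|iL] := pselect (sph_interior L x); last exact: h iL.
have := disj K L Ks Ls KL; rewrite -subset0 => /(_ x (conj iK iL)).
by [].
Qed.

Lemma count1_unique (T : eqType) (a : pred T) (r : seq T) (v w : T) :
  uniq r -> count a r = 1%N -> v \in r -> w \in r -> a v -> a w -> v = w.
Proof.
move=> ur c1 vr wr av aw; apply/eqP/negPn/negP => vw.
suff : (2 <= count a r)%N by rewrite c1.
rewrite -size_filter; apply: (@uniq_leq_size _ [:: v; w]).
  by rewrite /= inE vw.
by move=> z; rewrite !inE => /orP[]/eqP ->; rewrite mem_filter ?av ?aw.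
Qed.

(* The other cells are finitely many closed sets missing [x]. *)
Lemma single_cell_interior s K x : tessellation s -> sphere R d x ->
  K \in s -> (K : set (vec R d)) x ->
  (forall L, L \in s -> (L : set (vec R d)) x -> L = K) -> sph_interior K x.
Proof.
move=> ts hx Ks Kx h; split => //.
have : \forall y \near x, forall L, L \in s -> L <> K -> ~ (L : set (vec R d)) y.
  have : forall L, L \in s -> L <> K -> \forall y \near x, ~ (L : set (vec R d)) y.
    move=> L Ls LK; have cL := compacts_closed (Khat_compacts (tessellation_Khat ts Ls)).
    by apply: open_nbhs_nbhs; split; [exact: closed_openC|move=> Lx; apply: LK; exact: h].
  move=> hs; apply: (near_seq (A := fun L y => L <> K -> ~ (L : set (vec R d)) y)) => L Ls.
  have [->|LK] := pselect (L = K); first exact: nbhs_true.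
  by apply: filterS (hs L Ls LK).
apply: filterS => y hy ys; have [L Ls Ly] := tessellation_cover ts ys.
have [<-//|LK] := pselect (L = K).
by exfalso; apply: hy Ly.
Qed.

Lemma counting_mem s (m : set (hyper R d) -> \bar R) : is_counting s m ->
  (forall K, K \in s -> Khat K) -> forall K, Khat K -> (m [set K] != 0%E) = (K \in s).
Proof.
move=> ms sK K hK; rewrite ms; last by apply: measurable_compact1; exact: Khat_compacts.
rewrite sum_dirac_count -has_pred1 has_count.
rewrite (eq_count (a2 := pred1 K)); last by move=> L; apply/idP/eqP => [/set_mem//|->]; exact: mem_set.
by rewrite eqe pnatr_eq0 -lt0n.
Qed.

Lemma counting_cells s (m : set (hyper R d) -> \bar R) :
  is_counting s m -> tessellation s -> cells m = [set` s].
Proof.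
move=> ms ts; apply/seteqP; split => K /=.
  by move=> [hK]; rewrite (counting_mem ms)// => L; exact: tessellation_Khat.
move=> Ks; have hK := tessellation_Khat ts Ks; split => //.
by rewrite (counting_mem ms)// => L; exact: tessellation_Khat.
Qed.

Lemma crofton_cell_single s (m : set (hyper R d) -> \bar R) K x :
  is_counting s m -> tessellation s -> sphere R d x ->
  K \in s -> (K : set (vec R d)) x ->
  (forall L, L \in s -> (L : set (vec R d)) x -> L = K) -> crofton_cell x m = K.
Proof.
move=> ms ts hx Ks Kx h; rewrite /crofton_cell (counting_cells ms ts).
apply: xget_unique => [|L [/= Ls iL]].
  by split => //; exact: (single_cell_interior ts).
by apply: h => //; exact: sph_interior_sub.
Qed.

Lemma counting_setT s (m : set (hyper R d) -> \bar R) A : is_counting s m ->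
  measurable A -> (forall K, K \in s -> A K) -> m A = ((size s)%:R)%:E.
Proof.
move=> ms mA sA; rewrite ms// sum_dirac_count; congr (_%:R%:E).
by apply/eqP; rewrite -all_count; apply/allP => K /sA; rewrite inE.
Qed.

End tessellation_cells.

Section random_tessellation_intensity.
Context {R : realType} {d : nat} {dO : measure_display}.
Context {Omega : measurableType dO} (P : probability Omega R).
Context (X' : R.-ker Omega ~> hyper R d).
Notation M := (intensity_measure P X').

Lemma gammaE : random_tessellation X' -> gamma P X' = M setT.
Proof.
move=> hX; apply: eq_integral => w _; have [s ts ms] := hX w.
transitivity (((size s)%:R)%:E : \bar R); last exact/esym/(counting_setT ms).
apply: (counting_setT ms); first exact: measurable_compacts.
by move=> K Ks; exact: Khat_compacts (tessellation_Khat ts Ks).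
Qed.

Lemma intensity_Khat (A : set (hyper R d)) : random_tessellation X' -> measurable A -> M (A `&` @Khat R d) = M A.
Proof.
move=> hX mA; apply: eq_integral => w _; have [s ts ms] := hX w.
rewrite !ms//; last by apply: measurableI => //; exact: measurable_Khat.
apply: eq_big_seq => K /(tessellation_Khat ts) hK.
by rewrite !diracE in_setI (mem_set hK) andbT.
Qed.

(** Isotropy is applied to the events [Y (m A)]: the numbers of cells in A and in its preimage have
    the same distribution, hence the same mean. *)
Lemma intensity_rotset rho (A : set (hyper R d)) : isotropic P X' -> SO R d rho -> measurable A ->
  M (rotset rho @^-1` A) = M A.
Proof.
move=> iso hr mA.
have mrA : measurable (rotset rho @^-1` A : set (hyper R d)).
  by rewrite -[X in measurable X]setTI; exact: measurable_rotset.
apply: law_eq_integral => //; try exact: measurable_kernel.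
move=> Y mY.
have cE : counting_events [set m : set (hyper R d) -> \bar R | Y (m A)].
  by apply: sub_sigma_algebra; exists A => //; exists Y.
exact: (iso rho hr _ cE).
Qed.

Lemma integral_rotset rho (f : hyper R d -> \bar R) : isotropic P X' -> SO R d rho ->
  measurable_fun setT f -> (forall K, 0 <= f K)%E ->
  (\int[M]_K f (rotset rho K) = \int[M]_K f K)%E.
Proof.
move=> iso hr mf f0.
rewrite -[LHS]/(\int[M]_(K in rotset rho @^-1` setT) (f \o rotset rho) K)%E.
rewrite -(ge0_integral_pushforward (measurable_rotset hr))//.
apply: eq_measure_integral => [|? A mA _]; first exact: measurable_rotset.
exact: (intensity_rotset iso hr mA).
Qed.

End random_tessellation_intensity.

Section crofton.
Context {R : realType} {d : nat} {dO : measure_display}.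
Context {Omega : measurableType dO} (P : probability Omega R).
Context (X' : R.-ker Omega ~> hyper R d) (hX : random_tessellation X').
Context (iso : isotropic P X') (goo : (gamma P X' < +oo)%E) (d0 : (0 < d)%N).
Context (lambda : probability (borelM R d.+1 d.+1) R)
  (hlambda : haar_probability (SO R d) lambda).
Context (p : vec R d) (hp : sphere R d p).
Notation M := (intensity_measure P X').

Lemma measurable_Khat_set (K : hyper R d) : Khat K -> measurable (K : set (borel_vec R d)).
Proof. by move=> /Khat_compacts/compacts_closed/closed_borelM. Qed.

Let sigmaE K : Khat K ->
  sigma_sph (K : set (vec R d)) = lambda [set rho | SO R d rho /\ (K : set (vec R d)) (rho^T *m p)].
Proof. by move=> hK; apply: sigma_sph_haar => //; exact: measurable_Khat_set. Qed.

(** The indicator of x in K, cut off at compact K so as to be jointly measurable by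
    [measurable_mem_graph]; on [Khat] the cut-off is invisible. *)
Definition indic_cell (x : vec R d) (K : hyper R d) : \bar R :=
  (\1_[set z : borel_vec R d * hyper R d | compacts z.2 /\ (z.2 : set (vec R d)) z.1] (x, K))%:E.

Lemma indic_cell_ge0 x K : (0 <= indic_cell x K)%E.
Proof. by rewrite lee_fin. Qed.
Local Hint Resolve indic_cell_ge0 : core.

Lemma indic_cellE x K : Khat K -> indic_cell x K = ((x \in (K : set (vec R d)))%:R)%:E.
Proof.
move=> hK; rewrite /indic_cell indicE; congr (_%:R%:E); congr (nat_of_bool _).
apply/idP/idP => /set_mem h; apply/mem_set; first by case: h.
by split => //; exact: Khat_compacts.
Qed.

Lemma indic_cell_measurable :
  measurable_fun [set: borel_vec R d * hyper R d] (fun z => indic_cell z.1 z.2).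
Proof.
rewrite (_ : (fun z => _) = (fun z => (\1_[set z : borel_vec R d * hyper R d | compacts z.2 /\ (z.2 : set (vec R d)) z.1] z)%:E)).
  by apply/measurable_EFinP/measurable_indic; exact: measurable_mem_graph.
by apply/funext => -[].
Qed.

Section weight.
Context (f : hyper R d -> \bar R) (mf : measurable_fun setT f)
  (f0 : forall K, (0 <= f K)%E)
  (frot : forall rho K, SO R d rho -> f (rotset rho K) = f K)
  (fK : forall K, ~ Khat K -> f K = 0%E).

Let mfi : measurable_fun [set: borelM R d.+1 d.+1 * hyper R d]
  (fun z => (\1_(SO R d) z.1)%:E * (f z.2 * indic_cell ((z.1 : 'M[R]_d.+1)^T *m p) z.2))%E.
Proof.
apply: emeasurable_funM.
  apply: (measurableT_comp (f := fun rho : borelM R d.+1 d.+1 => (\1_(SO R d) rho)%:E)).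
    by apply/measurable_EFinP/measurable_indic; exact: measurable_SO.
  exact: measurable_fst.
apply: emeasurable_funM; first exact: measurableT_comp.
apply: (measurableT_comp (f := fun z : borel_vec R d * hyper R d => indic_cell z.1 z.2)
   (g := fun z : borelM R d.+1 d.+1 * hyper R d => ((z.1 : 'M[R]_d.+1)^T *m p : borel_vec R d, z.2))).
  exact: indic_cell_measurable.
apply: measurable_fun_pair; last exact: measurable_snd.
apply: measurable_mulmx => //.
by apply: measurable_trmx; exact: measurable_fst.
Qed.

Let inner K : (\int[lambda]_rho ((\1_(SO R d) rho)%:E * (f K * indic_cell ((rho : 'M[R]_d.+1)^T *m p) K)) =
  f K * sigma_sph (K : set (vec R d)))%E.
Proof.
have [hK|hK] := pselect (Khat K); last first.
  by rewrite (fK hK) mul0e integral0_eq// => rho _; rewrite mul0e mule0.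
have cK := Khat_compacts hK.
have mE : measurable ([set rho | SO R d rho /\ (K : set (vec R d)) (rho^T *m p)] : set (borelM R d.+1 d.+1)).
  apply: measurableI; first exact: measurable_SO.
  rewrite -[X in measurable X]setTI.
  apply: (measurable_mulmx (f := fun rho : borelM R d.+1 d.+1 => (rho : 'M[R]_d.+1)^T : borelM R d.+1 d.+1)
    (g := fun _ => p)) => //; last exact: measurable_Khat_set.
  exact: (measurable_trmx (f := id)).
transitivity (\int[lambda]_rho (f K * (\1_[set rho | SO R d rho /\ (K : set (vec R d)) (rho^T *m p)] rho)%:E))%E.
  apply: eq_integral => rho _; rewrite muleCA; congr (_ * _)%E.
  rewrite /indic_cell -EFinM; congr EFin; rewrite !indicE.
  rewrite -natrM mulnb; congr (_%:R); congr (nat_of_bool _).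
  apply/andP/idP; first by move=> [/set_mem h1 /set_mem [_ h2]]; exact/mem_set.
  by move=> /set_mem [h1 h2]; split; exact/mem_set.
rewrite ge0_integralZl//; last by apply/measurable_EFinP/measurable_indic.
by rewrite integral_indic// setIT sigmaE.
Qed.

(** By [inner] the product with the area is an average over rotations of a jointly measurable
    function, so Tonelli's theorem yields measurability. *)
Lemma measurable_weight_sigma :
  measurable_fun setT (fun K : hyper R d => f K * sigma_sph (K : set (vec R d)))%E.
Proof.
have [nu nuE] := @sigma_finite_pack _ _ R lambda (sigma_finiteT lambda).
rewrite (_ : (fun K => _) = fun K => (\int[nu]_rho
    ((\1_(SO R d) rho)%:E * (f K * indic_cell ((rho : 'M[R]_d.+1)^T *m p) K)))%E).
  by apply: (measurable_fun_fubini_tonelli_G (m1 := nu) _ mfi) => z; rewrite !mule_ge0// lee_fin.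
apply/funext => K; rewrite -inner; apply: eq_measure_integral => A mA _.
by rewrite -nuE.
Qed.

Lemma weight_sigma_ge0 K : (0 <= f K * sigma_sph (K : set (vec R d)))%E.
Proof. by rewrite -inner; apply: integral_ge0 => rho _; rewrite !mule_ge0// lee_fin. Qed.

Lemma crofton_weight :
  (\int[M]_K (f K * indic_cell p K) = \int[M]_K (f K * sigma_sph (K : set (vec R d))))%E.
Proof.
(* Finite intensity makes [M] a finite measure, which provides the sigma-finiteness for Tonelli's
   theorem. *)
have sfM : sigma_finite setT M.
  apply: fin_num_fun_sigma_finite; first by rewrite measure0.
  by apply: lty_fin_num_fun; move: goo; rewrite gammaE.
have [mu muE] := sigma_finite_pack sfM.
have toM (g : hyper R d -> \bar R) : (\int[M]_K g K = \int[mu]_K g K)%E.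
  by apply: eq_measure_integral => A mA _; exact: esym (muE A).
have mfp (x : vec R d) : measurable_fun setT (fun K => f K * indic_cell x K)%E.
  apply: emeasurable_funM => //.
  apply: (measurableT_comp (f := fun z : borel_vec R d * hyper R d => indic_cell z.1 z.2)
   (g := fun K : hyper R d => (x : borel_vec R d, K))); first exact: indic_cell_measurable.
  by apply: measurable_fun_pair => //; exact: measurable_id.
(* Invariance of [M] and of f: K is replaced by its image under the rotation, which moves p to rho^T
   p. *)
have H rho : SO R d rho ->
    (\int[M]_K (f K * indic_cell (rho^T *m p) K) = \int[M]_K (f K * indic_cell p K))%E.
  move=> hr; rewrite -(integral_rotset (rho := rho) iso hr (mfp p)); last first.
    by move=> K; rewrite mule_ge0.
  apply: eq_integral => K _; rewrite frot//; congr (_ * (_%:E))%E.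
  rewrite !indicE; congr (_%:R); congr (nat_of_bool _); apply/idP/idP => /set_mem [/= h1 h2].
    by apply/mem_set; split; [exact: rotset_compacts|rewrite /= rotsetE].
  by apply/mem_set; split; [exact/(rotset_compactsE K hr)|exact/(rotsetE K p hr)].
transitivity (\int[lambda]_rho \int[mu]_K ((\1_(SO R d) rho)%:E * (f K * indic_cell ((rho : 'M[R]_d.+1)^T *m p) K)))%E.
  transitivity (\int[lambda]_rho ((\1_(SO R d) rho)%:E * \int[M]_K (f K * indic_cell p K)))%E.
    rewrite ge0_integralZr//; last 2 first.
    - by apply/measurable_EFinP/measurable_indic; exact: measurable_SO.
    - by apply: integral_ge0 => K _; rewrite mule_ge0.
    rewrite integral_indic//; last exact: measurable_SO.
    by rewrite setIT -[LHS]mul1e; congr (_ * _)%E; case: hlambda.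
  apply: eq_integral => rho _; rewrite ge0_integralZl//; last by move=> K _; rewrite mule_ge0.
  rewrite indicE; case: (boolP (rho \in _)) => [/set_mem hr|_]; last by rewrite !mul0e.
  by rewrite !mul1e -toM H.
have [nu nuE] := @sigma_finite_pack _ _ R lambda (sigma_finiteT lambda).
transitivity (\int[nu]_rho \int[mu]_K ((\1_(SO R d) rho)%:E * (f K * indic_cell ((rho : 'M[R]_d.+1)^T *m p) K)))%E.
  by apply: eq_measure_integral => A mA _; exact: esym (nuE A).
rewrite (fubini_tonelli (fun z : borelM R d.+1 d.+1 * hyper R d => (\1_(SO R d) z.1)%:E * (f z.2 * indic_cell ((z.1 : 'M[R]_d.+1)^T *m p) z.2))%E)//=; last first.
  by move=> z; rewrite !mule_ge0// lee_fin.
rewrite toM; apply: eq_integral => K _; rewrite -inner.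
by apply: eq_measure_integral => A mA _; exact: nuE.
Qed.

End weight.

Lemma null_seq dT (T : measurableType dT) (m : {measure set T -> \bar R}) (I : eqType)
    (r : seq I) (F : I -> set T) :
  (forall i, i \in r -> measurable (F i) /\ m (F i) = 0%E) ->
  measurable [set x | exists2 i, i \in r & F i x] /\
  m [set x | exists2 i, i \in r & F i x] = 0%E.
Proof.
elim: r => [|i r IH] h.
  rewrite (_ : [set x | _] = set0); first by rewrite measure0.
  by rewrite -subset0 => x [].
have [m1 z1] := h i (mem_head _ _).
have [m2 z2] := IH (fun j jr => h j (@mem_behead _ (i :: r) _ jr)).
rewrite (_ : [set x | _] = F i `|` [set x | exists2 i, i \in r & F i x]); last first.
  apply/seteqP; split => x /=.
    by move=> [j]; rewrite inE => /predU1P[->|jr] Fx; [left|right; exists j].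
  by move=> [Fx|[j jr Fx]]; [exists i; rewrite ?mem_head|exists j; rewrite // inE jr orbT].
by split; [exact: measurableU|exact: null_set_setU].
Qed.

(** Finite additivity up to a null set: the overlap of a new set with the union of the others lies
    in N. *)
Lemma sum_measure_overlap dT (T : measurableType dT) (m : {measure set T -> \bar R})
    (I : eqType) (r : seq I) (F : I -> set T) (N : set T) :
  uniq r -> (forall i, i \in r -> measurable (F i)) -> measurable N -> m N = 0%E ->
  (forall i j, i \in r -> j \in r -> i <> j -> F i `&` F j `<=` N) ->
  measurable [set x | exists2 i, i \in r & F i x] /\
  (\sum_(i <- r) m (F i) = m [set x | exists2 i, i \in r & F i x])%E.
Proof.
move=> + + mN N0; elim: r => [|i r IH] /=.
  rewrite big_nil (_ : [set x | _] = set0); first by rewrite measure0.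
  by rewrite -subset0 => x [].
move=> /andP[ir ur] mF FN; set B := [set x | exists2 i, i \in r & F i x] in IH *.
have [mB IHE] : measurable B /\ (\sum_(i <- r) m (F i) = m B)%E.
  apply: IH => // [j jr|j k jr kr]; first by apply: mF; rewrite inE jr orbT.
  by apply: FN; rewrite inE ?jr ?kr orbT.
have mi : measurable (F i) by apply: mF; rewrite mem_head.
rewrite (_ : [set x | exists2 j, j \in i :: r & F j x] = F i `|` B); last first.
  apply/seteqP; split => x /=.
    by move=> [j]; rewrite inE => /predU1P[->|jr] Fx; [left|right; exists j].
  by move=> [Fx|[j jr Fx]]; [exists i; rewrite ?mem_head|exists j; rewrite // inE jr orbT].
split; first exact: measurableU.
have -> : F i `|` B = F i `|` (B `\` F i).
  apply/seteqP; split => x; last by case=> [|[]]; [left|right].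
  by have [Fx|Fx] := pselect (F i x); [left|case=> // Bx; right].
rewrite big_cons IHE measureU//; last 2 first.
- exact: measurableD.
- by rewrite -subset0 => x [? []].
congr (_ + _)%E; rewrite (measureDI m mB mi) [X in (_ + X)%E](_ : _ = 0%E) ?adde0//.
apply: (subset_measure0 _ mN _ N0); first exact: measurableI.
move=> x [[j jr Fj] Fi]; apply: (FN i j); rewrite ?mem_head// ?inE ?jr ?orbT//.
by move=> ij; move: ir; rewrite ij jr.
Qed.

(** By [sigma_sph_haar] the areas are the Haar measures of the sets [F K] of rotations. These cover
    SO because the cells cover the sphere, and they overlap only in the null sets [H u]. *)
Lemma tessellation_sigma_sum s : tessellation s ->
  (\sum_(K <- s) sigma_sph (K : set (vec R d)) = 1)%E.
Proof.
move=> ts; pose F (K : hyper R d) : set (borelM R d.+1 d.+1) :=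
  [set rho | SO R d rho /\ (K : set (vec R d)) (rho^T *m p)].
have mF (A : set (borel_vec R d)) : measurable A ->
    measurable ([set rho | SO R d rho /\ A (rho^T *m p)] : set (borelM R d.+1 d.+1)).
  move=> mA; apply: measurableI; first exact: measurable_SO.
  rewrite -[X in measurable X]setTI.
  apply: (measurable_mulmx (f := fun rho : borelM R d.+1 d.+1 => (rho : 'M[R]_d.+1)^T : borelM R d.+1 d.+1)
    (g := fun _ => p)) => //.
  exact: (measurable_trmx (f := id)).
have [us [us0 hus]] := tessellation_overlap ts.
pose H (u : vec R d) : set (borelM R d.+1 d.+1) :=
  [set rho | SO R d rho /\ dot u (rho^T *m p) = 0].
have mH0 (u : vec R d) : measurable ([set x : vec R d | dot u x = 0] : set (borel_vec R d)).
  apply: closed_borelM; rewrite (_ : [set x | _] = dot u @^-1` [set 0])//.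
  by apply: closed_comp; [move=> x _; exact: dot_continuous|exact: closed_eq].
have [|mN N0] := @null_seq _ _ lambda _ us H.
  move=> u /us0 u0; split; first exact: (mF _ (mH0 u)).
  transitivity (sigma_sph [set x : vec R d | dot u x = 0]).
    by rewrite (sigma_sph_haar d0 hlambda hp (mH0 u)).
  exact: (sigma_sph_hyperplane u0).
have [||mU sE] := @sum_measure_overlap _ _ lambda _ s F _ (tessellation_uniq ts) _ mN N0.
- by move=> K Ks; apply: mF; apply: measurable_Khat_set; exact: tessellation_Khat Ks.
- move=> K L Ks Ls KL rho [[hr Kx] [_ Lx]].
  by have [u uus ux] := hus K L _ Ks Ls KL Kx Lx; exists u.
transitivity (\sum_(K <- s) lambda (F K))%E.
  by apply: eq_big_seq => K Ks; rewrite sigmaE//; exact: tessellation_Khat Ks.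
rewrite sE -[RHS](proj1 hlambda); congr (lambda _).
apply/seteqP; split => rho /=; first by case=> K _ [].
move=> hr; have hx : sphere R d (rho^T *m p) by apply/SO_sphere => //; exact: SO_tr.
by have [K Ks Kx] := tessellation_cover ts hx; exists K.
Qed.

(** The constant weight 1, set to 0 off [Khat] to meet the hypotheses of [crofton_weight]; with it
    the weighted sum counts the cells containing p. *)
Let one_Khat (K : hyper R d) : \bar R := (\1_(@Khat R d) K)%:E.

Let m_one : measurable_fun setT one_Khat.
Proof. by apply/measurable_EFinP/measurable_indic; exact: measurable_Khat. Qed.

Let one_ge0 K : (0 <= one_Khat K)%E. Proof. by rewrite lee_fin. Qed.

Let one_rot rho K : SO R d rho -> one_Khat (rotset rho K) = one_Khat K.
Proof.
move=> hr; rewrite /one_Khat !indicE; congr (_%:R%:E); congr (nat_of_bool _).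
by apply/idP/idP => /set_mem h; apply/mem_set; apply/(rotset_KhatE _ hr).
Qed.

Let one_K K : ~ Khat K -> one_Khat K = 0%E.
Proof. by move=> hK; rewrite /one_Khat indicE memNset. Qed.

Let nb_cells w := (\int[X' w]_K (one_Khat K * indic_cell p K))%E.

Let mfp (f : hyper R d -> \bar R) : measurable_fun setT f ->
  measurable_fun setT (fun K => f K * indic_cell p K)%E.
Proof.
move=> mf; apply: emeasurable_funM => //.
apply: (measurableT_comp (f := fun z : borel_vec R d * hyper R d => indic_cell z.1 z.2)
   (g := fun K : hyper R d => (p : borel_vec R d, K))); first exact: indic_cell_measurable.
by apply: measurable_fun_pair => //; exact: measurable_id.
Qed.

Let nb_cells_count w s : tessellation s -> is_counting s (X' w) ->
  nb_cells w = ((count (fun K : hyper R d => p \in (K : set (vec R d))) s)%:R)%:E.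
Proof.
move=> ts ms; rewrite /nb_cells (counting_integral ms); last 2 first.
- by move=> K; rewrite mule_ge0.
- exact: mfp.
rewrite -sum1_count natr_sum -sumEFin [RHS]big_mkcond /=.
apply: eq_big_seq => K Ks; have hK := tessellation_Khat ts Ks.
rewrite indic_cellE// /one_Khat indicE mem_set// mul1e.
by case: (_ \in _).
Qed.

Let measurable_nb_cells : measurable_fun setT nb_cells.
Proof.
apply: measurable_integral_kernel; last exact: mfp.
by move=> K; rewrite mule_ge0.
Qed.

Let bad_set : set Omega := [set w | nb_cells w != 1%E].

Let measurable_bad : measurable bad_set.
Proof.
rewrite (_ : bad_set = ~` (nb_cells @^-1` [set 1%E])).
  by apply: measurableC; rewrite -[X in measurable X]setTI; exact: measurable_nb_cells.
by apply/seteqP; split => w /= /eqP.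
Qed.

Let bad0 : P bad_set = 0%E.
Proof.
have E1 : (\int[P]_w nb_cells w = 1)%E.
  rewrite integral_intensity//; [|by move=> K; rewrite mule_ge0|exact: mfp].
  rewrite crofton_weight// -integral_intensity//; last 2 first.
  - by move=> K; exact: weight_sigma_ge0.
  - exact: measurable_weight_sigma.
  rewrite (eq_integral (cst 1%E)); first by rewrite integral_cst// mul1e; exact: probability_setT.
  move=> w _; have [s ts ms] := hX w; rewrite (counting_integral ms); last 2 first.
  - by move=> K; exact: weight_sigma_ge0.
  - exact: measurable_weight_sigma.
  rewrite -[RHS](tessellation_sigma_sum ts); apply: eq_big_seq => K Ks.
  by rewrite /one_Khat indicE mem_set ?mul1e//; exact: tessellation_Khat Ks.
(* The integer [nb_cells w] is at least 1 and at least 2 on the bad set, hence at least 1 plus the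
   indicator of that set; integration compares this with the mean 1. *)
have : (1 + P bad_set <= 1)%E.
  rewrite -[leRHS]E1.
  apply: (@le_trans _ _ (\int[P]_w (cst 1 w + (\1_bad_set w)%:E))%E).
    rewrite ge0_integralD//; last by apply/measurable_EFinP/measurable_indic.
    rewrite integral_cst// mul1e integral_indic// setIT leeD2r//.
    by have /eqP := probability_setT P; rewrite eq_le => /andP[].
  apply: ge0_le_integral => //.
  - by move=> w _; rewrite adde_ge0// lee_fin.
  - apply: emeasurable_funD; first exact: measurable_cst.
    by apply/measurable_EFinP/measurable_indic.
  move=> w _; have [s ts ms] := hX w; rewrite (nb_cells_count ts ms).
  have c1 : (0 < count (fun K : hyper R d => p \in (K : set (vec R d))) s)%N.
    have [K Ks Kp] := tessellation_cover ts hp.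
    by rewrite -has_count; apply/hasP; exists K => //; exact/mem_set.
  rewrite indicE; case: (boolP (w \in bad_set)) => [/set_mem|_].
    rewrite /bad_set /= (nb_cells_count ts ms) eqe pnatr_eq1 => c2.
    by rewrite -EFinD lee_fin (_ : (1 + _ = 2%:R)%R) ?ler_nat ?(natrD _ 1 1)//; move: c1 c2; case: count => [|[|]].
  by rewrite adde0 lee_fin ler1n.
have Pfin : P bad_set \is a fin_num by exact: fin_num_measure.
rewrite -[leRHS]adde0 leeD2lE// => h; apply/eqP; rewrite eq_le h.
exact: measure_ge0.
Qed.

Lemma crofton_cell_Khat (x : vec R d) m : Khat (crofton_cell x m).
Proof.
by rewrite /crofton_cell; case: xgetP => [K _ [[]]//|_]; right.
Qed.

(** Where exactly one cell contains p, that cell is the Crofton cell and gives the only contribution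
    to the integral against [X' w]; the remaining w form a null set. *)
Lemma crofton_cell_integral (f : hyper R d -> \bar R) : measurable_fun setT f ->
  (forall K, 0 <= f K)%E ->
  (\int[P]_w f (crofton_cell p (X' w)) = \int[M]_K (f K * indic_cell p K))%E.
Proof.
move=> mf f0.
rewrite -integral_intensity//; [|by move=> K; rewrite mule_ge0|exact: mfp].
apply: (ge0_ae_eq_integral_nomeas measurable_bad bad0) => //.
- apply: measurable_integral_kernel; last exact: mfp.
  by move=> K; rewrite mule_ge0.
- by move=> w; apply: integral_ge0 => K _; rewrite mule_ge0.
move=> w /negP; rewrite negbK; have [s ts ms] := hX w.
rewrite (nb_cells_count ts ms) eqe pnatr_eq1 => /eqP c1.
have [K Ks Kp] := tessellation_cover ts hp.
have KE L : L \in s -> (L : set (vec R d)) p -> L = K.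
  by move=> Ls Lp; apply: (count1_unique (tessellation_uniq ts) c1) => //; exact/mem_set.
rewrite (crofton_cell_single ms ts hp Ks Kp KE) (counting_integral ms); last 2 first.
- by move=> L; rewrite mule_ge0.
- exact: mfp.
rewrite (bigD1_seq K)//=; last exact: tessellation_uniq.
rewrite indic_cellE ?mem_set ?mule1//; last exact: tessellation_Khat Ks.
rewrite big1_seq ?adde0// => L /andP[LK Ls].
rewrite indic_cellE; last exact: tessellation_Khat Ls.
by rewrite memNset ?mule0// => Lp; move: LK; rewrite (KE L)// eqxx.
Qed.

End crofton.

(** * The typical cell and the Crofton formula *)

Lemma sigma_sph_rotset (R : realType) (d : nat) (rho : 'M[R]_d.+1) (A : set (borel_vec R d)) :
  SO R d rho -> measurable A -> sigma_sph (rotset rho A) = sigma_sph (A : set (vec R d)).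
Proof.
move=> hr mA; rewrite rotset_preimage// /sigma_sph; congr (_ * _)%E.
rewrite -[RHS](lebesgue_cV_rot (SO_trK (SO_tr hr)) (measurable_spherical_cone mA)).
congr lebesgue_cV; rewrite !spherical_coneE.
by apply/seteqP; split => x /= -[h Ax]; split; move: h Ax;
  rewrite ?orth_enorm ?normalize_orth//; exact: SO_trK (SO_tr hr).
Qed.

Section typical.
Context {R : realType} {d : nat} {dO dO' : measure_display}.
Context {Omega : measurableType dO} {Omega' : measurableType dO'}.
Context (P : probability Omega R) (P' : probability Omega' R).
Context (X' : R.-ker Omega ~> hyper R d) (hX : random_tessellation X').
Context (kappa : vec R d -> probability (borelM R d.+1 d.+1) R)
  (c : hyper R d -> borel_vec R d) (Z : Omega' -> hyper R d).
Context (lambda : probability (borelM R d.+1 d.+1) R) (p : vec R d).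
Context (g0 : (0 < gamma P X')%E) (goo : (gamma P X' < +oo)%E) (d0 : (0 < d)%N).
Context (hp : sphere R d p) (hlambda : haar_probability (SO R d) lambda).
Context (hkappa : rotation_kernel lambda p kappa) (hc : centre_function c).
Context (hZ : typical_cell P P' kappa c X' Z).
Notation M := (intensity_measure P X').

(** For a centre on the sphere the kernel is the stabilizer measure translated by a rotation, for
    the centre 0 it is Haar measure; both are carried by SO. So the inner average in [typical_cell]
    has total mass 1. *)
Lemma kappa_SO K : Khat K -> kappa (c K) (SO R d) = 1%E.
Proof.
move=> hK; have [[kS _] kx k0] := hkappa; have [_ cS _] := hc.
have [hcK|->] := cS K (Khat_compacts hK); last first.
  by rewrite k0; [case: hlambda|exact: measurable_SO].
have [rho hr rp] := SO_transitive d0 hp hcK.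
rewrite (kx _ _ hcK hr rp); last exact: measurable_SO.
have mrS : measurable ([set r | SO R d (rho *m r)] : set (borelM R d.+1 d.+1)).
  rewrite -[X in measurable X]setTI; apply: (continuous_borelM (f := mulmx rho)) => //.
    exact: continuous_mulmxl.
  exact: measurable_SO.
have mst : measurable (stabilizer p : set (borelM R d.+1 d.+1)).
  apply: measurableI; first exact: measurable_SO.
  suff cp : closed ((fun r : 'M[R]_d.+1 => r *m p) @^-1` [set p]) by exact: closed_borelM cp.
  apply: closed_comp; first by move=> x _; exact: continuous_mulmxr.
  by apply: accessible_closed_set1; apply: hausdorff_accessible; exact: norm_hausdorff.
apply/eqP; rewrite eq_le probability_le1//= -[leLHS]kS.
by apply: le_measure; rewrite ?inE// => r [hs _]; exact: SO_mul.
Qed.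

(** On an invariant set the random rotation in [typical_cell] has no effect and the inner integral
    is the indicator of A at K. Thus on invariant sets the law of Z is [M] divided by gamma. *)
Lemma typical_cell_invariant (A : set (hyper R d)) : measurable A ->
  (forall rho K, SO R d rho -> A (rotset rho K) <-> A K) ->
  P' (Z @^-1` A) = (((fine (gamma P X'))^-1)%:E * M A)%E.
Proof.
move=> mA Arot; have [_ _ ->//] := hZ; congr (_ * _)%E.
rewrite -(intensity_Khat P hX mA); apply: eq_integral => w _.
transitivity (\int[X' w]_K (\1_(A `&` @Khat R d) K)%:E)%E; last first.
  by rewrite integral_indic ?setIT//; apply: measurableI => //; exact: measurable_Khat.
rewrite integral_mkcond.
apply: eq_integral => K _; rewrite patchE indicE in_setI.
case: (boolP (K \in @Khat R d)) => [/set_mem hK|_]; last by rewrite andbF.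
rewrite andbT -[RHS]mule1 -(kappa_SO hK) -integral_cst; last exact: measurable_SO.
apply: eq_integral => rho /set_mem hr; rewrite indicE SO_invmx//.
congr (_%:R%:E); congr (nat_of_bool _); apply/idP/idP => /set_mem h; apply/mem_set.
  by apply/(Arot rho^T) => //; exact: SO_tr.
by apply/(Arot rho^T) => //; exact: SO_tr.
Qed.

(** Both integrals are rewritten as integrals of y over [0, +oo] against image measures under g.
    These involve only preimages of sets under g, which are rotation invariant. *)
Lemma typical_cell_integral (g : hyper R d -> \bar R) : measurable_fun setT g ->
  (forall K, 0 <= g K)%E ->
  (forall rho K, SO R d rho -> g (rotset rho K) = g K) ->
  (gamma P X' * \int[P']_w g (Z w) = \int[M]_K g K)%E.
Proof.
move=> mg gg0 grot.
have mZ : measurable_fun setT Z by case: hZ.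
have mI : measurable (`[0%E, +oo%E] : set (\bar R)) by exact: emeasurable_itv.
have toy dT (T : measurableType dT) (m : {measure set T -> \bar R}) (W : T -> \bar R) :
    measurable_fun setT W -> (forall x, 0 <= W x)%E ->
    (\int[m]_x W x = \int[pushforward m W]_(y in `[0, +oo]) y)%E.
  move=> mW W0; rewrite [RHS]ge0_integral_pushforward//.
    by rewrite (_ : W @^-1` _ = setT)//; apply/seteqP; split => x //= _; rewrite in_itv /= W0 leey.
  by move=> y; rewrite inE /= in_itv /= => /andP[].
have gfin : gamma P X' \is a fin_num by rewrite ge0_fin_numE// ltW.
have fg0 : 0 < fine (gamma P X') by rewrite fine_gt0// g0.
have mgZ : measurable_fun setT (g \o Z) by exact: measurableT_comp.
apply: etrans; last exact: (esym (toy _ _ M g mg gg0)).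
have -> : (\int[P']_w g (Z w) = \int[pushforward P' (g \o Z)]_(y in `[0, +oo]) y)%E.
  exact: (toy _ _ P' (g \o Z) mgZ (fun w => gg0 (Z w))).
have ig0 : 0 <= fine (gamma P X') by exact: ltW.
(* As a non-negative number the factor gamma can be absorbed into the measure. *)
rewrite -{1}(fineK gfin) -[(fine _)%:E]/((NngNum ig0)%:num%:E).
have [mu muE] := pushforward_pack P' mgZ.
have [nu nuE] := pushforward_pack M mg.
transitivity ((NngNum ig0)%:num%:E * \int[mu]_(y in `[0, +oo]) y)%E.
  by congr (_ * _)%E; apply: eq_measure_integral => A mA _; exact: esym (muE A).
rewrite -ge0_integral_mscale//; last by move=> y; rewrite /= in_itv /= => /andP[].
apply: eq_measure_integral => A mA _; rewrite /= /mscale muE /=.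
have mgA : measurable (g @^-1` A) by rewrite -[X in measurable X]setTI; exact: mg.
rewrite comp_preimage typical_cell_invariant//; last first.
  by move=> rho K hr; rewrite /= grot.
by rewrite muleA -EFinM divff ?mul1e// gt_eqF.
Qed.

End typical.

Lemma crofton_formula (R : realType) (d : nat) (dO : measure_display)
    (Omega : measurableType dO) (P : probability Omega R) (X' : R.-ker Omega ~> hyper R d)
    (f : hyper R d -> R) (p : vec R d)
    (lambda : probability (borelM R d.+1 d.+1) R)
    (kappa : vec R d -> probability (borelM R d.+1 d.+1) R)
    (c : hyper R d -> borel_vec R d)
    (dO' : measure_display) (Omega' : measurableType dO')
    (P' : probability Omega' R) (Z : Omega' -> hyper R d) :
  (0 < d)%N -> random_tessellation X' -> isotropic P X' -> (0 < gamma P X' < +oo)%E ->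
  measurable_fun (@Khat R d) f -> (forall K, Khat K -> 0 <= f K) ->
  (forall rho K, SO R d rho -> Khat K -> f (rotset rho K) = f K) ->
  sphere R d p -> haar_probability (SO R d) lambda ->
  rotation_kernel lambda p kappa -> centre_function c ->
  typical_cell P P' kappa c X' Z ->
  (\int[P]_w (f (crofton_cell p (X' w)))%:E =
   gamma P X' * \int[P']_w ((f (Z w))%:E * sigma_sph (Z w)))%E.
Proof.
move=> d0 hX iso /andP[g0 goo] mf f0 frot hp hl hk hc hZ.
(* f is constrained on [Khat] only; its extension by 0 is measurable, non-negative and rotation
   invariant everywhere. *)
pose fe : hyper R d -> \bar R := (EFin \o f) \_ (@Khat R d).
have mfe : measurable_fun setT fe.
  apply/(measurable_restrictT _ _).1; first exact: measurable_Khat.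
  exact/measurable_EFinP.
have fe0 K : (0 <= fe K)%E.
  by rewrite /fe patchE; case: ifPn => // /set_mem hK; rewrite lee_fin f0.
have feE K : Khat K -> fe K = (f K)%:E by move=> hK; rewrite /fe patchE mem_set.
have feK K : ~ Khat K -> fe K = 0%E by move=> hK; rewrite /fe patchE memNset.
have ferot rho K : SO R d rho -> fe (rotset rho K) = fe K.
  move=> hr; have [hK|hK] := pselect (Khat K).
    by rewrite !feE// ?frot//; exact: rotset_Khat.
  by rewrite !feK// => /(rotset_KhatE _ hr).
transitivity (\int[P]_w fe (crofton_cell p (X' w)))%E.
  by apply: eq_integral => w _; rewrite feE//; exact: crofton_cell_Khat.
rewrite (crofton_cell_integral hX iso goo d0 hl hp mfe fe0).
rewrite (crofton_weight hX iso goo d0 hl hp mfe fe0 ferot feK).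
rewrite -(typical_cell_integral hX g0 goo d0 hp hl hk hc hZ).
- congr (_ * _)%E; apply: eq_integral => w _; rewrite feE//.
  by case: hZ => _ + _; apply.
- exact: (measurable_weight_sigma d0 hl hp mfe fe0 feK).
- by move=> K; exact: (weight_sigma_ge0 d0 hl hp fe0 feK).
move=> rho K hr; rewrite ferot//.
have [hK|hK] := pselect (Khat K); last by rewrite feK// !mul0e.
congr (_ * _)%E.
by apply: sigma_sph_rotset => //; exact: measurable_Khat_set.
Qed.

(** * Hyperplanes in general position *)

Section linear_independence.
Context {R : realType} {d : nat}.
Implicit Types (x y z w q : vec R d) (c l s : seq (vec R d)).

(** The number k of rows is a separate parameter so that lists of equal size, such as c and its
    perturbation in [lin_indep_open], yield matrices of one type. *)
Definition rows_mx k c : 'M[R]_(k, d.+1) := \matrix_(i < k, j < d.+1) (nth 0 c i) j 0.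

Definition lin_indep c := row_free (rows_mx (size c) c).

Lemma rows_mxE k c y i : (rows_mx k c *m y) i 0 = dot (nth 0 c i) y.
Proof. by rewrite mxE dotE; apply: eq_bigr => j _; rewrite mxE. Qed.

Lemma rows_mx_col k c p (B : 'M[R]_(d.+1, p)) i j :
  (rows_mx k c *m B) i j = dot (nth 0 c i) (col j B).
Proof. by rewrite mxE dotE; apply: eq_bigr => m _; rewrite !mxE. Qed.

Lemma rows_mx_eq0 c y : rows_mx (size c) c *m y = 0 <-> forall q, q \in c -> dot q y = 0.
Proof.
split => [h q /(nthP 0)[i ic <-]|h].
  by have := congr1 (fun v : 'cV_(size c) => v (Ordinal ic) 0) h; rewrite rows_mxE mxE.
by apply/colP => i; rewrite rows_mxE mxE h// mem_nth.
Qed.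

Lemma row_mul_rows_mx k c (a : 'rV[R]_k) y :
  (a *m rows_mx k c *m y) 0 0 = \sum_i a 0 i * dot (nth 0 c i) y.
Proof. by rewrite -mulmxA mxE; apply: eq_bigr => i _; rewrite rows_mxE. Qed.

(** The first column of a right inverse of the rows pairs to 1 with x and to 0 with the other
    vectors. *)
Lemma lin_indep_dual x c : lin_indep (x :: c) ->
  exists2 z, (forall q, q \in c -> dot q z = 0) & dot x z != 0.
Proof.
move=> /row_freeP[B hB]; exists (col 0 B); last first.
  rewrite -[x]/(nth 0 (x :: c) (0%R : 'I_(size c).+1)) -(@rows_mx_col (size c).+1) hB.
  by rewrite mxE eqxx oner_eq0.
move=> q /(nthP 0)[i ic <-].
pose i' : 'I_(size c).+1 := lift 0 (Ordinal ic).
rewrite -[nth 0 c i]/(nth 0 (x :: c) i') -(@rows_mx_col (size c).+1) hB.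
by rewrite mxE.
Qed.

Lemma lin_indep_full c y : lin_indep c -> size c = d.+1 ->
  (forall q, q \in c -> dot q y = 0) -> y = 0.
Proof.
move=> fc sc /rows_mx_eq0 h; move: fc h; rewrite /lin_indep; move: (rows_mx _ _).
rewrite sc => M; rewrite row_free_unit => uM h.
by rewrite -[y]mul1mx -(mulVmx uM) -mulmxA h mulmx0.
Qed.

Lemma orthogonal_sphere c : (size c < d.+1)%N ->
  exists2 w, sphere R d w & forall q, q \in c -> dot q w = 0.
Proof.
move=> sc.
have : kermx (rows_mx (size c) c)^T != 0.
  rewrite kermx_eq0 /row_free mxrank_tr; apply/negP => /eqP e.
  by have := rank_leq_row (rows_mx (size c) c); rewrite e leqNgt sc.
move=> /rowV0Pn[v /sub_kermxP hv v0].
have vT0 : v^T != 0 by apply: contra_neq v0 => /(congr1 trmx); rewrite trmxK trmx0.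
exists (normalize v^T); first exact: sphere_normalize.
move=> q qc; rewrite dot_normalize (proj1 (rows_mx_eq0 c v^T))// ?mulr0//.
by apply: trmx_inj; rewrite trmx_mul trmxK trmx0.
Qed.

(** Pairing a linear relation with w kills the coefficient of x, and what remains is a relation
    within c. *)
Lemma lin_indep_cons x c w : lin_indep c -> (forall q, q \in c -> dot q w = 0) ->
  dot x w != 0 -> lin_indep (x :: c).
Proof.
move=> fc hw xw; apply: inj_row_free => a ha.
have ha0 : a 0 0 = 0.
  have := row_mul_rows_mx (x :: c) a w; rewrite ha mul0mx mxE.
  rewrite big_ord_recl /= big1 ?addr0; last first.
    by move=> i _; rewrite hw ?mulr0//; exact: mem_nth (ltn_ord i).
  by move/esym/eqP; rewrite mulf_eq0 (negbTE xw) orbF => /eqP.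
pose b : 'rV[R]_(size c) := \row_i a 0 (lift 0 i).
have : b *m rows_mx (size c) c = 0.
  apply/rowP => j; have := congr1 (fun v : 'rV_d.+1 => v 0 j) ha.
  rewrite !mxE big_ord_recl /= ha0 mul0r add0r => e; rewrite -[RHS]e.
  by apply: eq_bigr => i _; rewrite !mxE.
move=> hb; have {hb} b0 : b = 0.
  by apply: (row_free_inj fc); rewrite /= hb mul0mx.
apply/rowP => i; rewrite mxE; have [j ->|->//] := unliftP 0 i.
by have := congr1 (fun v : 'rV_(size c) => v 0 j) b0; rewrite !mxE.
Qed.

(** For a right inverse B of the rows, A |-> det (A B) is continuous and equals 1 at c; where it is
    non-zero, A again has a right inverse. *)
Lemma lin_indep_open c : lin_indep c -> exists2 e : R, 0 < e &
  forall c', size c' = size c ->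
    (forall i j, (i < size c)%N -> `|nth 0 c i j 0 - nth 0 c' i j 0| < e) -> lin_indep c'.
Proof.
move=> /row_freeP[B hB]; set k := size c in hB *.
pose f (A : 'M[R]_(k, d.+1)) := \det (A *m B).
have cf : continuous f.
  apply: (continuousT_comp (f := fun A : 'M[R]_(k, d.+1) => A *m B)).
    exact: continuous_mulmxr.
  exact: continuous_det.
have : \forall A \near rows_mx k c, f A != 0.
  have f1 : f (rows_mx k c) = 1 by rewrite /f hB det1.
  have h0 : 0 < f (rows_mx k c) by rewrite f1.
  have h := cf (rows_mx k c) _ (lt_nbhsr h0).
  by apply: filterS (h : \forall A \near rows_mx k c, 0 < f A) => A /gt_eqF ->.
move=> /nbhs_ballP[e /= e0 he]; exists e => // c' sc' h.
rewrite /lin_indep sc'; have {}he : f (rows_mx k c') != 0.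
  by apply: he; split => // i j; rewrite /ball /= !mxE; apply: h; exact: ltn_ord.
apply/row_freeP; exists (B *m invmx (rows_mx k c' *m B)).
by rewrite mulmxA mulmxV// unitmxE unitfE.
Qed.

Lemma lin_indep_nil : lin_indep [::].
Proof. by rewrite /lin_indep /row_free -leqn0 rank_leq_row. Qed.

Lemma lin_dep_hyperplane c : lin_indep c -> (size c < d.+1)%N ->
  exists2 w, sphere R d w & forall x, ~ lin_indep (x :: c) -> dot w x = 0.
Proof.
move=> fc /orthogonal_sphere[w hw cw]; exists w => // x nf; apply/eqP/negPn/negP => xw.
by apply: nf; apply: (lin_indep_cons fc cw); rewrite dotC.
Qed.

End linear_independence.

(** * Counting realizable sign vectors *)

Section sign_vectors.
Context {R : realType} {d : nat}.
Implicit Types (x y z w q : vec R d) (c l s : seq (vec R d)) (e : bitseq).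

Definition has_sign (q : vec R d) (b : bool) y := if b then 0 < dot q y else dot q y < 0.

Definition realizes l e y := all2 (fun q b => has_sign q b y) l e.

(** Set up for deletion and restriction: signs are prescribed with respect to [l], and the vector is
    confined to the orthogonal complement of [c]. *)
Definition realizable c l e :=
  exists2 y, forall q, q \in c -> dot q y = 0 & realizes l e y.

Fixpoint bit_words (n : nat) : seq bitseq :=
  if n is n'.+1 then
    map (cons true) (bit_words n') ++ map (cons false) (bit_words n')
  else [:: [::]].

Definition nb_realizable c l :=
  count (fun e => `[< realizable c l e >]) (bit_words (size l)).

Lemma mem_bit_words n e : (e \in bit_words n) = (size e == n).
Proof.
elim: n e => [|n IH] [|b e] //=.
  by rewrite mem_cat; apply/negbTE/negP => /orP[]/mapP[].
rewrite mem_cat eqSS -IH; apply/orP/idP.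
  by move=> []/mapP[e' he' [_ ->]].
by move=> he; case: b; [left|right]; apply/mapP; exists e.
Qed.

Lemma bit_words_uniq n : uniq (bit_words n).
Proof.
elim: n => [|n IH] //=; rewrite cat_uniq !map_inj_uniq ?IH ?andbT /=; try by move=> ? ? [].
by apply/hasPn => e /mapP[e' _ ->]; apply/negP => /mapP[].
Qed.

Lemma realizes_near l e y z : realizes l e y ->
  \forall t \near (0 : R), realizes l e (y + t *: z).
Proof.
elim: l e => [|q l IH] [|b e] //=; first by move=> _; exact: nbhs_true.
move=> /andP[hq /IH he]; rewrite /realizes /=.
have cq : {for 0, continuous (fun t : R => dot q (y + t *: z))}.
  rewrite (_ : (fun _ => _) = fun t => dot q y + t * dot q z); last first.
    by apply/funext => t; rewrite dotDr dotZr.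
  by apply: cvgD; [exact: cvg_cst|apply: cvgM; [exact: cvg_id|exact: cvg_cst]].
have q0 : dot q (y + 0 *: z) = dot q y by rewrite scale0r addr0.
have h : \forall t \near (0 : R), has_sign q b (y + t *: z).
  case: b hq => hq.
    by apply: (cq (fun r => 0 < r)); rewrite q0; exact: lt_nbhsr.
  by apply: (cq (fun r => r < 0)); rewrite q0; exact: lt_nbhsl.
by apply: filterS2 h he => t h1 h2; apply/andP.
Qed.

Lemma realizes_perturb l e y z : realizes l e y ->
  exists2 t : R, 0 < t & realizes l e (y + t *: z) /\ realizes l e (y - t *: z).
Proof.
move=> /realizes_near -/(_ z)/nbhs_ballP[r /= r0 hr]; exists (r / 2); first by rewrite divr_gt0.
have rr : r / 2 < r by rewrite ltr_pdivrMr// ltr_pMr// ltr1n.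
split; first by apply: hr; rewrite /ball /= sub0r normrN gtr0_norm ?divr_gt0.
rewrite -scaleNr; apply: hr.
by rewrite /ball /= sub0r opprK gtr0_norm ?divr_gt0.
Qed.

Lemma realizes_comb l e y z (a b : R) : 0 < a -> 0 < b ->
  realizes l e y -> realizes l e z -> realizes l e (a *: y + b *: z).
Proof.
move=> a0 b0; elim: l e => [|q l IH] [|c e] //= /andP[h1 h2] /andP[h3 h4].
apply/andP; split; last exact: IH.
rewrite /has_sign dotDr !dotZr; case: c h1 h3 => /= h1 h3.
  by rewrite addr_gt0// mulr_gt0.
by rewrite -[ltRHS]addr0 ltrD// pmulr_rlt0.
Qed.

(** Inclusion-exclusion for the two possible signs at x. At least one sign is possible iff e is
    realizable on c^perp, since a witness on x^perp can be pushed off it along z; both are possible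
    iff e is realizable on (x :: c)^perp, since the segment between witnesses on opposite sides
    crosses x^perp. *)
Lemma nb_realizable_cons c x l :
  (exists2 z, (forall q, q \in c -> dot q z = 0) & dot x z != 0) ->
  nb_realizable c (x :: l) = (nb_realizable c l + nb_realizable (x :: c) l)%N.
Proof.
move=> [z cz xz]; rewrite /nb_realizable /= count_cat !count_map -count_predUI.
have cyz (t : R) y : (forall q, q \in c -> dot q y = 0) ->
    forall q, q \in c -> dot q (y + t *: z) = 0.
  by move=> cy q qc; rewrite dotDr dotZr cy// cz// mulr0 addr0.
have cyz' (t : R) y : (forall q, q \in c -> dot q y = 0) ->
    forall q, q \in c -> dot q (y - t *: z) = 0.
  by move=> cy q qc; rewrite -scaleNr; exact: cyz.
(* The sign of dot x z is unknown, so it is open which of the two perturbations lies on which side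
   of x^perp. *)
have xe (t : R) y : dot x y = 0 -> 0 < t ->
    (0 < dot x (y + t *: z)) && (dot x (y - t *: z) < 0) ||
    (dot x (y + t *: z) < 0) && (0 < dot x (y - t *: z)).
  move=> xy t0; rewrite !dotDr dotNr !dotZr xy !add0r.
  rewrite !oppr_lt0 oppr_gt0 !pmulr_rgt0// !pmulr_rlt0// !andbb.
  by move: xz; rewrite neq_lt orbC.
congr (_ + _)%N; apply: eq_count => e /=; apply/idP/idP.
- move=> /orP[]/asboolP[y cy] /= /andP[_ hy]; apply/asboolP; by exists y.
- move=> /asboolP[y cy hy]; have [xy|xy|xy] := ltgtP (dot x y) 0.
  + by apply/orP; right; apply/asboolP; exists y => //=; rewrite /realizes /= xy.
  + by apply/orP; left; apply/asboolP; exists y => //=; rewrite /realizes /= xy.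
  have [t t0 [h1 h2]] := realizes_perturb z hy.
  have /orP[/andP[s1 s2]|/andP[s1 s2]] := xe t y xy t0.
    apply/orP; left; apply/asboolP; exists (y + t *: z); first exact: cyz.
    by rewrite /realizes /= s1.
  apply/orP; left; apply/asboolP; exists (y - t *: z); first exact: cyz'.
  by rewrite /realizes /= s2.
- move=> /andP[/asboolP[y1 cy1 /= /andP[s1 h1]] /asboolP[y2 cy2 /= /andP[s2 h2]]].
  rewrite /has_sign in s1 s2.
  (* The positive combination of [y1] and [y2] that is orthogonal to x. *)
  apply/asboolP; exists ((- dot x y2) *: y1 + dot x y1 *: y2).
    move=> q; rewrite inE => /predU1P[->|qc].
      by rewrite dotDr !dotZr; ring.
    by rewrite dotDr !dotZr (cy1 q qc) (cy2 q qc) !mulr0 addr0.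
  by apply: realizes_comb => //; rewrite oppr_gt0.
- move=> /asboolP[y cy hy]; have [t t0 [h1 h2]] := realizes_perturb z hy.
  have xy : dot x y = 0 by apply: cy; rewrite mem_head.
  have {}cy q : q \in c -> dot q y = 0 by move=> qc; apply: cy; rewrite inE qc orbT.
  have /orP[/andP[s1 s2]|/andP[s1 s2]] := xe t y xy t0; apply/andP; split; apply/asboolP.
  + by exists (y + t *: z); [exact: cyz|rewrite /realizes /= s1].
  + by exists (y - t *: z); [exact: cyz'|rewrite /realizes /= s2].
  + by exists (y - t *: z); [exact: cyz'|rewrite /realizes /= s2].
  + by exists (y + t *: z); [exact: cyz|rewrite /realizes /= s1].
Qed.

(* Number of chambers of [n] hyperplanes through the origin of R^j in general
   position. *)
Fixpoint nb_chambers (n j : nat) : nat :=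
  match n, j with
  | 0, _ => 1
  | n'.+1, 0 => 0
  | n'.+1, j'.+1 => nb_chambers n' j + nb_chambers n' j'
  end.

Definition general_position s :=
  forall m, uniq m -> {subset m <= s} -> (size m <= d.+1)%N -> lin_indep m.

(* A sign vector of [l] realized on the subspace [c]^perp extends to [x :: l] in
   both ways iff it is realized on (x :: c)^perp. *)
Lemma nb_realizable_gp s : general_position s -> forall l c,
  uniq (c ++ l) -> {subset c ++ l <= s} -> (size c <= d.+1)%N ->
  nb_realizable c l = nb_chambers (size l) (d.+1 - size c).
Proof.
move=> gp; elim => [|x l IH] c uc cs sc.
  by rewrite /nb_realizable /= asboolT//; exists 0 => // q _; rewrite dot0r.
have uxc : uniq ((x :: c) ++ l) by move: uc; rewrite -(cat1s x l) uniq_catCA.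
have ucl : uniq (c ++ l) by move: uxc => /andP[].
have uc1 : uniq (x :: c).
  by move: uxc; rewrite cat_uniq => /andP[].
have scl : {subset c ++ l <= s}.
  by move=> q; rewrite mem_cat => /orP[] qq; apply: cs; rewrite mem_cat ?qq// inE qq !orbT.
have sxc : {subset (x :: c) ++ l <= s}.
  by move=> q; rewrite inE => /predU1P[->|/scl//]; apply: cs; rewrite mem_cat mem_head orbT.
(* If c already consists of d + 1 independent vectors, c^perp = {0} and no strict sign at x can be
   realized, in agreement with [nb_chambers n.+1 0 = 0]. *)
have [scd|scd] := ltnP (size c) d.+1; last first.
  have {}scd : size c = d.+1 by apply/eqP; rewrite eqn_leq sc.
  rewrite scd subnn /=; apply/eqP; rewrite -leqn0 leqNgt -has_count; apply/negP.
  move=> /hasP[e _ /asboolP[y cy]].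
  have -> : y = 0.
    apply: (lin_indep_full _ scd cy); apply: gp => //.
      by move: uc; rewrite cat_uniq => /andP[].
    by move=> q qc; apply: cs; rewrite mem_cat qc.
  by case: e => [|[] e] //=; rewrite /realizes /= dot0r ltxx.
rewrite nb_realizable_cons; last first.
  apply: lin_indep_dual; apply: gp => //.
  by move=> q qxc; apply: sxc; rewrite mem_cat qxc.
rewrite IH// IH//= subSS subSn//.
Qed.

End sign_vectors.

(** * Cells induced by hyperspheres *)

Section induced_cells_theory.
Context {R : realType} {d : nat} (d0 : (0 < d)%N).
Implicit Types (x y z w q : vec R d) (s : seq (vec R d)) (e : bitseq).

Definition sign_cell s e : set (vec R d) := [set y | sphere R d y /\ realizes s e y].

Definition sign_word s y : bitseq := [seq 0 < dot q y | q <- s].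

(** The closed counterpart of [realizes], satisfied on the closure of a sign cell. *)
Definition weakly_realizes s e y :=
  all2 (fun q (b : bool) => if b then 0 <= dot q y else dot q y <= 0) s e.

Lemma realizesW s e y : realizes s e y -> weakly_realizes s e y.
Proof.
elim: s e => [|q s IH] [|b e] //= /andP[h /IH h2]; apply/andP; split => //.
by case: b h => /= /ltW.
Qed.

Lemma off_hyperspheresE s y : off_hyperspheres [set` s] y <->
  sphere R d y /\ forall q, q \in s -> dot q y != 0.
Proof.
split => [[hy h]|[hy h]]; split => //.
  by move=> q qs; apply/eqP => e; apply: h; exists q.
by move=> [q /= qs [_ /eqP]]; apply/negP; exact: h.
Qed.

Lemma realizes_sign_word s y : (forall q, q \in s -> dot q y != 0) ->
  realizes s (sign_word s y) y.
Proof.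
elim: s => [|q s IH] h //=; rewrite /realizes /=; apply/andP; split.
  by have := h q (mem_head _ _); rewrite /has_sign neq_lt; case: ltgtP.
by apply: IH => r rs; apply: h; rewrite inE rs orbT.
Qed.

Lemma weakly_realizes_sign_word s e y : (forall q, q \in s -> dot q y != 0) ->
  weakly_realizes s e y -> e = sign_word s y.
Proof.
elim: s e => [|q s IH] [|b e] //= h /andP[h1 h2]; congr (_ :: _).
  by have := h q (mem_head _ _); case: b h1; case: ltgtP.
by apply: IH => // r rs; apply: h; rewrite inE rs orbT.
Qed.

Lemma realizes_neq0 s e y : realizes s e y -> forall q, q \in s -> dot q y != 0.
Proof.
elim: s e => [|q s IH] [|b e] //= /andP[h1 /IH h2] r; rewrite inE => /predU1P[->|/h2//].
by case: b h1 => /=; [move=> /gt_eqF ->|move=> /lt_eqF ->].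
Qed.

Lemma sign_cell_off s e : sign_cell s e `<=` off_hyperspheres [set` s].
Proof. by move=> y [hy /realizes_neq0 h]; apply/off_hyperspheresE. Qed.

Lemma sign_cell_word s e y : sign_cell s e y -> e = sign_word s y.
Proof.
by move=> [hy h]; apply: weakly_realizes_sign_word; [exact: realizes_neq0 h|exact: realizesW].
Qed.

Lemma realizesZ s e y (a : R) : 0 < a -> realizes s e y -> realizes s e (a *: y).
Proof.
move=> a0; elim: s e => [|q s IH] [|b e] //= /andP[h1 /IH h2]; apply/andP; split => //.
by case: b h1 => /= h1; rewrite dotZr ?pmulr_rgt0// pmulr_rlt0.
Qed.

Lemma closed_weak s e : closed [set y | sphere R d y /\ weakly_realizes s e y].
Proof.
rewrite (_ : [set y | _] = sphere R d `&` [set y | weakly_realizes s e y])//.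
apply: closedI; first exact: closed_sphere.
elim: s e => [|q s IH] [|b e].
- by rewrite (_ : [set y | _] = setT); [exact: closedT|apply/seteqP; split].
- by rewrite (_ : [set y | _] = set0); [exact: closed0|apply/seteqP; split].
- by rewrite (_ : [set y | _] = set0); [exact: closed0|apply/seteqP; split].
rewrite (_ : [set y | _] = [set y | if b then 0 <= dot q y else dot q y <= 0] `&`
   [set y | weakly_realizes s e y]); last first.
  by apply/seteqP; split => y /=; [move=> /andP[]|move=> [h1 h2]; apply/andP].
apply: closedI => //; case: b.
  rewrite (_ : [set y | _] = dot q @^-1` [set r | 0 <= r])//.
  by apply: closed_comp; [move=> x _; exact: dot_continuous|exact: closed_ge].
rewrite (_ : [set y | _] = dot q @^-1` [set r | r <= 0])//.
by apply: closed_comp; [move=> x _; exact: dot_continuous|exact: closed_le].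
Qed.

Lemma closure_sign_cell s e : closure (sign_cell s e) `<=`
  [set y | sphere R d y /\ weakly_realizes s e y].
Proof.
have cw := @closed_weak s e; rewrite closure_id in cw; rewrite cw.
by apply: closure_subset => y [hy /realizesW].
Qed.

(** The segment from y to z meets the origin only if z = - y; otherwise its radial projection is a
    continuous arc. *)
Lemma connected_arc y z : sphere R d y -> sphere R d z -> z != - y ->
  connected ((fun t : R => normalize ((1 - t) *: y + t *: z)) @` `[0, 1]).
Proof.
move=> hy hz zy; apply: connected_continuous_connected; first exact: segment_connected.
apply: continuous_in_subspaceT => t; rewrite inE /= in_itv /= => /andP[t0 t1].
have nz : (1 - t) *: y + t *: z != 0.
  apply/eqP => /eqP; rewrite addr_eq0 => /eqP e.
  have := congr1 (@enorm R d) e; rewrite -scaleNr !enormZ hy hz !mulr1 normrN.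
  rewrite !ger0_norm ?subr_ge0// => e2.
  have t2 : t = 2^-1 by lra.
  move/eqP: zy; apply; move: e; rewrite t2 (_ : 1 - 2^-1 = 2^-1 :> R); last by field.
  by move=> /(congr1 (fun v => 2 *: v)); rewrite scalerN !scalerA divff// !scale1r => ->; rewrite opprK.
apply: (@continuous_comp _ _ _ (fun t : R => (1 - t) *: y + t *: z) (@normalize R d)).
  apply: cvgD; apply: cvgZ; try exact: cvg_cst; last exact: cvg_id.
  by apply: cvgB; [exact: cvg_cst|exact: cvg_id].
exact: normalize_continuous.
Qed.

Lemma arc_ends y z : sphere R d y -> sphere R d z ->
  let A := (fun t : R => normalize ((1 - t) *: y + t *: z)) @` `[0, 1] in A y /\ A z.
Proof.
move=> hy hz; split; [exists 0|exists 1]; rewrite /= ?in_itv /= ?lexx ?ler01//.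
  by rewrite subr0 scale1r scale0r addr0 normalize_sphere.
by rewrite subrr scale0r scale1r add0r normalize_sphere.
Qed.

Lemma connected_joined (A : set (vec R d)) :
  (forall y z, A y -> A z -> exists B : set (vec R d), [/\ B y, B z, connected B & B `<=` A]) ->
  connected A.
Proof.
move=> h; have [->|/set0P[y Ay]] := eqVneq A set0; first exact: connected0.
rewrite (_ : A = \bigcup_(B in [set B : set (vec R d) | [/\ B y, connected B & B `<=` A]]) B).
  apply: bigcup_connected; first by exists y => B [].
  by move=> B [].
apply/seteqP; split => z; last by move=> [B [_ _ BA] /BA].
by move=> Az; have [B [By Bz cB BA]] := h y z Ay Az; exists B.
Qed.

(** An intermediate point, for joining y to - y by two arcs. *)
Lemma sphere_third y : sphere R d y -> exists w, [/\ sphere R d w, w != y & w != - y].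
Proof.
move=> hy; have [w hw cw] : exists2 w, sphere R d w & forall q, q \in [:: y] -> dot q w = 0.
  by apply: orthogonal_sphere; rewrite ltnS.
have yw : dot y w = 0 by apply: cw; rewrite mem_head.
have yy : dot y y = 1 by apply/sphereE.
by exists w; split => //; apply: contra_eqN yw => /eqP ->; rewrite ?dotNr yy ?oppr_eq0 oner_eq0.
Qed.

(** Sign cells are stable under positive combinations, so the arc between two non-antipodal points
    stays inside. Antipodal points have opposite signs and share a cell only if s = [::]; then the
    cell is the whole sphere and the arcs go through a third point. *)
Lemma connected_sign_cell s e : connected (sign_cell s e).
Proof.
apply: connected_joined => y z [hy ry] [hz rz].
have arc_in u v : sphere R d u -> sphere R d v -> realizes s e u -> realizes s e v ->
    v != - u -> (fun t : R => normalize ((1 - t) *: u + t *: v)) @` `[0, 1] `<=` sign_cell s e.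
  move=> hu hv ru rv vu _ [t + <-]; rewrite /= in_itv /= => /andP[t0 t1].
  have [->|t0'] := eqVneq t 0.
    by rewrite subr0 scale1r scale0r addr0 normalize_sphere.
  have [->|t1'] := eqVneq t 1.
    by rewrite subrr scale0r scale1r add0r normalize_sphere.
  have t0'' : 0 < t by rewrite lt_neqAle eq_sym t0'.
  have t1'' : t < 1 by rewrite lt_neqAle t1'.
  have nz : (1 - t) *: u + t *: v != 0.
    apply/eqP => /eqP; rewrite addr_eq0 => /eqP E.
    have := congr1 (@enorm R d) E; rewrite -scaleNr !enormZ hu hv !mulr1 normrN.
    rewrite !ger0_norm ?subr_ge0// => e2.
    have t2 : t = 2^-1 by lra.
    move/eqP: vu; apply; move: E; rewrite t2 (_ : 1 - 2^-1 = 2^-1 :> R); last by field.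
    by move=> /(congr1 (fun v => 2 *: v)); rewrite scalerN !scalerA divff// !scale1r => ->; rewrite opprK.
  split; first exact: sphere_normalize.
  apply: realizesZ; first by rewrite invr_gt0 enorm_gt0.
  by apply: realizes_comb => //; rewrite subr_gt0.
have [zy|zy] := eqVneq z (- y); last first.
  exists ((fun t : R => normalize ((1 - t) *: y + t *: z)) @` `[0, 1]).
  have [h1 h2] := arc_ends hy hz; split => //; first exact: connected_arc.
  exact: arc_in.
have s0 : s = [::].
  case: s ry rz {arc_in} => [//|q s]; case: e => [//|b e] /= /andP[h1 _] /andP[h2 _].
  by exfalso; move: h1 h2; rewrite zy /has_sign dotNr; case: b; lra.
have e0 : e = [::] by move: ry; rewrite s0; case: (e).
have [w [hw wy wNy]] := sphere_third hy.
have rw' : realizes s e w by rewrite s0 e0.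
have zw : z != - w by rewrite zy eqr_opp eq_sym.
exists ((fun t : R => normalize ((1 - t) *: y + t *: w)) @` `[0, 1] `|`
        (fun t : R => normalize ((1 - t) *: w + t *: z)) @` `[0, 1]).
have [h1 h2] := arc_ends hy hw; have [h3 h4] := arc_ends hw hz.
split; [by left|by right| |].
  apply: connectedU; [by exists w|exact: connected_arc|exact: connected_arc].
by move=> v [] hv; [apply: arc_in hv|apply: arc_in hv].
Qed.

(** The image under [dot q] of a connected set avoiding the hyperspheres is an interval without 0,
    so signs are constant on it; conversely sign cells are connected. *)
Lemma component_sign_cell s y : off_hyperspheres [set` s] y ->
  connected_component (off_hyperspheres [set` s]) y = sign_cell s (sign_word s y).
Proof.
move=> oy; have [hy ny] := (off_hyperspheresE s y).1 oy.
apply/seteqP; split => z.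
  move=> [C [Cy Coff cC] Cz].
  have [hz nz] := (off_hyperspheresE s z).1 (Coff _ Cz).
  split => //; suff -> : sign_word s y = sign_word s z by exact: realizes_sign_word.
  apply/eq_in_map => q qs.
  have cq : connected (dot q @` C).
    by apply: connected_continuous_connected => //; apply: continuous_subspaceT; exact: dot_continuous.
  move/connected_intervalP : cq => iq.
  have n0 : ~ (dot q @` C) 0.
    move=> [v Cv qv]; have [_ /(_ q qs)] := (off_hyperspheresE s v).1 (Coff _ Cv).
    by rewrite qv eqxx.
  have := ny q qs; have := nz q qs; rewrite !neq_lt => /orP[z0|z0] /orP[y0|y0].
  - by rewrite !ltNge !ltW.
  - by exfalso; apply: n0; apply: (iq (dot q z) (dot q y)); [exists z|exists y|rewrite !ltW].
  - by exfalso; apply: n0; apply: (iq (dot q y) (dot q z)); [exists y|exists z|rewrite !ltW].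
  - by rewrite z0 y0.
move=> hz; exists (sign_cell s (sign_word s y)) => //; split.
- by split => //; exact: realizes_sign_word.
- exact: sign_cell_off.
- exact: connected_sign_cell.
Qed.

Lemma induced_cellsE s : induced_cells [set` s] =
  [set closure (sign_cell s e) | e in [set e | sign_cell s e !=set0]].
Proof.
apply/seteqP; split => K.
  move=> [y oy <-]; exists (sign_word s y); last by rewrite component_sign_cell.
  have [hy ny] := (off_hyperspheresE s y).1 oy.
  by exists y; split => //; exact: realizes_sign_word.
move=> [e [y ye] <-]; exists y; first exact: sign_cell_off ye.
by rewrite component_sign_cell; [rewrite -(sign_cell_word ye)|exact: sign_cell_off ye].
Qed.

(** At a point of an open sign cell no product vanishes, so every cell whose closure contains the
    point has the same word. Counting cells thus becomes counting realizable words. *)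
Lemma closure_sign_cell_inj s e e' : sign_cell s e !=set0 ->
  closure (sign_cell s e) = closure (sign_cell s e') -> e = e'.
Proof.
move=> [y ye] E; have : closure (sign_cell s e) y by exact: subset_closure.
rewrite E => /closure_sign_cell[_ h].
rewrite (sign_cell_word ye); apply/esym; apply: weakly_realizes_sign_word h.
by case: ye => _; exact: realizes_neq0.
Qed.

Lemma sign_cell_realizable s e : sign_cell s e !=set0 <-> realizable [::] s e.
Proof.
split => [[y [hy ry]]|[y _ ry]]; first by exists y.
have [y0|y0] := eqVneq y 0; last first.
  exists (normalize y); split; first exact: sphere_normalize.
  by apply: realizesZ => //; rewrite invr_gt0 enorm_gt0.
(* y = 0 realizes the empty word only, and then any point of the sphere will do. *)
case: s e ry => [|q s] [|b e] //=; last first.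
  by rewrite y0 /has_sign dot0r ltxx if_same.
by move=> _; have [w hw] := @sphere_neq_nil R d; exists w.
Qed.

Lemma induced_cells_count s (t : seq (set (vec R d))) : uniq t ->
  [set` t] = induced_cells [set` s] -> size t = nb_realizable [::] s.
Proof.
move=> ut tE; rewrite /nb_realizable -size_filter.
set r := [seq _ <- _ | _].
rewrite -(size_map (fun e => closure (sign_cell s e)) r).
apply: perm_size; apply: uniq_perm => //.
  rewrite map_inj_in_uniq ?filter_uniq ?bit_words_uniq// => e e'.
  rewrite mem_filter => /andP[/asboolP he _] _.
  by apply: closure_sign_cell_inj; apply/sign_cell_realizable.
move=> K; apply/idP/mapP.
  have -> : (K \in t) = `[< [set` t] K >] by rewrite asboolb.
  rewrite tE induced_cellsE => /asboolP[e he <-]; exists e => //.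
  rewrite mem_filter asboolT ?mem_bit_words/=; last exact/sign_cell_realizable.
  by have [y /sign_cell_word ->] := he; rewrite size_map.
move=> [e]; rewrite mem_filter => /andP[/asboolP he _] ->.
have : [set` t] (closure (sign_cell s e)) by rewrite tE induced_cellsE; exists e => //; apply/sign_cell_realizable.
by [].
Qed.

(** If exactly one cell K contains x, then x is interior to K, yet K lies on one side of each
    q^perp, so x is on none of them. Conversely, a closed cell containing a point x off the
    hyperspheres has the sign word of x. This expresses the absence of points of X on x^perp through
    X' alone. *)
Lemma single_induced_cell s (t : seq (hyper R d)) x :
  tessellation t -> [set` t] = induced_cells [set` s] -> (forall q, q \in s -> q != 0) ->
  sphere R d x ->
  count (fun K : hyper R d => x \in (K : set (vec R d))) t = 1%N <->
  (forall q, q \in s -> dot q x != 0).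
Proof.
move=> tt tE s0 hx.
have tcell K : K \in t -> exists2 e, sign_cell s e !=set0 & K = closure (sign_cell s e).
  move=> Kt; have : [set` t] K by [].
  by rewrite tE induced_cellsE => -[e he <-]; exists e.
split.
  move=> c1 q qs; apply/eqP => qx.
  have [K Kt Kx] := tessellation_cover tt hx.
  have KE L : L \in t -> (L : set (vec R d)) x -> L = K.
    by move=> Lt Lx; apply: (count1_unique (tessellation_uniq tt) c1) => //; exact/mem_set.
  have [_ iK] := single_cell_interior tt hx Kt Kx KE.
  have [e [y0 [_ ye]] KEq] := tcell K Kt.
  have [b hb] : exists b : bool, forall v, weakly_realizes s e v ->
      if b then 0 <= dot q v else dot q v <= 0.
    elim: s e qs ye {s0 tE tcell KEq} => [|r s IH] [|b e] //=.
    rewrite inE => /predU1P[->|qs] /andP[_ h]; first by exists b => v /andP[].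
    by have [b' hb'] := IH e qs h; exists b' => v /andP[_]; exact: hb'.
  (* [u] points to the side of q^perp that K avoids; a small step along it from x leaves K. *)
  pose u : vec R d := if b then - q else q.
  have qq : 0 < dot q q by rewrite lt_neqAle eq_sym dotxx_eq0 s0// dotxx_ge0.
  have xu (a : R) : 0 < a -> x + a *: u != 0.
    move=> a0; apply/eqP => E; have := congr1 (dot q) E.
    rewrite dotDr qx add0r dotZr dot0r /u => /eqP; rewrite mulf_eq0 gt_eqF//=.
    by case: b {hb u E}; rewrite ?dotNr ?oppr_eq0 gt_eqF.
  have cx : {for (0 : R), continuous (fun a : R => normalize (x + a *: u))}.
    apply: (@continuous_comp _ _ _ (fun a : R => x + a *: u) (@normalize R d)).
      by apply: cvgD; [exact: cvg_cst|apply: cvgZ; [exact: cvg_id|exact: cvg_cst]].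
    by apply: normalize_continuous; rewrite scale0r addr0; exact: sphere_neq0.
  have : \forall a \near (0 : R), sphere R d (normalize (x + a *: u)) -> K (normalize (x + a *: u)).
    by apply: (cx (fun y => sphere R d y -> K y)); rewrite scale0r addr0 normalize_sphere.
  move=> /nbhs_ballP[r /= r0 hr].
  have a0 : 0 < r / 2 by rewrite divr_gt0.
  have := hr (r / 2); rewrite /ball /= sub0r normrN gtr0_norm// ltr_pdivrMr// ltr_pMr// ltr1n.
  move=> /(_ isT (sphere_normalize (xu _ a0))); rewrite KEq => /closure_sign_cell[_ /hb].
  rewrite dot_normalize dotDr qx add0r dotZr mulrA.
  have c0 : 0 < (enorm (x + (r / 2) *: u))^-1 * (r / 2).
    by rewrite mulr_gt0// invr_gt0 enorm_gt0; exact: xu.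
  move: (_ * (r / 2)) c0 => E E0; rewrite /u.
  by case: (b); rewrite ?dotNr ?mulrN ?oppr_ge0 leNgt mulr_gt0.
move=> nx; pose K0 : hyper R d := closure (sign_cell s (sign_word s x)).
have xK0 : sign_cell s (sign_word s x) x by split => //; exact: realizes_sign_word.
have K0t : K0 \in t.
  have : [set` t] K0 by rewrite tE induced_cellsE; exists (sign_word s x) => //; exists x.
  by [].
rewrite (eq_in_count (a2 := pred1 K0)).
  by rewrite count_uniq_mem ?K0t//; exact: tessellation_uniq.
move=> K Kt /=; apply/idP/eqP => [/set_mem|->]; last by apply/mem_set; exact: subset_closure.
have [e he ->] := tcell K Kt => /closure_sign_cell[_ wx].
by rewrite /K0 -(weakly_realizes_sign_word nx wx).
Qed.

End induced_cells_theory.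

(** * Poisson points are in general position *)

Section grid.
Context {R : realType} {d : nat}.
Implicit Types (x y z : vec R d).

(** The cube [-1, 1]^(d+1) is cut into cells of side 1 / (m + 1), indexed in each coordinate by 0,
    ..., 2 (m + 1); the last index occurs only for the coordinate 1. *)
Definition grid_index (m : nat) := {ffun 'I_d.+1 -> 'I_(m.+1.*2).+1}.

Definition grid_of (m : nat) x : grid_index m :=
  [ffun i => inord (Num.truncn (m.+1%:R * (x i 0 + 1)))].

Definition grid_cell (m : nat) (b : grid_index m) : set (borel_vec R d) :=
  [set x : vec R d | sphere R d x /\
    forall i, (b i)%:R <= m.+1%:R * (x i 0 + 1) < (b i).+1%:R].

Lemma grid_cellP m (b : grid_index m) x : sphere R d x ->
  grid_cell b x <-> grid_of m x = b.
Proof.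
move=> hx; have bnd i : 0 <= m.+1%:R * (x i 0 + 1) /\
    (Num.truncn (m.+1%:R * (x i 0%R + 1))%R < (m.+1.*2).+1)%N.
  have := coord_le_enorm x i; rewrite hx ler_norml => /andP[h1 h2].
  have h0 : 0 <= m.+1%:R * (x i 0 + 1) by rewrite mulr_ge0//; lra.
  split=> //; rewrite ltnS -(ler_nat R); apply: le_trans (_ : m.+1%:R * (x i 0 + 1) <= _).
    by rewrite truncn_le.
  by rewrite -muln2 natrM ler_pM2l//; lra.
split => [[_ h]|<-].
  apply/ffunP => i; rewrite ffunE; apply: val_inj; rewrite /= inordK; last by case: (bnd i).
  by apply: truncn_def; exact: h.
split => // i; rewrite ffunE inordK; last by case: (bnd i).
by apply: truncn_itv; case: (bnd i).
Qed.

Lemma measurable_grid_cell m (b : grid_index m) : measurable (grid_cell b).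
Proof.
rewrite (_ : grid_cell b = (sphere R d : set (borel_vec R d)) `&` \bigcap_(i in [set: 'I_d.+1])
   ((fun x : vec R d => m.+1%:R * (x i 0 + 1)) @^-1` `[(b i)%:R, (b i).+1%:R[)); last first.
  by apply/seteqP; split => x /= [hx h]; split => // i; [move=> _|];
    rewrite ?in_itv/=; [exact: h|have := h i I; rewrite /= in_itv].
apply: measurableI; first by apply: closed_borelM; exact: closed_sphere.
apply: fin_bigcap_measurable => // i _; rewrite -[X in measurable X]setTI.
have mf : measurable_fun [set: borel_vec R d] (fun x : borel_vec R d => m.+1%:R * ((x : vec R d) i 0 + 1)).
  apply: measurable_funM; first exact: measurable_cst.
  by apply: measurable_funD; [exact: measurable_coord|exact: measurable_cst].
exact: mf.
Qed.

Lemma grid_cell_close m x y : sphere R d x -> sphere R d y -> grid_of m x = grid_of m y ->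
  forall i j, `|x i j - y i j| < m.+1%:R^-1.
Proof.
move=> hx hy e i j; rewrite (ord1 j).
have [_ /(_ i)] := (grid_cellP (grid_of m x) hx).2 erefl.
have [_ /(_ i)] := (grid_cellP (grid_of m x) hy).2 (esym e).
have c0 : 0 < m.+1%:R :> R by [].
move=> /andP[y1 y2] /andP[x1 x2]; rewrite -[ltRHS]mul1r ltr_pdivlMr// mulrC.
rewrite -{1}(gtr0_norm c0) -normrM ltr_norml.
move: y1 y2 x1 x2; rewrite -[(grid_of m x i).+1]addn1 natrD.
move: (m.+1%:R) (nat_of_ord _)%:R => c' a; rewrite mulrBr !mulrDr; lra.
Qed.

Lemma trivIset_grid m : trivIset setT (@grid_cell m).
Proof.
move=> a b _ _ [x [ax bx]]; have [hx _] := ax.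
by rewrite -((grid_cellP a hx).1 ax) -((grid_cellP b hx).1 bx).
Qed.

Lemma grid_of_eventually (x y : vec R d) : sphere R d x -> sphere R d y -> x != y ->
  exists M, forall m, (M <= m)%N -> grid_of m x != grid_of m y.
Proof.
move=> hx hy xy; have [i xyi] : exists i, x i 0 != y i 0.
  apply: contrapT => h; move/eqP: xy; apply; apply/colP => i; apply/eqP/negPn/negP => xyi.
  by apply: h; exists i.
exists (Num.truncn (`|x i 0 - y i 0|^-1)) => m Mm; apply/eqP => e.
have := grid_cell_close hx hy e i 0; apply/negP; rewrite -leNgt.
rewrite -[leRHS]invrK lef_pV2 ?posrE ?invr_gt0 ?normr_gt0 ?subr_eq0//.
apply: le_trans (ltW (truncnS_gt _)) _.
by rewrite ler_nat ltnS.
Qed.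

End grid.

Section grid_words.
Context {R : realType} {d : nat}.

Fixpoint grid_words (m k : nat) : seq (seq (grid_index (d := d) m)) :=
  if k is k'.+1 then [seq t :: b | t <- enum (grid_index m), b <- grid_words m k']
  else [:: [::]].

Lemma mem_grid_words m k b : (b \in grid_words m k) = (size b == k).
Proof.
elim: k b => [|k IH] [|t b] //=.
  by apply/negbTE/negP => /allpairsP[[? ?] []].
rewrite eqSS -IH; apply/allpairsP/idP => [[[t' b'] /= [_ ? [_ ->]]]//|hb].
by exists (t, b); rewrite mem_enum.
Qed.

(** A property of grid words, of which there are finitely many of each length: the events built from
    it are finite unions of occupancy events, measurable whatever the set of dependent tuples looks
    like. *)
Definition dependent_cells m (b : seq (grid_index m)) : Prop :=
  exists y : seq (vec R d), [/\ forall x, x \in y -> sphere R d x,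
    map (grid_of m) y = b & ~ lin_indep y].

Context (l : forall m, grid_index (d := d) m -> R).

(** Sums the products of weights over the choices of k further cells that together with c form a
    dependent word. The recursion lets one point be integrated out at a time; [dep_massE] gives the
    sum over words needed for the union bound. *)
Fixpoint dep_mass m k (c : seq (grid_index m)) : R :=
  if k is k'.+1 then \sum_(t : grid_index m) l t * dep_mass k' (t :: c)
  else (`[< dependent_cells c >])%:R.

Lemma dep_massE m k (c : seq (grid_index m)) : dep_mass k c =
  \sum_(b <- grid_words m k) (\prod_(t <- b) l t) * (`[< dependent_cells (catrev b c) >])%:R.
Proof.
elim: k c => [|k IH] c /=; first by rewrite big_seq1 big_nil mul1r.
rewrite big_allpairs_dep /= big_enum /=; apply: eq_bigr => t _.
rewrite IH big_distrr /=; apply: eq_bigr => b _.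
by rewrite big_cons mulrA.
Qed.

Lemma dep_mass_ge0 m k (c : seq (grid_index m)) : (forall t : grid_index m, 0 <= l t) -> 0 <= dep_mass k c.
Proof.
by move=> l0; elim: k c => [|k IH] c //=; apply: sumr_ge0 => t _; rewrite mulr_ge0.
Qed.

Lemma dep_mass_le m k (c : seq (grid_index m)) : (forall t : grid_index m, 0 <= l t) ->
  dep_mass k c <= (\sum_(t : grid_index m) l t) ^+ k.
Proof.
move=> l0; elim: k c => [|k IH] c /=; first by rewrite expr0; case: asboolP.
rewrite exprS big_distrl /=; apply: ler_sum => t _.
by rewrite ler_wpM2l.
Qed.

End grid_words.

Section null_events.
Context {R : realType} {dT : measure_display} {T : measurableType dT}.
Local Open Scope ereal_scope.

Lemma measure_seq_union (m : {measure set T -> \bar R}) (I : eqType) (r : seq I)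
    (F : I -> set T) : (forall i, i \in r -> measurable (F i)) ->
  measurable [set x | exists2 i, i \in r & F i x] /\
  m [set x | exists2 i, i \in r & F i x] <= \sum_(i <- r) m (F i).
Proof.
elim: r => [|i r IH] h.
  rewrite big_nil (_ : [set x | _] = set0); first by rewrite measure0.
  by rewrite -subset0 => x [].
have m1 := h i (mem_head _ _).
have [m2 z2] := IH (fun j jr => h j (@mem_behead _ (i :: r) _ jr)).
rewrite (_ : [set x | _] = F i `|` [set x | exists2 i, i \in r & F i x]); last first.
  apply/seteqP; split => x /=.
    by move=> [j]; rewrite inE => /predU1P[->|jr] Fx; [left|right; exists j].
  by move=> [Fx|[j jr Fx]]; [exists i; rewrite ?mem_head|exists j; rewrite // inE jr orbT].
split; first exact: measurableU.
rewrite big_cons; apply: le_trans (measureU2 _ m1 m2) _.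
by rewrite leeD2l.
Qed.

(* The grids are not nested, so neither are the events [E n]. *)
Lemma null_liminf (m : {measure set T -> \bar R}) (E : nat -> set T) (u : nat -> R) :
  (forall n, measurable (E n)) -> (forall n, m (E n) <= (u n)%:E) ->
  u n @[n --> \oo] --> (0 : R)%R ->
  m.-negligible [set x | exists M, forall n, (M <= n)%N -> E n x].
Proof.
move=> mE mu u0.
rewrite (_ : [set x | _] = \bigcup_M \bigcap_(n in [set n | (M <= n)%N]) E n); last first.
  apply/seteqP; split => x; first by move=> [M hM]; exists M.
  by move=> [M _ hM]; exists M.
apply: negligible_bigcup => M.
have mF : measurable (\bigcap_(n in [set n | (M <= n)%N]) E n).
  rewrite -[X in measurable X]setCK setC_bigcap; apply: measurableC.
  by apply: bigcup_measurable => n _; apply: measurableC.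
apply/negligibleP => //; apply/eqP; rewrite eq_le measure_ge0 andbT.
apply/lee_addgt0Pr => e e0; rewrite add0e.
move/cvgrPdist_lt : u0 => /(_ e e0)[N _ hN].
have := hN (maxn M N) (leq_maxr _ _); rewrite sub0r normrN => h.
apply: le_trans (_ : (u (maxn M N))%:E <= _); last first.
  by rewrite lee_fin (le_trans (ler_norm _))// ltW.
apply: le_trans (mu (maxn M N)); apply: le_measure; rewrite ?inE//.
by move=> x; apply; rewrite /= leq_maxl.
Qed.

End null_events.

Section dominated_null.
Context {R : realType} {dT : measure_display} {T : measurableType dT}.
Context (mu : {measure set T -> \bar R}).

Lemma cvg_integral_null (N : set T) (C : R) (f : nat -> T -> R) :
  (mu setT < +oo)%E -> measurable N -> mu N = 0%E ->
  (forall m, measurable_fun setT (f m)) -> (forall m x, 0 <= f m x <= C) ->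
  (forall x, ~ N x -> f m x @[m --> \oo] --> 0) ->
  fine (\int[mu]_x (f m x)%:E)%E @[m --> \oo] --> 0.
Proof.
move=> muT mN N0 mf fC f0.
suff : (\int[mu]_x (f m x)%:E)%E @[m --> \oo] --> (\int[mu]_x (cst 0 x))%E.
  by rewrite integral_cst// mul0e => /fine_cvg.
have [] // := @dominated_convergence _ T R mu setT measurableT
   (fun m x => (f m x)%:E) (cst 0%E) (cst C%:E).
- by move=> m; exact/measurable_EFinP.
- exists N; split => // x /= h; apply: contrapT => nx; apply: h => _.
  by apply: cvg_EFin; [exact: nearW|exact: f0].
- apply/integrableP; split; first exact: measurable_cst.
  by rewrite integral_cst//= lte_mul_pinfty.
- apply: aeW => x m _ /=; rewrite lee_fin.
  by have /andP[h1 h2] := fC m x; rewrite ger0_norm.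
Qed.

End dominated_null.

Lemma not_uniq_count (T : eqType) (s : seq T) : ~~ uniq s ->
  exists2 x, x \in s & (1 < count_mem x s)%N.
Proof.
elim: s => [//|x s IH] /=; rewrite negb_and negbK => /orP[xs|/IH[y ys y2]].
  by exists x; rewrite ?mem_head// eqxx ltnS -has_count has_pred1.
by exists y; rewrite ?inE ?ys ?orbT// (leq_trans y2)// leq_addl.
Qed.

(** * Occupied grid cells of a Poisson process *)

Section poisson_grid.
Context {R : realType} {d : nat} {dO : measure_display}.
Context {Omega : measurableType dO} (P : probability Omega R).
Context (X : R.-ker Omega ~> borel_vec R d).
Hypothesis hX : poisson_process P X (sphere R d).
Local Notation Lam := (intensity_measure P X).
Hypothesis Lam_fin : (Lam (sphere R d) < +oo)%E.

Lemma measurable_sphere : measurable (sphere R d : set (borel_vec R d)).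
Proof. by apply: closed_borelM; exact: closed_sphere. Qed.

Lemma measurable_point (x : vec R d) : measurable ([set x] : set (borel_vec R d)).
Proof.
apply: closed_borelM; apply: accessible_closed_set1.
by apply: hausdorff_accessible; exact: norm_hausdorff.
Qed.

Lemma poisson_counting w : exists2 s : seq (borel_vec R d),
  (forall x, x \in s -> sphere R d x) & is_counting s (X w).
Proof. by have [h _ _] := hX; exact: h. Qed.

Lemma poisson_offsphere A : measurable A -> Lam A = Lam (A `&` sphere R d).
Proof.
move=> mA; apply: eq_integral => w _; have [s hs cs] := poisson_counting w.
rewrite !cs//; last exact: measurableI measurable_sphere.
rewrite [LHS]big_seq_cond [RHS]big_seq_cond; apply: eq_bigr => x /andP[xs _].
rewrite !diracE; congr (_%:R%:E); congr nat_of_bool; apply/idP/idP => /set_mem h; apply/mem_set.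
  by split => //; exact: hs.
by case: h.
Qed.

Lemma poisson_setT : Lam setT = Lam (sphere R d).
Proof. by rewrite poisson_offsphere// setTI. Qed.

Lemma poisson_setT_lty : (Lam setT < +oo)%E.
Proof. by rewrite poisson_setT. Qed.

Lemma poisson_le A : measurable A -> (Lam A <= Lam (sphere R d))%E.
Proof.
move=> mA; rewrite -poisson_setT; apply: le_measure; rewrite ?inE//.
Qed.

Lemma poisson_fin_num A : measurable A -> Lam A \is a fin_num.
Proof. by move=> mA; rewrite ge0_fin_numE//; exact: le_lt_trans (poisson_le mA) Lam_fin. Qed.

Lemma measurable_at_least A (n : R) : measurable A ->
  measurable [set w | (n%:E <= X w A)%E].
Proof.
move=> mA; rewrite -[X in measurable X]setTI.
by apply: emeasurable_fun_c_infty => //; exact: measurable_kernel.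
Qed.

(** Markov's inequality for the number of points in A. *)
Lemma poisson_hit_le A : measurable A -> (P [set w | (1%:E <= X w A)%E] <= Lam A)%E.
Proof.
move=> mA; have mE := @measurable_at_least A 1 mA.
have := integral_indic P measurableT mE; rewrite setIT => <-.
apply: ge0_le_integral_nomeas => w; first by rewrite lee_fin.
rewrite indicE; have [/set_mem//|_] := boolP (w \in _).
by rewrite measure_ge0.
Qed.

Lemma poisson_pmf A k : measurable A ->
  P [set w | X w A = k%:R%:E] =
  (expR (- fine (Lam A)) * fine (Lam A) ^+ k / k`!%:R)%:E.
Proof.
by move=> mA; have [_ h _] := hX; apply: h => //; exact: le_lt_trans (poisson_le mA) Lam_fin.
Qed.

Lemma poisson_nat w A : measurable A -> exists n : nat, X w A = n%:R%:E.
Proof.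
move=> mA; have [s _ cs] := poisson_counting w.
by exists (count (fun x => x \in A) s); rewrite cs// sum_dirac_count.
Qed.

Lemma measurable_exactly A (y : \bar R) : measurable A -> measurable [set w | X w A = y].
Proof.
move=> mA; rewrite -[X in measurable X]setTI.
have /(_ measurableT [set y] (emeasurable_set1 y)) := measurable_kernel X A mA.
by [].
Qed.

(** The probability is 1 - e^(-t) (1 + t), and e^(-t) >= 1 - t bounds it by 1 - (1 - t) (1 + t) =
    t^2. *)
Lemma poisson_multiple_le A : measurable A ->
  (P [set w | (2%:E <= X w A)%E] <= (fine (Lam A) ^+ 2)%:E)%E.
Proof.
move=> mA; set t := fine _.
pose E k := [set w | X w A = k%:R%:E].
have mE k : measurable (E k) by exact: measurable_exactly.
have PE k : P (E k) = (expR (- t) * t ^+ k / k`!%:R)%:E by exact: poisson_pmf.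
rewrite (_ : [set w | _] = ~` (E 0%N `|` E 1%N)); last first.
  apply/seteqP; split => w; rewrite /E /=; have [n ->] := poisson_nat w mA.
    by rewrite lee_fin (ler_nat R 2) => n2 [][] /eqP; rewrite eqr_nat => /eqP n0; rewrite n0 in n2.
  move=> h; rewrite lee_fin (ler_nat R 2); case: n h => [|[|n]]//; first by case; left.
  by case; right.
rewrite probability_setC; last exact: measurableU.
have dE : E 0%N `&` E 1%N = set0.
  by rewrite -subset0 => w; rewrite /E /= => -[->] /eqP; rewrite eqe eqr_nat.
have -> : P (E 0%N `|` E 1%N) = (expR (- t) + expR (- t) * t)%:E.
  transitivity (P (E 0%N) + P (E 1%N))%E; first exact: measureU.
  by rewrite !PE expr0 expr1 !divr1 mulr1.
rewrite -EFinB lee_fin.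
have t0 : 0 <= t by apply: fine_ge0.
have := expR_ge1Dx (- t); move: (expR (- t)) => u; nra.
Qed.

(** Distinct grid cells are disjoint, so their numbers of points are independent, and each factor is
    bounded by [poisson_hit_le]. *)
Lemma poisson_hit_all m (b : seq (grid_index (d := d) m)) : uniq b ->
  measurable [set w | forall t, t \in b -> (1%:E <= X w (grid_cell t))%E] /\
  (P [set w | forall t, t \in b -> (1%:E <= X w (grid_cell t))%E] <=
   (\prod_(t <- b) fine (Lam (grid_cell t)))%:E)%E.
Proof.
move=> ub; have [_ _ hI] := hX.
pose B (i : 'I_(size b)) : set (borel_vec R d) := grid_cell (tnth (in_tuple b) i).
have mB i : measurable (B i) by exact: measurable_grid_cell.
have tB : trivIset setT B.
  move=> i j _ _ h; have e := trivIset_grid I I h.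
  by move: ub => /uniqP-/(_ (tnth (in_tuple b) i)) inj; apply: val_inj; apply: inj; rewrite ?inE ?ltn_ord// -!(tnth_nth _ (in_tuple b)).
have -> : [set w | forall t, t \in b -> (1%:E <= X w (grid_cell t))%E] =
    \bigcap_i ((fun w => X w (B i)) @^-1` [set y | (1%:E <= y)%E]).
  apply/seteqP; split => w /= h; first by move=> i _; apply: h; exact: mem_tnth.
  by move=> t tb; have [i ->] := tnthP (in_tuple b) t tb; exact: (h i I).
split.
  by apply: fin_bigcap_measurable => // i _; exact: measurable_at_least.
rewrite (hI _ _ mB tB) => [|_]; last first.
  by rewrite -(set_itvcy 1%:E)%E; exact: emeasurable_itv.
rewrite big_tnth (eq_bigr (fun i => (fine (P ((fun w => X w (B i)) @^-1` [set y | (1%:E <= y)%E])))%:E)).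
  rewrite prodEFin lee_fin; apply: ler_prod => i _; rewrite fine_ge0//= fine_le ?poisson_fin_num//.
    by apply: fin_num_measure; exact: measurable_at_least.
    exact: measurable_grid_cell.
  by apply: poisson_hit_le; exact: measurable_grid_cell.
by move=> i _; rewrite fineK//; apply: fin_num_measure; exact: measurable_at_least.
Qed.

Definition grid_mass m (t : grid_index (d := d) m) : R := fine (Lam (grid_cell t)).

Lemma grid_mass_ge0 m (t : grid_index m) : 0 <= grid_mass t.
Proof. exact: fine_ge0. Qed.

(** Writes a sum over cells weighted by their masses as an integral against the intensity, to which
    dominated convergence applies as the grid is refined. *)
Definition grid_lift m (g : grid_index (d := d) m -> R) (x : borel_vec R d) : R :=
  \sum_t g t * \1_(grid_cell t) x.

Lemma grid_liftE m (g : grid_index m -> R) x : sphere R d x -> grid_lift g x = g (grid_of m x).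
Proof.
move=> hx; rewrite /grid_lift (bigD1 (grid_of m x))//= big1 ?addr0.
  by rewrite indicE mem_set ?mulr1//; exact/(grid_cellP _ hx).
move=> t tx; rewrite indicE memNset ?mulr0// => /(grid_cellP _ hx) e.
by rewrite e eqxx in tx.
Qed.

Lemma grid_lift_off m (g : grid_index m -> R) x : ~ sphere R d x -> grid_lift g x = 0.
Proof.
by move=> hx; rewrite /grid_lift big1// => t _; rewrite indicE memNset ?mulr0// => -[].
Qed.

Lemma measurable_grid_lift m (g : grid_index m -> R) : measurable_fun setT (grid_lift g).
Proof.
apply: measurable_sum => t; apply: measurable_funM; first exact: measurable_cst.
by apply: measurable_indic; exact: measurable_grid_cell.
Qed.

Lemma integral_grid_lift m (g : grid_index m -> R) : (forall t, 0 <= g t) ->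
  (\int[Lam]_x (grid_lift g x)%:E)%E = (\sum_t grid_mass t * g t)%:E.
Proof.
move=> g0; under eq_integral do rewrite /grid_lift -sumEFin.
rewrite ge0_integral_sum//; last first.
- by move=> t x _; rewrite lee_fin mulr_ge0.
- move=> t; apply/measurable_EFinP; apply: measurable_funM; first exact: measurable_cst.
  by apply: measurable_indic; exact: measurable_grid_cell.
rewrite -sumEFin; apply: eq_bigr => t _; under eq_integral do rewrite EFinM.
rewrite ge0_integralZl ?lee_fin//; last first.
  by apply/measurable_EFinP; apply: measurable_indic; exact: measurable_grid_cell.
rewrite integral_indic// ?setIT; last exact: measurable_grid_cell.
by rewrite muleC EFinM fineK// poisson_fin_num//; exact: measurable_grid_cell.
Qed.

Lemma grid_mass_sum m : \sum_(t : grid_index m) grid_mass t = fine (Lam (sphere R d)).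
Proof.
have := @integral_grid_lift m (fun _ => 1) (fun _ => ler01).
under [in X in _ = X]eq_bigr do rewrite mulr1.
move=> /(congr1 fine) /= <-; congr fine.
rewrite -[sphere R d]setIT -integral_indic//; last exact: measurable_sphere.
apply: eq_integral => x _; congr (_%:E); rewrite indicE.
by have [/set_mem hx|/negP hx] := boolP (x \in _); [rewrite grid_liftE|rewrite grid_lift_off// => h; apply: hx; exact: mem_set].
Qed.

Lemma measurable_great_hypersphere (w : vec R d) :
  measurable (great_hypersphere w : set (borel_vec R d)).
Proof.
apply: closed_borelM; rewrite (_ : great_hypersphere w = sphere R d `&` (dot w @^-1` [set 0])).
  by apply: closedI; [exact: closed_sphere|
    apply: closed_comp => [x _|]; [exact: dot_continuous|exact: closed_eq]].
by apply/seteqP; split => x.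
Qed.

Hypothesis Lam_hyp : forall w, sphere R d w -> Lam (great_hypersphere w) = 0%E.

(* Integrating out one more point [x]: almost every [x] is independent of [y],
   since the others lie on one hypersphere. *)
Lemma dep_mass_cvg k (y : seq (vec R d)) : (forall x, x \in y -> sphere R d x) ->
  lin_indep y -> (size y + k <= d.+1)%N ->
  dep_mass (@grid_mass) k (map (grid_of m) y) @[m --> \oo] --> (0 : R).
Proof.
elim: k y => [|k IH] y hy iy yk.
  (* No point is left to integrate: on a fine grid all representatives of the cells of y are so
     close to y that they are independent, and the mass is 0. *)
  have [e e0 he] := lin_indep_open iy.
  apply: cvg_near_cst; exists (Num.truncn e^-1) => // m /= Nm.
  have me : m.+1%:R^-1 < e.
    rewrite -[ltRHS]invrK ltf_pV2 ?posrE ?invr_gt0//.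
    by apply: lt_le_trans (truncnS_gt _) _; rewrite ler_nat ltnS.
  case: asboolP => // -[y' [hy' yy']]; case.
  have sy : size y' = size y by rewrite -(size_map (grid_of m)) yy' size_map.
  apply: he => // i j iy'; apply: lt_trans me; apply: grid_cell_close.
  - by apply: hy; exact: mem_nth.
  - by apply: hy'; rewrite mem_nth// sy.
  - by rewrite -!(nth_map (0 : vec R d) (grid_of m (0 : vec R d)) (grid_of m)) ?sy// yy'.
have [w hw yw] : exists2 w, sphere R d w & forall x, ~ lin_indep (x :: y) -> dot w x = 0.
  by apply: lin_dep_hyperplane => //; apply: leq_trans yk; rewrite addnS ltnS leq_addr.
pose g m (t : grid_index m) := dep_mass (@grid_mass) k (t :: map (grid_of m) y).
have g0 m (t : grid_index m) : 0 <= g m t by apply: dep_mass_ge0 => ?; exact: grid_mass_ge0.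
rewrite (_ : (fun m => _) = fun m => fine (\int[Lam]_x (grid_lift (@g m) x)%:E)%E); last first.
  by apply/funext => m; rewrite integral_grid_lift.
(* The constant majorant, the k-th power of the total mass, comes from [dep_mass_le]. *)
apply: (@cvg_integral_null _ _ _ Lam (great_hypersphere w) (fine (Lam (sphere R d)) ^+ k)).
- exact: poisson_setT_lty.
- exact: measurable_great_hypersphere.
- exact: Lam_hyp.
- by move=> m; exact: measurable_grid_lift.
- move=> m x; have [hx|hx] := pselect (sphere R d x).
    rewrite grid_liftE// g0 /= -(grid_mass_sum m); apply: dep_mass_le => t.
    exact: grid_mass_ge0.
  by rewrite grid_lift_off// lexx exprn_ge0// fine_ge0.
- move=> x nx; have [hx|hx] := pselect (sphere R d x); last first.
    by apply: cvg_near_cst; apply: nearW => m; rewrite grid_lift_off.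
  rewrite (_ : (fun m => _) = fun m => dep_mass (@grid_mass) k (map (grid_of m) (x :: y))).
    apply: IH; first by move=> z; rewrite inE => /predU1P[->//|]; exact: hy.
      by apply: contrapT => /yw wx; apply: nx.
    by rewrite /= addSnnS.
  by apply/funext => m; rewrite grid_liftE.
Qed.

(** The cells are distinct for the sake of the independence in [poisson_hit_all]; the reversal
    matches [dep_mass], which adds cells at the front. *)
Definition dependent_hits m k := [set w | exists2 b, b \in grid_words m k &
  [/\ uniq b, dependent_cells (R := R) (rev b) &
     forall t, t \in b -> (1%:E <= X w (grid_cell t))%E]].

Lemma dependent_hits_le m k : measurable (dependent_hits m k) /\
  (P (dependent_hits m k) <= (dep_mass (@grid_mass) k ([::] : seq (grid_index m)))%:E)%E.
Proof.
pose F (b : seq (grid_index m)) : set Omega := if uniq b && `[< dependent_cells (R := R) (rev b) >] then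
  [set w | forall t, t \in b -> (1%:E <= X w (grid_cell t))%E] else set0.
have FE : dependent_hits m k = [set w | exists2 b, b \in grid_words m k & F b w].
  apply/seteqP; split => w [b bk]; rewrite /F.
    by move=> [ub /asboolP db h]; exists b => //; rewrite ub db.
  by case: ifP => // /andP[ub /asboolP db] h; exists b.
have mF b : b \in grid_words m k -> measurable (F b).
  by rewrite /F; case: ifP => // /andP[ub _] _; have [] := poisson_hit_all ub.
rewrite FE; have [mU le] := measure_seq_union P mF; split => //.
apply: le_trans le _; rewrite dep_massE -sumEFin; apply: lee_sum => b _; rewrite /F.
case: ifPn => [/andP[ub db]|_].
  by rewrite [catrev b [::]]/(rev b) db mulr1; have [] := poisson_hit_all ub.
by rewrite measure0 lee_fin mulr_ge0// prodr_ge0// => t _; exact: grid_mass_ge0.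
Qed.

Lemma dependent_hits_null k : (k <= d.+1)%N ->
  P.-negligible [set w | exists M, forall m, (M <= m)%N -> dependent_hits m k w].
Proof.
move=> kd; apply: (@null_liminf _ _ _ _ (dependent_hits ^~ k)
  (fun m => dep_mass (@grid_mass) k ([::] : seq (grid_index m)))).
- by move=> m; have [] := dependent_hits_le m k.
- by move=> m; have [] := dependent_hits_le m k.
- by apply: (@dep_mass_cvg k [::]) => //; exact: lin_indep_nil.
Qed.

(** Some great hypersphere passes through x. *)
Lemma poisson_no_atom x : (0 < d)%N -> sphere R d x -> Lam [set x] = 0%E.
Proof.
move=> d0 hx; have [w hw xw] := @orthogonal_sphere R d [:: x] d0.
apply/eqP; rewrite eq_le measure_ge0 andbT -(Lam_hyp hw).
apply: le_measure; rewrite ?inE; [|exact: measurable_great_hypersphere|].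
  exact: measurable_point.
by move=> _ ->; split => //; rewrite dotC xw ?mem_head.
Qed.

Definition double_hits m := [set w | exists2 t, t \in enum (grid_index (d := d) m) &
  (2%:E <= X w (grid_cell t))%E].

(** The probability that some cell has two points is at most the sum of the squared masses, that is,
    the integral over x of the mass of the cell of x. The cells shrink to the null set {x}, and
    dominated convergence is used twice: for this mass at fixed x and for its integral. *)
Lemma double_hits_null : (0 < d)%N ->
  P.-negligible [set w | exists M, forall m, (M <= m)%N -> double_hits m w].
Proof.
move=> d0; apply: (@null_liminf _ _ _ _ double_hits
  (fun m => \sum_(t : grid_index m) grid_mass t * grid_mass t)).
- move=> m; have [] // := @measure_seq_union _ _ _ P _ (enum (grid_index m))
    (fun t => [set w | (2%:E <= X w (grid_cell t))%E]).
  by move=> t _; apply: measurable_at_least; exact: measurable_grid_cell.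
- move=> m; have [|_ le] := @measure_seq_union _ _ _ P _ (enum (grid_index m))
    (fun t => [set w | (2%:E <= X w (grid_cell t))%E]).
    by move=> t _; apply: measurable_at_least; exact: measurable_grid_cell.
  apply: le_trans le _; rewrite big_enum -sumEFin; apply: lee_sum => t _.
  by rewrite -expr2; apply: poisson_multiple_le; exact: measurable_grid_cell.
rewrite (_ : (fun m => _) = fun m => fine (\int[Lam]_x (grid_lift (@grid_mass m) x)%:E)%E); last first.
  by apply/funext => m; rewrite integral_grid_lift// => t; exact: grid_mass_ge0.
have L1 m t : grid_mass (t : grid_index m) <= fine (Lam (sphere R d)).
  by rewrite fine_le ?poisson_fin_num ?poisson_le//; do ?[exact: measurable_grid_cell|exact: measurable_sphere].
apply: (@cvg_integral_null _ _ _ Lam set0 (fine (Lam (sphere R d)))) => //.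
- exact: poisson_setT_lty.
- by move=> m; exact: measurable_grid_lift.
- move=> m x; have [hx|hx] := pselect (sphere R d x).
    by rewrite grid_liftE// grid_mass_ge0 L1.
  by rewrite grid_lift_off// lexx fine_ge0.
move=> x _; have [hx|hx] := pselect (sphere R d x); last first.
  by apply: cvg_near_cst; apply: nearW => m; rewrite grid_lift_off.
rewrite (_ : (fun m => _) = fun m => fine (\int[Lam]_y (\1_(grid_cell (grid_of m x)) y)%:E)%E); last first.
  apply/funext => m; rewrite grid_liftE// integral_indic ?setIT//; exact: measurable_grid_cell.
apply: (@cvg_integral_null _ _ _ Lam [set x] 1) => //.
- exact: poisson_setT_lty.
- exact: measurable_point.
- exact: poisson_no_atom.
- by move=> m; apply: measurable_indic; exact: measurable_grid_cell.
- by move=> m y; rewrite indicE; case: (_ \in _); rewrite ?lexx ler01.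
move=> y yx; have [hy|hy] := pselect (sphere R d y); last first.
  by apply: cvg_near_cst; apply: nearW => m; rewrite indicE memNset// => -[].
have [M hM] : exists M, forall m, (M <= m)%N -> grid_of m x != grid_of m y.
  by apply: grid_of_eventually => //; apply/eqP => e; apply: yx.
apply: cvg_near_cst; exists M => // m /= /hM; rewrite indicE => ne.
by rewrite memNset// => /(grid_cellP _ hy) e; rewrite e eqxx in ne.
Qed.

Lemma grid_ids_uniq (s : seq (vec R d)) : uniq s -> (forall x, x \in s -> sphere R d x) ->
  exists M, forall m, (M <= m)%N -> uniq (map (grid_of m) s).
Proof.
elim: s => [|x s IH] /=; first by exists 0%N.
move=> /andP[xs us] hs; have [M hM] := IH us (fun y ys => hs y (@mem_behead _ (x :: s) y ys)).
have [M' hM'] : exists M', forall m, (M' <= m)%N -> grid_of m x \notin map (grid_of m) s.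
  have : forall y, y \in s -> \forall m \near \oo, grid_of m x != grid_of m y.
    move=> y ys; have xy : x != y by apply: contraNneq xs => ->.
    have hy : sphere R d y by apply: hs; rewrite inE ys orbT.
    by have [N hN] := grid_of_eventually (hs x (mem_head _ _)) hy xy; exists N.
  move=> H; have : \forall m \near \oo, forall y, y \in s -> grid_of m x != grid_of m y.
    elim: s {IH xs us hs hM} H => [|y s IHs] H; first exact: nearW.
    have := H y (mem_head _ _); have := IHs (fun z zs => H z (@mem_behead _ (y :: s) z zs)).
    apply: filterS2 => m h1 h2 z; rewrite inE => /predU1P[->//|]; exact: h1.
  move=> [N _ hN]; exists N => m Nm; apply/mapP => -[y ys e].
  by have := hN m Nm y ys; rewrite e eqxx.
exists (maxn M M') => m; rewrite geq_max => /andP[h1 h2].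
by rewrite hM' // hM.
Qed.

(** A repeated point gives a doubly occupied cell on every grid, and a dependent tuple of distinct
    points gives a dependent word of distinct occupied cells on all sufficiently fine grids; both
    have probability 0. *)
Lemma poisson_simple_general : (0 < d)%N -> exists2 N, P.-negligible N &
  forall w, ~ N w -> exists2 s : seq (borel_vec R d),
    (forall x, x \in s -> sphere R d x) & [/\ is_counting s (X w), uniq s & general_position s].
Proof.
move=> d0; pose D k := [set w | exists M, forall m, (M <= m)%N -> dependent_hits m k w].
pose D2 := [set w | exists M, forall m, (M <= m)%N -> double_hits m w].
exists ((\bigcup_(k in [set k | (k <= d.+1)%N]) D k) `|` D2).
  apply: negligibleU; last exact: double_hits_null.
  rewrite (_ : \bigcup_(k in _) _ = \bigcup_k (if (k <= d.+1)%N then D k else set0)); last first.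
    apply/seteqP; split => w; first by move=> [k /= kd h]; exists k => //; rewrite kd.
    by move=> [k _]; case: ifP => // kd h; exists k.
  apply: negligible_bigcup => k; case: ifP => kd; last exact: negligible_set0.
  exact: dependent_hits_null.
move=> w nw; have [s hs cs] := poisson_counting w; exists s => //; split => //.
  apply: contrapT => /negP us; apply: nw; right; exists 0%N => m _.
  have [x xs x2] := not_uniq_count us.
  exists (grid_of m x); first by rewrite mem_enum.
  rewrite cs ?sum_dirac_count; last exact: measurable_grid_cell.
  rewrite lee_fin (ler_nat R 2) (leq_trans x2)//; apply: sub_count => y /eqP ->.
  by apply/mem_set/(grid_cellP _ (hs x xs)).
move=> l ul ls sl; apply: contrapT => nl; apply: nw; left; exists (size l) => //.
have hl x : x \in l -> sphere R d x by move=> /ls; exact: hs.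
have [M hM] := grid_ids_uniq ul hl; exists M => m /hM ui.
exists (rev (map (grid_of m) l)); first by rewrite mem_grid_words size_rev size_map.
rewrite rev_uniq revK; split => //; first by exists l.
move=> t; rewrite mem_rev => /mapP[x xl ->].
rewrite cs ?sum_dirac_count; last exact: measurable_grid_cell.
rewrite lee_fin (ler_nat R 1) -has_count; apply/hasP; exists x; first exact: ls.
by apply/mem_set/(grid_cellP _ (hl x xl)).
Qed.

End poisson_grid.

(** * Mean number of cells *)

Section chamber_numbers.

(** Schlaefli's formula: Pascal's rule turns the right-hand side into the recursion of
    [nb_chambers]. *)
Lemma nb_chambers_binom n j : nb_chambers n.+1 j = (2 * \sum_(i < j) 'C(n, i))%N.
Proof.
elim: n j => [|n IH] [|j]; rewrite ?big_ord0//.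
  by rewrite big_ord_recl /= big1 ?addn0// => i _; rewrite bin0n.
have -> : nb_chambers n.+2 j.+1 = (nb_chambers n.+1 j.+1 + nb_chambers n.+1 j)%N by [].
rewrite !IH -mulnDr; congr (_ * _)%N.
rewrite [X in (X + _)%N]big_ord_recl [RHS]big_ord_recl !bin0 -addnA; congr (_ + _)%N.
by rewrite -big_split; apply: eq_bigr => i _; rewrite /= /bump binS.
Qed.

(** Pascal's rule merges the terms of the left sum in pairs of neighbours, whence the induction on d
    in steps of two. *)
Lemma sum_bin_half n d :
  (\sum_(i < d.+1) 'C(n, i) = \sum_(i < (d./2).+1) 'C(n.+1, d - i.*2))%N.
Proof.
have [k] := ubnP d; elim: k d => // k IH [|[|d]] dk.
- by rewrite !big_ord1 !bin0.
- by rewrite big_ord_recl !big_ord1 /= subn0 bin0 !bin1.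
rewrite big_ord_recr big_ord_recr /= IH; last by move: dk; rewrite !ltnS => /ltnW.
rewrite [RHS]big_ord_recl double0 subn0 binS addnC addnAC -addnA addnC; congr addn.
Qed.

Context {R : realType}.

(** For n = 0 there is one cell, while twice the binomial sum is 2 for even d and 0 for odd d. The
    sign (-1)^(d+1) repairs this and becomes the term (-1)^(d+1) e^(-t) of [h_fun]. *)
Lemma nb_chambersE n d : (nb_chambers n d.+1)%:R =
  2 * (\sum_(i < (d./2).+1) ('C(n, d - i.*2))%:R) + (n == 0%N)%:R * (-1) ^+ d.+1 :> R.
Proof.
case: n => [|n].
  rewrite mul1r -natr_sum -signr_odd /=.
  (* For n = 0 only a term with d - 2 i = 0 survives; it exists for even d, at the last index. *)
  rewrite (bigD1 ord_max) //= big1 => [|i ni].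
    rewrite -[X in (X - _)%N](odd_double_half d) addnK bin0n addn0.
    by case: (odd d) => /=; rewrite ?expr1 ?expr0; lra.
  rewrite bin_small// subn_gt0.
  have : (i < d./2)%N by rewrite ltn_neqAle -ltnS ltn_ord andbT; apply: contra ni => /eqP e; exact/eqP/val_inj.
  by lia.
by rewrite mul0r addr0 nb_chambers_binom sum_bin_half natrM natr_sum.
Qed.

(** Binomial moments of the Poisson law, up to the factor e^(-t): the terms with n < k vanish, and
    C(n, k) / n! = 1 / (k! (n - k)!) leaves a shifted exponential series. *)
Lemma cvg_series_binomial (t : R) k :
  series (fun n => 'C(n, k)%:R * (t ^+ n / n`!%:R)) @ \oo --> t ^+ k / k`!%:R * expR t.
Proof.
rewrite -(cvg_shiftn k) (_ : [sequence _]_n = fun n => t ^+ k / k`!%:R * series (exp_coeff t) n).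
  by apply: cvgMr; exact: is_cvg_series_exp_coeff.
apply/funext => n; rewrite /series /= (@big_cat_nat _ _ _ k) ?leq_addl//=.
rewrite big_nat_cond big1 ?add0r; last first.
  by move=> i /andP[/andP[_ ik] _]; rewrite bin_small// mul0r.
rewrite -{1}[k]add0n big_addn addnK big_distrr /=; apply: eq_bigr => i _.
rewrite /exp_coeff /= exprD.
have e : ('C(i + k, k) * (k`! * i`!))%:R = (i + k)`!%:R :> R.
  by rewrite -{2}(addnK k i) bin_fact// leq_addl.
have n0 m : m`!%:R != 0 :> R by rewrite pnatr_eq0 -lt0n fact_gt0.
have b0 : 'C(i + k, k)%:R != 0 :> R by rewrite pnatr_eq0 -lt0n bin_gt0 leq_addl.
rewrite -e !natrM; field.
by rewrite !n0 b0.
Qed.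

Lemma poisson_mean_chambers d (t : R) : 0 <= t ->
  (\sum_(n <oo) ((nb_chambers n d.+1)%:R * (expR (- t) * t ^+ n / n`!%:R))%:E =
   (h_fun d t)%:E)%E.
Proof.
move=> t0; set f := fun n : nat => (nb_chambers n d.+1)%:R * (expR (- t) * t ^+ n / n`!%:R) : R.
have fE : series f @ \oo --> h_fun d t.
  pose g k n := 'C(n, k)%:R * (t ^+ n / n`!%:R) : R.
  have -> : h_fun d t = 2 * expR (- t) *
      (\sum_(i < (d./2).+1) t ^+ (d - i.*2) / (d - i.*2)`!%:R * expR t) +
      (-1) ^+ d.+1 * expR (- t).
    have e1 : expR (- t) * expR t = 1 by rewrite -expRD addNr expR0.
    rewrite /h_fun -big_distrl /=; move: (\sum_(i < _) _) => S.
    by rewrite [S * _]mulrC -mulrA (mulrA (expR (- t))) e1 mul1r addrC.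
  (* After a shift by one every partial sum contains n = 0, which carries the exceptional
     summand. *)
  rewrite -(cvg_shiftn 1) (_ : [sequence _]_n = fun n => 2 * expR (- t) *
      (\sum_(i < (d./2).+1) series (g (d - i.*2)%N) (n + 1)%N) + (-1) ^+ d.+1 * expR (- t)).
    apply: cvgD; last exact: cvg_cst.
    apply: cvgMr; apply: cvg_big => [|i _]; first exact: add_continuous.
    by rewrite (cvg_shiftn 1); exact: cvg_series_binomial.
  apply/funext => n; rewrite /series /= exchange_big /= big_distrr /=.
  rewrite (eq_bigr (fun i => 2 * expR (- t) * (\sum_(j < (d./2).+1) g (d - j.*2)%N i) +
     (i == 0%N)%:R * ((-1) ^+ d.+1 * expR (- t)))); last first.
    move=> i _; rewrite /f nb_chambersE mulrDl /g -big_distrl /=.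
    congr (_ + _); first by ring.
    by case: i => [|i]; rewrite ?mul0r//= fact0 divr1 expr0; ring.
  rewrite big_split /=; congr (_ + _).
  by rewrite addn1 big_nat_recl//= mul1r big1 ?addr0// => i _; rewrite mul0r.
apply: cvg_lim => //; rewrite (_ : (fun n => _) = EFin \o series f).
  by apply: cvg_EFin; [exact: nearW|exact: fE].
by apply/funext => n; rewrite /series /= sumEFin.
Qed.

End chamber_numbers.

Section poisson_tessellation.
Context {R : realType} {d : nat} (d0 : (0 < d)%N) {dO : measure_display}.
Context {Omega : measurableType dO} (P : probability Omega R).
Context (X' : R.-ker Omega ~> hyper R d) (hX' : random_tessellation X').
Context (X : R.-ker Omega ~> borel_vec R d).
Hypothesis hX : poisson_process P X (sphere R d).
Hypothesis Lam_fin : (intensity_measure P X (sphere R d) < +oo)%E.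
Hypothesis hXX' : hypersphere_tessellation X X'.

Lemma counting_points (s : seq (borel_vec R d)) (m : set (borel_vec R d) -> \bar R) :
  is_counting s m -> points m = [set` s].
Proof.
move=> ms; apply/seteqP; split => x /=; rewrite /points /= ms ?sum_dirac_count;
  do ?exact: measurable_point; rewrite eqe pnatr_eq0 -lt0n -has_count.
  by move=> /hasP[y ys /set_mem <-].
by move=> xs; apply/hasP; exists x => //; exact: mem_set.
Qed.

Lemma cells_of_points w (s : seq (borel_vec R d)) : is_counting s (X w) ->
  exists t : seq (hyper R d), [/\ tessellation t, is_counting t (X' w) &
    [set` t] = induced_cells [set` s]].
Proof.
move=> cs; have [t tt ct] := hX' w; exists t; split => //.
by rewrite -(counting_cells ct tt) hXX' (counting_points cs).
Qed.

Lemma gamma_poisson :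
  (forall w, sphere R d w -> intensity_measure P X (great_hypersphere w) = 0%E) ->
  gamma P X' = (h_fun d (fine (intensity_measure P X (sphere R d))))%:E.
Proof.
move=> hyp0; set t := fine _.
have [N nN hN] := poisson_simple_general hX Lam_fin hyp0 d0.
have mS := @measurable_sphere R d.
pose A n := [set w | X w (sphere R d) = n%:R%:E].
have mA n : measurable (A n) by exact: measurable_exactly.
(* A measurable function of the number of points that equals the number of cells whenever the points
   are simple and in general position. *)
pose F w : \bar R := (\sum_(n <oo) ((nb_chambers n d.+1)%:R%:E * (\1_(A n) w)%:E))%E.
have FE w k : A k w -> F w = (nb_chambers k d.+1)%:R%:E.
  move=> Ak; rewrite /F (@nneseriesD1 R _ k)//.
  rewrite eseries0 ?adde0 ?indicE ?mem_set ?mule1// => n _ /= nk.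
  rewrite indicE memNset ?mule0// => An; move: nk; apply/negP; rewrite negbK.
  by move: Ak An; rewrite /A /= => -> /eqP; rewrite eqe eqr_nat eq_sym.
have mf n : measurable_fun setT (fun w => ((nb_chambers n d.+1)%:R%:E * (\1_(A n) w)%:E : \bar R)%E).
  by apply: measurable_funeM; apply/measurable_EFinP; exact: measurable_indic.
have [N' [mN' N'0 NN']] := nN.
rewrite /gamma /intensity_measure (@ge0_ae_eq_integral_nomeas _ _ _ P N' _ F) //.
- rewrite integral_nneseries//.
  rewrite -poisson_mean_chambers; last exact: fine_ge0.
  apply: eq_eseriesr => n _; rewrite ge0_integralZl ?lee_fin//; last first.
    by apply/measurable_EFinP; exact: measurable_indic.
  rewrite integral_indic// setIT EFinM; congr (_ * _)%E; exact: poisson_pmf.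
- by apply: ge0_emeasurable_sum => // n w _; rewrite mule_ge0// lee_fin.
- by move=> w; apply: nneseries_ge0 => n _ _; rewrite mule_ge0// lee_fin.
move=> w nw; have [|s hs [cs us gs]] := hN w; first by move=> /NN'.
have [l [tl cl lE]] := cells_of_points cs.
rewrite (FE w (size s)).
  rewrite (counting_setT cl measurable_compacts); last first.
    by move=> K Kl; exact: Khat_compacts (tessellation_Khat tl Kl).
  congr (_%:R%:E).
  rewrite (induced_cells_count d0 (tessellation_uniq tl) lE).
  by rewrite (nb_realizable_gp gs).
rewrite /A /= cs// sum_dirac_count; congr (_%:R%:E).
by apply/eqP; rewrite -all_count; apply/allP => x /hs hx; exact: mem_set.
Qed.

End poisson_tessellation.

(** * Isotropic hypersphere tessellations *)

Section isotropic_intensity.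
Context {R : realType} {d : nat} (d0 : (0 < d)%N) {dO : measure_display}.
Context {Omega : measurableType dO} (P : probability Omega R).
Context (X' : R.-ker Omega ~> hyper R d) (hX' : random_tessellation X').
Context (X : R.-ker Omega ~> borel_vec R d).
Hypothesis hX : poisson_process P X (sphere R d).
Hypothesis Lam_fin : (intensity_measure P X (sphere R d) < +oo)%E.
Hypothesis hXX' : hypersphere_tessellation X X'.
Local Notation Lam := (intensity_measure P X).

Let cells_at (x : vec R d) : set (hyper R d) := [set K | compacts K /\ K x].

Lemma single_cell_event x : sphere R d x ->
  [set w | X' w (cells_at x) = 1%:E] = [set w | X w (great_hypersphere x) = 0%:R%:E].
Proof.
move=> hx; apply/funext => w /=; apply/propext.
have [s hs cs] := poisson_counting hX w.
have [t [tt ct tE]] := cells_of_points hX' hXX' cs.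
have nz q : q \in s -> q != 0 by move=> /hs; exact: sphere_neq0.
have := single_induced_cell d0 tt tE nz hx.
rewrite ct; last exact: measurable_mem.
rewrite cs; last exact: measurable_great_hypersphere.
rewrite !sum_dirac_count (eq_in_count (a2 := fun K => K \in cells_at x)); last first.
  move=> K Kt /=; apply/idP/idP => /set_mem h; apply/mem_set.
    by split => //; exact: Khat_compacts (tessellation_Khat tt Kt).
  by case: h.
move=> H; split.
  move=> [] /eqP; rewrite (eqr_nat R _ 1) => /eqP/H h.
  congr (_%:R%:E); apply/eqP; rewrite -leqn0 leqNgt -has_count; apply/hasPn => q qs.
  by apply/negP => /set_mem[_]; rewrite dotC; apply/eqP; exact: h.
move=> [] /eqP; rewrite eqr_nat => /eqP h; congr (_%:E).
apply/eqP; rewrite (eqr_nat R _ 1); apply/eqP/H => q qs.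
apply/negP => /eqP qx; move/eqP: h; apply/negP; rewrite -lt0n -has_count; apply/hasP.
by exists q => //; apply/mem_set; split; [exact: hs|rewrite dotC].
Qed.

(** A rotation taking x to y pulls the event for y back to the event for x. *)
Lemma isotropic_cells_at x y : isotropic P X' -> sphere R d x -> sphere R d y ->
  P [set w | X' w (cells_at x) = 1%:E] = P [set w | X' w (cells_at y) = 1%:E].
Proof.
move=> iso hx hy; have [rho hr e] := SO_transitive d0 hx hy.
have cE : counting_events [set m : set (hyper R d) -> \bar R | [set 1%:E] (m (cells_at y))].
  by apply: sub_sigma_algebra; exists (cells_at y); [exact: measurable_mem|exists [set 1%:E]].
have <- := iso rho hr _ cE; congr (P _); apply/funext => w /=.
rewrite /pushforward (_ : _ @^-1` _ = cells_at x)//.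
apply/funext => K; apply/propext.
rewrite /cells_at /= (rotset_compactsE _ hr) (rotsetE _ _ hr) -e mulmxA.
by have [-> _] := hr; rewrite mul1mx.
Qed.

(* The void probabilities of the two hyperspheres agree. *)
Lemma isotropic_hypersphere x y : isotropic P X' -> sphere R d x -> sphere R d y ->
  Lam (great_hypersphere x) = Lam (great_hypersphere y).
Proof.
move=> iso hx hy; have mx := @measurable_great_hypersphere R d x.
have my := @measurable_great_hypersphere R d y.
have px := poisson_pmf hX Lam_fin 0 mx; have py := poisson_pmf hX Lam_fin 0 my.
have := isotropic_cells_at iso hx hy; rewrite (single_cell_event hx) (single_cell_event hy).
move=> h; have := etrans (etrans (esym px) h) py.
have fx := poisson_fin_num hX Lam_fin mx; have fy := poisson_fin_num hX Lam_fin my.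
rewrite -[X in _ -> X = _](fineK fx) -[X in _ -> _ = X](fineK fy); clear.
move: (fine _) (fine _) => a b; rewrite !expr0 !mulr1 !divr1.
by move=> /(congr1 fine) /= /expR_inj /oppr_inj ->.
Qed.

Definition moment_point (n : nat) : vec R d := normalize (\col_(i < d.+1) n%:R ^+ i).

Lemma moment_vector_neq0 n : \col_(i < d.+1) (n%:R : R) ^+ i != 0.
Proof.
apply/eqP => /matrixP/(_ 0 0); rewrite !mxE expr0 => /eqP.
by rewrite oner_eq0.
Qed.

Lemma sphere_moment_point n : sphere R d (moment_point n).
Proof. by apply: sphere_normalize; exact: moment_vector_neq0. Qed.

(** y is orthogonal to [moment_point n] iff n is a root of the polynomial whose coefficients are the
    coordinates of y; it is non-zero of degree at most d. *)
Lemma moment_hyperspheres (N : nat) y : sphere R d y ->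
  (count (fun n => y \in great_hypersphere (moment_point n)) (iota 0 N) <= d)%N.
Proof.
move=> hy; pose p := \poly_(i < d.+1) y (inord i) 0.
have p0 : p != 0.
  apply/eqP => pe; have /eqP := sphere_neq0 hy; apply.
  apply/colP => i; rewrite mxE.
  by have := congr1 (fun q : {poly R} => q`_i) pe; rewrite coef_poly ltn_ord inord_val coef0.
rewrite -size_filter -(size_map (fun n => n%:R : R)) -ltnS.
apply: leq_trans (size_poly d.+1 (fun i => y (inord i) 0)).
apply: max_poly_roots => //; last first.
  by rewrite map_inj_uniq ?filter_uniq ?iota_uniq// => a b /eqP; rewrite eqr_nat => /eqP.
apply/allP => _ /mapP[n + ->]; rewrite mem_filter => /andP[/set_mem[_ +] _].
rewrite dotC dot_normalize => /eqP; rewrite mulf_eq0 invr_eq0 enorm_eq0.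
rewrite (negbTE (moment_vector_neq0 n)) => /eqP h.
apply/rootP; rewrite horner_poly -[RHS]h dotE; apply: eq_bigr => i _.
by rewrite mxE inord_val.
Qed.

Lemma isotropic_hypersphere0 x : isotropic P X' -> sphere R d x ->
  Lam (great_hypersphere x) = 0%E.
Proof.
move=> iso hx; have mg y := @measurable_great_hypersphere R d y.
pose a := fine (Lam (great_hypersphere x)); pose L := fine (Lam (sphere R d)).
have aE n : Lam (great_hypersphere (moment_point n)) = a%:E.
  by rewrite (isotropic_hypersphere iso (sphere_moment_point n) hx) fineK// (poisson_fin_num hX).
have a0 : 0 <= a by exact: fine_ge0.
have Na N : N%:R * a <= d%:R * L.
  rewrite -lee_fin EFinM.
  (* N a is the integral over y of the number of the first N hyperspheres that contain y, which is
     at most d. *)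
  have -> : (N%:R%:E * a%:E = \int[Lam]_y \sum_(n <- iota 0 N) (\1_(great_hypersphere (moment_point n)) y)%:E)%E.
    rewrite ge0_integral_sum//; last first.
      by move=> n; apply/measurable_EFinP; exact: measurable_indic.
    rewrite (eq_bigr (fun _ => a%:E)); last first.
      by move=> n _; rewrite integral_indic// setIT; exact: aE.
    by rewrite sumEFin big_const_seq count_predT size_iota iter_addr addr0 -EFinM mulr_natl.
  have -> : ((d%:R * L)%:E = \int[Lam]_y (cst d%:R%:E y))%E.
    rewrite integral_cst// EFinM /L fineK ?(poisson_fin_num hX)//; last exact: measurable_sphere.
    by rewrite -(poisson_setT hX).
  apply: ge0_le_integral_nomeas => y.
    by apply: sume_ge0 => n _; rewrite lee_fin.
  rewrite sumEFin lee_fin /=; have [hy|hy] := pselect (sphere R d y).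
    rewrite (eq_bigr (fun n => (y \in great_hypersphere (moment_point n))%:R))//.
    rewrite -natr_sum ler_nat (leq_trans _ (moment_hyperspheres N hy))//.
    by rewrite -sum1_count [leqRHS]big_mkcond; apply: leq_sum => n _; case: (_ \in _).
  rewrite big1 ?ler0n// => n _; rewrite indicE memNset// => -[] //.
have ae : a = 0.
  apply/eqP; rewrite eq_le a0 andbT leNgt; apply/negP => ap.
  have := Na (Num.truncn (d%:R * L / a)).+1; apply/negP; rewrite -ltNge.
  rewrite -ltr_pdivrMr//; exact: truncnS_gt.
by rewrite (isotropic_hypersphere iso hx (sphere_moment_point 0)) aE ae.
Qed.

End isotropic_intensity.

Section sigma_sph_intensity.
Context {R : realType} {d : nat}.

Lemma sigma_sph_great_hypersphere (w : vec R d) : sphere R d w ->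
  sigma_sph (great_hypersphere w) = 0%E.
Proof.
by move=> /sphere_neq0 w0; apply: (sigma_sph_hyperplane w0) => x [].
Qed.

End sigma_sph_intensity.

(** The formula for the mean number of cells appears three times, according to what makes great
    hyperspheres null: isotropy of the tessellation, an assumption on the intensity measure, or its
    being a multiple of the surface measure. *)
Theorem theorem9p5 (R : realType) (d : nat) (hd : (2 <= d)%N)
    (dO : measure_display) (Omega : measurableType dO)
    (P : probability Omega R) (X' : R.-ker Omega ~> hyper R d)
    (hX' : random_tessellation X') :
  (isotropic P X' -> (0 < gamma P X' < +oo)%E ->
    (forall (f : hyper R d -> R) (p : vec R d)
        (lambda : probability (borelM R d.+1 d.+1) R)
        (kappa : vec R d -> probability (borelM R d.+1 d.+1) R)
        (c : hyper R d -> borel_vec R d)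
        (dO' : measure_display) (Omega' : measurableType dO')
        (P' : probability Omega' R) (Z : Omega' -> hyper R d),
      measurable_fun (@Khat R d) f ->
      (forall K, Khat K -> 0 <= f K) ->
      (forall rho K, SO R d rho -> Khat K -> f (rotset rho K) = f K) ->
      sphere R d p ->
      haar_probability (SO R d) lambda ->
      rotation_kernel lambda p kappa ->
      centre_function c ->
      typical_cell P P' kappa c X' Z ->
      (\int[P]_w (f (crofton_cell p (X' w)))%:E =
       gamma P X' * \int[P']_w ((f (Z w))%:E * sigma_sph (Z w)))%E)
    /\
    (forall X : R.-ker Omega ~> borel_vec R d,
      poisson_process P X (sphere R d) ->
      (0 < intensity_measure P X (sphere R d) < +oo)%E ->
      (forall x, sphere R d x -> intensity_measure P X [set x] = 0%E) ->
      hypersphere_tessellation X X' ->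
      (gamma P X' = (h_fun d (fine (intensity_measure P X (sphere R d))))%:E)%E))
  /\
  (forall X : R.-ker Omega ~> borel_vec R d,
      poisson_process P X (sphere R d) ->
      (0 < intensity_measure P X (sphere R d) < +oo)%E ->
      (forall x, sphere R d x ->
         intensity_measure P X (great_hypersphere x) = 0%E) ->
      hypersphere_tessellation X X' ->
      (gamma P X' = (h_fun d (fine (intensity_measure P X (sphere R d))))%:E)%E)
  /\
  (forall (X : R.-ker Omega ~> borel_vec R d) (gamma_s : R),
      0 < gamma_s ->
      poisson_process P X (sphere R d) ->
      (forall A, measurable A ->
         intensity_measure P X A = (gamma_s%:E * sigma_sph A)%E) ->
      hypersphere_tessellation X X' ->
      gamma P X' = (h_fun d gamma_s)%:E).
Proof.
have d0 : (0 < d)%N by exact: ltnW.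
split; [move=> iso gam; split|split].
- move=> f p lambda kappa c dO' Omega' P' Z mf f0 frot hp hl hk hc hZ.
  exact: (@crofton_formula _ _ _ _ P X' f p lambda kappa c).
- move=> X hX /andP[_ Xoo] _ hXX'; apply: gamma_poisson => // w.
  by apply: isotropic_hypersphere0; [exact: d0|exact: hX'|exact: hX|exact: Xoo|exact: hXX'|exact: iso].
- move=> X hX /andP[_ Xoo] hyp0 hXX'; exact: gamma_poisson.
- move=> X g g0 hX hLam hXX'.
  have e : intensity_measure P X (sphere R d) = g%:E.
    by rewrite hLam ?sigma_sph_sphere ?mule1//; exact: measurable_sphere.
  rewrite -[g in RHS]/(fine g%:E) -e; apply: gamma_poisson => //; first by rewrite e ltry.
  move=> w hw; rewrite hLam ?sigma_sph_great_hypersphere ?mule0//.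
  exact: measurable_great_hypersphere.
Qed.
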